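(* Let $\phi_1,\phi_2$ be inner functions on $\mathbb{D}$ such that $[P_{\phi_1},P_{\phi_2}]$ is a finite-rank operator, and let $\phi=\gcd(\phi_1,\phi_2)$. Then $(P_{\phi_1},P_{\phi_2})$ is a Fredholm pair if and only if both $\phi_1/\phi$ and $\phi_2/\phi$ are finite Blaschke products. Moreover, in this case, $$\operatorname{index}(P_{\phi_1},P_{\phi_2})=\deg(\phi_2/\phi)-\deg(\phi_1/\phi).$$
   Context: $\mathbb{D}$ is the open unit disc, $\mathbb{T}$ the unit circle, $H^2(\mathbb{D})$ the Hardy space. An inner function is a bounded analytic function $\phi$ on $\mathbb{D}$ with $|\phi|=1$ a.e. on $\mathbb{T}$. For an inner function $\theta$, $P_\theta$ denotes the orthogonal projection of $H^2(\mathbb{D})$ onto the closed subspace $\theta H^2(\mathbb{D})$. $[P,Q]=PQ-QP$. $\gcd(\phi_1,\phi_2)$ is the greatest inner function dividing both $\phi_1$ and $\phi_2$ (a common inner divisor divisible by every common inner divisor), unique up to a unimodular constant. A finite Blaschke product is a function $\zeta\prod_{i=1}^n\frac{z-a_i}{1-\overline{a_i}z}$ with $\zeta\in\mathbb{T}$, $n\ge 0$, $a_i\in\mathbb{D}$ (unimodular constants are included, $n=0$); its degree is the number $n$ of its zeros in $\mathbb{D}$ counted with multiplicity. A pair $(P,Q)$ of orthogonal projections on a separable Hilbert space is a Fredholm pair if $QP$, viewed as a map from $\operatorname{ran}P$ to $\operatorname{ran}Q$, is a Fredholm operator; $\operatorname{index}(P,Q)$ is the Fredholm index of this map, equivalently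 $\dim\ker(P-Q-I)-\dim\ker(P-Q+I)$. *)

(* Defs.v *)
From mathcomp Require Import all_boot all_order all_algebra.
From mathcomp Require Import all_classical all_reals all_analysis.
From mathcomp Require Import complex.

Set Implicit Arguments.
Unset Strict Implicit.
Unset Printing Implicit Defensive.

Import Order.TTheory GRing.Theory Num.Theory.
Import numFieldNormedType.Exports.

Local Open Scope classical_set_scope.
Local Open Scope ring_scope.

(* R[i] behind a constant of type numClosedFieldType: the topology and the
   norm (the modulus, with values in the nonnegative reals of R[i]) are
   declared for that structure only. *)
Definition cplx (R : realType) : numClosedFieldType := R[i].

Section LinearAlgebra.
Variables (K : fieldType) (E : lmodType K).
Implicit Types V W : set E.

(* For subspaces W `<=` V of E, e induces a basis of V / W. With W = 0 it is a
   basis of V. *)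
Definition quotient_basis V W n (e : 'I_n -> E) : Prop :=
  [/\ forall i, V (e i),
      forall x, V x -> exists c : 'I_n -> K, W (x - \sum_i c i *: e i)
    & forall c : 'I_n -> K, W (\sum_i c i *: e i) -> forall i, c i = 0].

Definition findim_mod V W : Prop :=
  exists n, exists e : 'I_n -> E, quotient_basis V W e.

(* Dimension of V / W, with value 0 if it is infinite. *)
Definition dim_mod V W : nat :=
  xget 0%N [set n | exists e : 'I_n -> E, quotient_basis V W e].

Definition findim V : Prop := findim_mod V [set 0].
Definition dim V : nat := dim_mod V [set 0].

End LinearAlgebra.

Section Hardy.
Variable R : realType.
Let C := cplx R.
Implicit Types (f g h phi psi theta : C -> C) (M N : set (C -> C)).

Definition disc : set C := [set z | `|z| < 1].

Definition expi (t : R) : C := (cos t +i* sin t)%C.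

(* f is analytic on the disc with Taylor coefficients a at 0; the values of f
   outside the disc are irrelevant. *)
Definition has_taylor f (a : nat -> C) : Prop :=
  forall z, disc z -> series (fun n => a n * z ^+ n) @ \oo --> f z.

Definition analytic_disc f : Prop := exists a, has_taylor f a.

Definition taylor f : nat -> C := xget (cst 0) [set a | has_taylor f a].

(* The boundary value at expi t is the radial limit. *)
Definition inner theta : Prop :=
  [/\ analytic_disc theta,
      exists B : C, forall z, disc z -> `|theta z| <= B
    & {ae (@lebesgue_measure R), forall t : R, t \in `[0, pi *+ 2] ->
        exists2 l : C, `|l| = 1 &
          theta (r%:C%C * expi t) @[r --> (1 : R)^'-] --> l}].

Definition inner_dvd psi phi : Prop :=
  exists2 h, inner h & forall z, disc z -> phi z = psi z * h z.

Definition inner_gcd phi1 phi2 phi : Prop :=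
  [/\ inner phi, inner_dvd phi phi1, inner_dvd phi phi2
    & forall psi, inner psi -> inner_dvd psi phi1 -> inner_dvd psi phi2 ->
        inner_dvd psi phi].

(* The inner function phi / psi, when psi divides phi. The pointwise quotient
   would have the wrong value at the zeros of psi, where the singularity has to
   be removed. *)
Definition inner_quot phi psi : C -> C :=
  xget (cst 0) [set h | inner h /\ forall z, disc z -> phi z = psi z * h z].

Definition blaschke_product n f : Prop :=
  exists (zeta : C) (a : 'I_n -> C),
    [/\ `|zeta| = 1, forall i, disc (a i)
      & forall z, disc z ->
          f z = zeta * \prod_i ((z - a i) / (1 - (a i)^* * z))].

Definition finite_blaschke f : Prop := exists n, blaschke_product n f.

Definition blaschke_degree f : nat := xget 0%N [set n | blaschke_product n f].

(* The Hardy space, as a subspace of the space of all functions C -> C. Its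
   elements are extended by 0 outside the disc, so that they are equal as
   functions exactly when they agree on the disc. *)
Definition hardy : set (C -> C) :=
  [set f | (exists2 a, has_taylor f a & cvgn (series (fun n => `|a n| ^+ 2)))
           /\ forall z, ~ disc z -> f z = 0].

Definition hardy_dot f g : C :=
  limn (series (fun n => taylor f n * (taylor g n)^*)).

Definition orth_proj M f : C -> C :=
  xget 0 [set g | M g /\ forall h, M h -> hardy_dot (f - g) h = 0].

(* The projection of the Hardy space onto theta * hardy. *)
Definition inner_proj theta : (C -> C) -> (C -> C) :=
  orth_proj [set theta * f | f in hardy].

Definition commutator (P Q : (C -> C) -> (C -> C)) f : C -> C :=
  P (Q f) - Q (P f).

Definition finite_rank (T : (C -> C) -> (C -> C)) : Prop :=
  findim (T @` hardy).

(* T is a bounded linear map between the closed subspaces M and N of the Hardy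
   space, and it is Fredholm: the range of T is automatically closed when its
   codimension in N is finite. *)
Definition fredholm M N (T : (C -> C) -> (C -> C)) : Prop :=
  [/\ forall f, M f -> N (T f),
      forall (c : C) f g, M f -> M g -> T (c *: f + g) = c *: T f + T g,
      exists B : C, forall f, M f ->
        hardy_dot (T f) (T f) <= B * hardy_dot f f,
      findim [set f | M f /\ T f = 0]
    & findim_mod N (T @` M)].

Definition fredholm_index M N (T : (C -> C) -> (C -> C)) : int :=
  (dim [set f | M f /\ T f = 0])%:Z - (dim_mod N (T @` M))%:Z.

Definition fredholm_pair (P Q : (C -> C) -> (C -> C)) : Prop :=
  fredholm (P @` hardy) (Q @` hardy) (Q \o P).

Definition pair_index (P Q : (C -> C) -> (C -> C)) : int :=
  fredholm_index (P @` hardy) (Q @` hardy) (Q \o P).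

End Hardy.

(* Main.v *)
(* Write phi_i = phi psi_i, M_i = phi_i H^2 and P_i for the projection onto
   M_i.

   Suppose that the pair is Fredholm. On the subspace of M_1 where the
   commutator vanishes, which has finite codimension in M_1, P_2 maps into
   M_1 /\ M_2, and its kernel on M_1 is finite-dimensional; so M_1 /\ M_2
   has finite codimension in M_1, and likewise in M_2. Hence N = {f | psi_1
   f \in psi_2 H^2} is a z-invariant subspace of finite codimension. If N is
   proper, multiplication by z on H^2 / N has an eigenvalue, and the
   representing vector of the corresponding functional has geometric Taylor
   coefficients; being square-summable it is a multiple of a reproducing
   kernel, so the elements of N have a common zero in the disc. That zero is
   a zero of psi_2, and dividing psi_2 by its Blaschke factor lowers the
   codimension of N by at least one. When N is all of H^2, what is left of
   psi_2 divides psi_1, so it is constant because phi is the greatest common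
   divisor, and psi_2 is a finite Blaschke product.

   Conversely, P_2 P_1 restricted to M_1 is unitarily equivalent to psi_1
   H^2 -> H^2, g |-> M_{psi_2}^* g. If psi_1 H^2 has codimension n_1 and the
   kernel K of M_{psi_2}^* has dimension n_2, then its kernel and cokernel
   are those of the map K -> H^2 / psi_1 H^2, and the index is n_2 - n_1.

   The only boundary-value argument is the fact that multiplication by an
   inner function is isometric on polynomials, which follows from Parseval's
   identity on the circles of radius r < 1 and dominated convergence as r
   tends to 1. *)
Require Import Defs.
From mathcomp Require Import all_boot all_order all_algebra.
From mathcomp Require Import all_classical all_reals all_analysis.
From mathcomp Require Import measurable_realfun complex spectral ring lra.

Set Implicit Arguments.
Unset Strict Implicit.
Unset Printing Implicit Defensive.

Import Order.TTheory GRing.Theory Num.Theory.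
Import numFieldNormedType.Exports.

Local Open Scope classical_set_scope.
Local Open Scope ring_scope.

(** * Quotients of finite dimension *)

Section QuotientBases.
Variables (K : fieldType) (E : lmodType K).
Implicit Types V W : set E.

(** In the forward direction, finite codimension is carried as a bound on the length of families
    that are independent modulo [N]. Such a bound follows from finitely many linear conditions that
    force membership in [N], and the induction that strips Blaschke factors runs on it. A
    finite-rank operator supplies such conditions because a vector in the span of [t_1, ..., t_k]
    vanishes as soon as it is orthogonal to every [t_i]. The two inclusions need different
    arguments: one uses the kernel of [P_2 P_1], the other its cokernel, through the orthogonality
    of [x - P_1 x] to [M_1].

    Operators on [H^2] are built by hand: the adjoint of a multiplication is given by its
    coefficients, and a projection is the multiplication composed with its adjoint. The isometry of
    multiplication by an inner function has three further uses: an inner factor can be cancelled in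
    spite of its zeros, inner functions are bounded by 1, and an [H^2] quotient of inner functions
    is inner. *)

Definition is_subspace V := V 0 /\ forall c x y, V x -> V y -> V (c *: x + y).

Definition linear_on (F : lmodType K) V (q : E -> F) :=
  forall c x y, V x -> V y -> q (c *: x + y) = c *: q x + q y.

Definition indep_mod W n (e : 'I_n -> E) :=
  forall c : 'I_n -> K, W (\sum_i c i *: e i) -> forall i, c i = 0.

Lemma subspaceZ V c x : is_subspace V -> V x -> V (c *: x).
Proof. by move=> [V0 VL] Vx; rewrite -[_ *: _]addr0; exact: VL. Qed.

Lemma subspaceD V x y : is_subspace V -> V x -> V y -> V (x + y).
Proof. by move=> [V0 VL] Vx Vy; rewrite -[x]scale1r; exact: VL. Qed.

Lemma subspaceB V x y : is_subspace V -> V x -> V y -> V (x - y).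
Proof.
by move=> [V0 VL] Vx Vy; rewrite addrC -scaleN1r; exact: VL.
Qed.

Lemma subspace_sum V n (c : 'I_n -> K) (e : 'I_n -> E) :
  is_subspace V -> (forall i, V (e i)) -> V (\sum_i c i *: e i).
Proof.
move=> sV Ve; elim/big_ind: _ => [|x y|i _]; first by case: sV.
  exact: subspaceD.
exact: subspaceZ.
Qed.

Lemma linear_on0 (F : lmodType K) V (q : E -> F) :
  is_subspace V -> linear_on V q -> q 0 = 0.
Proof.
move=> [V0 _] qL; have /eqP := qL 1 0 0 V0 V0.
by rewrite !scale1r addr0 -{1}[q 0]addr0 (inj_eq (addrI _)) eq_sym => /eqP.
Qed.

Lemma linear_onD (F : lmodType K) V (q : E -> F) x y :
  linear_on V q -> V x -> V y -> q (x + y) = q x + q y.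
Proof. by move=> qL Vx Vy; rewrite -{1}[x]scale1r qL // scale1r. Qed.

Lemma linear_onB (F : lmodType K) V (q : E -> F) x y :
  linear_on V q -> V x -> V y -> q (x - y) = q x - q y.
Proof.
by move=> qL Vx Vy; rewrite addrC -scaleN1r qL // scaleN1r addrC.
Qed.

Lemma linear_on_sum (F : lmodType K) V (q : E -> F) n (c : 'I_n -> K)
    (e : 'I_n -> E) : is_subspace V -> linear_on V q -> (forall i, V (e i)) ->
  q (\sum_i c i *: e i) = \sum_i c i *: q (e i).
Proof.
move=> sV qL Ve; elim: n c e Ve => [|n IH] c e Ve.
  by rewrite !big_ord0; exact: linear_on0 sV qL.
rewrite !big_ord_recl qL //; last exact: subspace_sum.
by rewrite IH.
Qed.

(** A relation among the rows [l (e i)] gives a combination of the [e i] killed by [l], hence in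
    [W], hence trivial; so these [m] rows are free in a space of dimension [n]. *)
Lemma indep_mod_leq V W n (l : E -> 'rV[K]_n) m (e : 'I_m -> E) :
  is_subspace V -> linear_on V l -> (forall x, V x -> l x = 0 -> W x) ->
  (forall i, V (e i)) -> indep_mod W e -> (m <= n)%N.
Proof.
move=> sV lL lW Ve ind.
pose A := \matrix_(i < m) l (e i).
have frA : row_free A.
  apply/inj_row_free => y yA0; apply/rowP => i; rewrite mxE.
  apply: (ind (fun i => y 0 i)); apply: lW; first exact: subspace_sum.
  rewrite (linear_on_sum _ sV lL Ve) -[RHS]yA0 mulmx_sum_row.
  by apply: eq_bigr => j _; rewrite rowK.
by rewrite -(eqP frA); exact: rank_leq_col.
Qed.

(** A family of maximal length is a basis of the quotient: a vector outside its span modulo [W]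
    could be prepended without losing independence. *)
Lemma findim_mod_bound V W n : is_subspace V -> is_subspace W ->
  (forall m (e : 'I_m -> E), (forall i, V (e i)) -> indep_mod W e ->
    (m <= n)%N) -> findim_mod V W.
Proof.
move=> sV sW bnd.
pose P m := `[< exists e : 'I_m -> E, (forall i, V (e i)) /\ indep_mod W e >].
have exP : exists m, P m.
  exists 0%N; apply/asboolP; exists (fun=> 0).
  by split => [i|c _ i]; [case: sV | case: i].
have Pn m : P m -> (m <= n)%N by move=> /asboolP [e [Ve]]; exact: bnd.
case: (ex_maxnP exP Pn) => m /asboolP[e [Ve ind]] mmax.
exists m, e; split => // x Vx; apply: contrapT => nx.
suff /mmax : P m.+1 by rewrite ltnn.
apply/asboolP; exists (fun i => oapp e x (unlift ord0 i)); split.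
  by move=> i; case: unliftP => [j|] _ //=.
move=> c; rewrite big_ord_recl unlift_none /=.
under eq_bigr do rewrite liftK /=.
move=> Wc.
(* A nonzero coefficient of [x] could be divided out, which would put [x] in the span modulo [W],
   against [nx]. *)
have c0 : c ord0 = 0.
  apply/eqP/negPn/negP => c0; apply: nx.
  exists (fun i => - ((c ord0)^-1 * c (lift ord0 i))).
  have := subspaceZ (c ord0)^-1 sW Wc.
  rewrite scalerDr scalerA mulVf // scale1r scaler_sumr -sumrN.
  congr (W (_ + _)); apply: eq_bigr => i _.
  by rewrite scaleNr opprK scalerA.
move=> i; case: (unliftP ord0 i) => [j|] -> //.
by move: Wc; rewrite c0 scale0r add0r => /ind; exact.
Qed.

Lemma quotient_basis_coords V W n (e : 'I_n -> E) :
  is_subspace V -> is_subspace W -> quotient_basis V W e ->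
  exists q : E -> 'rV[K]_n,
    [/\ linear_on V q, forall x, V x -> (W x <-> q x = 0),
        forall i, q (e i) = delta_mx 0 i
      & forall x, V x -> W (x - \sum_i q x 0 i *: e i)].
Proof.
move=> sV sW [Ve gen ind].
(* Outside [V] the coordinates are junk, set to 0 so that the choice can be made on all of [E]. On
   [V] independence makes them unique, and uniqueness gives linearity. *)
have ex x : exists v : 'rV[K]_n, V x -> W (x - \sum_i v 0 i *: e i).
  have [/gen[c Wc]|nVx] := pselect (V x); last by exists 0.
  exists (\row_i c i) => _.
  by under eq_bigr do rewrite mxE.
have [q qP] := choice ex.
have uniq x (v : 'rV_n) : V x -> W (x - \sum_i v 0 i *: e i) -> q x = v.
  move=> Vx Wv; apply/rowP => i; apply/eqP; rewrite -subr_eq0; apply/eqP.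
  apply: (ind (fun i => q x 0 i - v 0 i)).
  have := subspaceB sW Wv (qP _ Vx); congr W.
  under [in RHS]eq_bigr do rewrite scalerBl.
  by rewrite sumrB opprB [LHS]addrC addrA subrK.
exists q; split => //.
- move=> c x y Vx Vy; apply: uniq; first by case: sV => _; exact.
  have := (proj2 sW) c _ _ (qP _ Vx) (qP _ Vy); congr W.
  under [in RHS]eq_bigr do rewrite !mxE scalerDl -scalerA.
  by rewrite big_split /= -scaler_sumr scalerBr opprD addrACA.
- move=> x Vx; split => [Wx|qx0].
    apply: uniq => //; under eq_bigr do rewrite mxE scale0r.
    by rewrite big1 // subr0.
  have := qP _ Vx; rewrite qx0; under eq_bigr do rewrite mxE scale0r.
  by rewrite big1 // subr0.
move=> i; apply: uniq => //.
rewrite (bigD1 i) //= mxE !eqxx scale1r big1 ?addr0 ?subrr; first by case: sW.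
by move=> j ji; rewrite mxE (negbTE ji) andbF scale0r.
Qed.

Lemma quotient_basis_leq V W n (e : 'I_n -> E) m (f : 'I_m -> E) :
  is_subspace V -> is_subspace W -> quotient_basis V W e ->
  (forall i, V (f i)) -> indep_mod W f -> (m <= n)%N.
Proof.
move=> sV sW /(quotient_basis_coords sV sW)[q [qL qW _ _]] Vf.
by apply: indep_mod_leq sV qL _ Vf => x Vx /qW; exact.
Qed.

(** Two bases bound each other's length, so the value picked by [xget] does not depend on the
    choice. *)
Lemma dim_modE V W n (e : 'I_n -> E) :
  is_subspace V -> is_subspace W -> quotient_basis V W e -> dim_mod V W = n.
Proof.
move=> sV sW eb; rewrite /dim_mod.
case: xgetP => [m _ [f fb]|/(_ n)[]]; last by exists e.
have [Ve _ ie] := eb; have [Vf _ iF] := fb.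
apply/eqP; rewrite eqn_leq (quotient_basis_leq sV sW eb Vf iF).
exact: quotient_basis_leq fb Ve ie.
Qed.

Lemma quotient_basis_surj V W n (q : E -> 'rV[K]_n) :
  is_subspace V -> is_subspace W -> linear_on V q ->
  (forall x, V x -> (W x <-> q x = 0)) ->
  (forall v, exists2 x, V x & q x = v) ->
  exists e : 'I_n -> E, quotient_basis V W e.
Proof.
move=> sV sW qL qW qS.
have ex i : exists x, V x /\ q x = delta_mx 0 i.
  by have [x] := qS (delta_mx 0 i); exists x.
have [e eP] := choice ex.
have Ve i : V (e i) by case: (eP i).
have qs c : q (\sum_i c i *: e i) = \row_i c i.
  rewrite (linear_on_sum _ sV qL Ve) [RHS]row_sum_delta.
  by apply: eq_bigr => i _; rewrite mxE (proj2 (eP i)).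
exists e; split => //.
  move=> x Vx; exists (fun i => q x 0 i); apply/qW.
    by apply: subspaceB => //; exact: subspace_sum.
  rewrite (linear_onB qL) //; last exact: subspace_sum.
  by rewrite qs; apply/rowP => i; rewrite !mxE subrr.
move=> c /qW; rewrite qs => /(_ (subspace_sum _ sV Ve)) /rowP c0 i.
by have := c0 i; rewrite !mxE.
Qed.

(* The map [L -> V / W] between finite-dimensional spaces has kernel [W `&` L]
   and cokernel [V / (W + L)]. *)
Lemma quotient_basis_index V W (L : set E) n m (e : 'I_n -> E) (k : 'I_m -> E) :
  is_subspace V -> is_subspace W -> is_subspace L -> W `<=` V -> L `<=` V ->
  quotient_basis V W e -> quotient_basis L [set 0] k ->
  exists d d' : nat,
    [/\ exists f : 'I_d -> E, quotient_basis (W `&` L) [set 0] f,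
        exists g : 'I_d' -> E,
          quotient_basis V [set x | exists2 y, L y & W (x - y)] g
      & (d%:Z - d'%:Z = m%:Z - n%:Z)%R].
Proof.
move=> sV sW sL WV LV eb kb.
have s0 : is_subspace [set (0 : E)].
  by split => // c x y -> ->; rewrite scaler0 addr0.
have [q [qL qW qe _]] := quotient_basis_coords sV sW eb.
have [p [pL pW pk pg]] := quotient_basis_coords sL s0 kb.
have [Lk _ _] := kb; have [Ve _ _] := eb.
(* Matrix of [L -> V / W] in the two bases; vectors are rows, so the map is right multiplication by
   [D]. *)
pose D := \matrix_(i < m) q (k i).
have qp x : L x -> q x = p x *m D.
  move=> Lx; have := pg _ Lx => /= /eqP; rewrite subr_eq0 => /eqP {1}->.
  rewrite (linear_on_sum _ sV qL) ?mulmx_sum_row; last by move=> i; exact: LV.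
  by apply: eq_bigr => i _; rewrite rowK.
have pS (v : 'rV_m) : exists2 x, L x & p x = v.
  exists (\sum_i v 0 i *: k i); first exact: subspace_sum.
  rewrite (linear_on_sum _ sL pL Lk) [RHS]row_sum_delta.
  by apply: eq_bigr => i _; rewrite pk.
have qS (v : 'rV_n) : exists2 x, V x & q x = v.
  exists (\sum_i v 0 i *: e i); first exact: subspace_sum.
  rewrite (linear_on_sum _ sV qL Ve) [RHS]row_sum_delta.
  by apply: eq_bigr => i _; rewrite qe.
(* These ranks are [m - \rank D] and [n - \rank D], so the rank of [D] cancels in the difference. *)
exists (\rank (kermx D)), (\rank (cokermx D)); split.
- have sWL : is_subspace (W `&` L).
    case: sW sL => [W0 WD] [L0 LD].
    by split=> [//|c x y [Wx Lx] [Wy Ly]]; split; [exact: WD|exact: LD].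
  have WLE x : L x -> W x <-> (p x <= kermx D)%MS.
    move=> Lx; split=> [/(qW _ (LV _ Lx)) qx0|/sub_kermxP px].
      by apply/sub_kermxP; rewrite -qp.
    by apply/(qW _ (LV _ Lx)); rewrite qp.
  (* The rows of [row_base (kermx D)] form a basis of the kernel, and [pinvmx] reads off coordinates
     in it. *)
  apply: (quotient_basis_surj (q := fun x =>
    p x *m pinvmx (row_base (kermx D))))
    => //.
  + by move=> c x y [_ Lx] [_ Ly]; rewrite pL // mulmxDl scalemxAl.
  + move=> x [/[dup] Wx + Lx] => /(WLE _ Lx) px.
    rewrite (pW _ Lx); split=> [->|px0]; first by rewrite mul0mx.
    rewrite -(@mulmxKpV _ _ _ _ (p x) (row_base (kermx D))) ?eq_row_base //.
    by rewrite px0 mul0mx.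
  + move=> v; have [x Lx px] := pS (v *m row_base (kermx D)).
    exists x; last by rewrite px -mulmxA mulmxVp ?row_base_free // mulmx1.
    split=> //; apply/(WLE _ Lx).
    by rewrite px -(eq_row_base (kermx D)) submxMl.
- have sWL : is_subspace [set x | exists2 y, L y & W (x - y)].
    case: (sW) (sL) => [W0 WD] [L0 LD]; split; first by exists 0;
      rewrite ?subr0.
    move=> c x y [x' Lx' Wx] [y' Ly' Wy]; exists (c *: x' + y');
      first exact: LD.
    by rewrite opprD addrACA -scalerBr; exact: WD.
  (* A row lies in the row space of [D] exactly when [cokermx D] kills it; keeping only independent
     columns makes the map onto. *)
  apply: (quotient_basis_surj (q := fun x => q x *m col_base (cokermx D))) =>
    //.
  + by move=> c x y Vx Vy; rewrite qL // mulmxDl scalemxAl.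
  + move=> x Vx.
    have -> : q x *m col_base (cokermx D) = 0 <-> (q x <= D)%MS.
      rewrite submxE -[X in _ *m X == _]mulmx_base mulmxA; split=> [->|].
        by rewrite mul0mx.
      move=> /eqP h; apply: (row_free_inj (row_base_free (cokermx D))).
      by rewrite h mul0mx.
    split=> [[y Ly Wxy]|/submxP[u qx]].
      have /(qW _ (subspaceB sV Vx (LV _ Ly))) := Wxy.
      rewrite (linear_onB qL Vx (LV _ Ly)) => /eqP; rewrite subr_eq0 => /eqP ->.
      by rewrite qp // submxMl.
    have [y Ly py] := pS u; exists y => //.
    apply/(qW _ (subspaceB sV Vx (LV _ Ly))).
    by rewrite (linear_onB qL Vx (LV _ Ly)) (qp y) // py qx subrr.
  + move=> v; have [x Vx qx] := qS (v *m pinvmx (col_base (cokermx D))).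
    by exists x => //; rewrite qx -mulmxA mulVpmx ?col_base_full // mulmx1.
rewrite mxrank_ker mxrank_coker -!subzn ?rank_leq_row ?rank_leq_col //.
by rewrite opprB addrA subrK.
Qed.

End QuotientBases.

(** * Complex limits and series *)

Section ComplexModulus.
Variable R : realType.
Notation C := (cplx R).
Implicit Types (z w : C) (x : R).

(** The modulus on [cplx R] is itself complex-valued. The real-valued [nrm] and [sqn] bring
    estimates back to [R], where suprema, integrals and a total order are available. *)
Definition rc x : C := x%:C%C.
Definition re z : R := complex.Re z.
Definition im z : R := complex.Im z.
Definition nrm z : R := re `|z|.
Definition sqn z : R := nrm z ^+ 2.

Lemma nrmE z : `|z| = rc (nrm z).
Proof. by rewrite /nrm /re normc_def. Qed.

Lemma sqnE z : sqn z = re z ^+ 2 + im z ^+ 2.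
Proof. by rewrite /sqn /nrm normc_def /= sqr_sqrtr // addr_ge0 ?sqr_ge0. Qed.

Lemma rc_inj : injective rc. Proof. exact: complexI. Qed.
Lemma rcD x y : rc (x + y) = rc x + rc y. Proof. exact: rmorphD. Qed.
Lemma rcM x y : rc (x * y) = rc x * rc y. Proof. exact: rmorphM. Qed.
Lemma rcX x n : rc (x ^+ n) = rc x ^+ n. Proof. exact: rmorphXn. Qed.
Lemma rc0 : rc 0 = 0. Proof. by []. Qed.
Lemma rc1 : rc 1 = 1. Proof. by []. Qed.
Lemma rc_le x y : (rc x <= rc y) = (x <= y). Proof. exact: lecR. Qed.
Lemma rc_lt x y : (rc x < rc y) = (x < y). Proof. exact: ltcR. Qed.
Lemma rc_sum (I : Type) (s : seq I) (P : pred I) (F : I -> R) :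
  rc (\sum_(i <- s | P i) F i) = \sum_(i <- s | P i) rc (F i).
Proof. exact: rmorph_sum. Qed.
Lemma reD z w : re (z + w) = re z + re w. Proof. by case: z w => [? ?] []. Qed.
Lemma reN z : re (- z) = - re z. Proof. by case: z. Qed.
Lemma imD z w : im (z + w) = im z + im w. Proof. by case: z w => [? ?] []. Qed.
Lemma imN z : im (- z) = - im z. Proof. by case: z. Qed.
Lemma re_sum (I : Type) (s : seq I) (P : pred I) (F : I -> C) :
  re (\sum_(i <- s | P i) F i) = \sum_(i <- s | P i) re (F i).
Proof. exact: (big_morph re reD). Qed.
Lemma im_sum (I : Type) (s : seq I) (P : pred I) (F : I -> C) :
  im (\sum_(i <- s | P i) F i) = \sum_(i <- s | P i) im (F i).
Proof. exact: (big_morph im imD). Qed.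

Lemma nrm_ge0 z : 0 <= nrm z.
Proof. by rewrite -rc_le -nrmE normr_ge0. Qed.
Hint Resolve nrm_ge0 : core.

Lemma sqn_ge0 z : 0 <= sqn z. Proof. exact: sqr_ge0. Qed.

Lemma nrmM z w : nrm (z * w) = nrm z * nrm w.
Proof. by apply: rc_inj; rewrite -nrmE normrM !nrmE rcM. Qed.

Lemma nrmX z n : nrm (z ^+ n) = nrm z ^+ n.
Proof. by apply: rc_inj; rewrite -nrmE normrX !nrmE rcX. Qed.

Lemma nrmD z w : nrm (z + w) <= nrm z + nrm w.
Proof. by rewrite -rc_le rcD -!nrmE ler_normD. Qed.

Lemma nrmN z : nrm (- z) = nrm z.
Proof. by apply: rc_inj; rewrite -!nrmE normrN. Qed.

Lemma nrmB z w : nrm (z - w) = nrm (w - z).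
Proof. by rewrite -nrmN opprB. Qed.

Lemma nrmJ z : nrm (z^*) = nrm z.
Proof. by apply: rc_inj; rewrite -!nrmE norm_conjC. Qed.

Lemma nrm0 : nrm 0 = 0. Proof. by apply: rc_inj; rewrite -nrmE normr0. Qed.
Lemma nrm1 : nrm 1 = 1. Proof. by apply: rc_inj; rewrite -nrmE normr1. Qed.

Lemma nrm_eq0 z : (nrm z == 0) = (z == 0).
Proof. by rewrite -(inj_eq rc_inj) -nrmE normr_eq0. Qed.

Lemma nrmV z : nrm z^-1 = (nrm z)^-1.
Proof.
have [->|z0] := eqVneq z 0; first by rewrite invr0 nrm0 invr0.
have nz0 : nrm z != 0 by rewrite nrm_eq0.
by apply: (mulfI nz0); rewrite -nrmM !divff // nrm1.
Qed.

Lemma nrm_rc x : nrm (rc x) = `|x|.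
Proof.
by rewrite /nrm normc_def /= expr0n addr0 sqrtr_sqr.
Qed.

Lemma nrm_sum (I : Type) (s : seq I) (P : pred I) (F : I -> C) :
  nrm (\sum_(i <- s | P i) F i) <= \sum_(i <- s | P i) nrm (F i).
Proof.
elim/big_ind2: _ => [|x1 x2 y1 y2 h1 h2|//]; first by rewrite nrm0.
by apply: le_trans (nrmD _ _) _; exact: lerD.
Qed.

Lemma sqnM z w : sqn (z * w) = sqn z * sqn w.
Proof. by rewrite /sqn nrmM exprMn. Qed.

Lemma sqnJ z : rc (sqn z) = z * z^*.
Proof. by rewrite /sqn rcX -nrmE normCK. Qed.

Lemma sqnD z w : sqn (z + w) = sqn z + sqn w + 2 * re (z * w^*).
Proof.
apply: rc_inj; rewrite !rcD rcM !sqnJ rmorphD /=.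
have -> : rc (re (z * w^*)) = (z * w^* + (z * w^*)^*) / 2.
  by rewrite /rc /re complexRe ReE.
rewrite rmorphM  /= conjCK /= (_ : rc 2 = 2); last first.
  by rewrite /rc rmorph_nat.
by field.
Qed.

Lemma nrm_sqn z : nrm z = Num.sqrt (sqn z).
Proof. by rewrite /sqn sqrtr_sqr ger0_norm. Qed.

Lemma nrm_re z : `|re z| <= nrm z.
Proof.
rewrite nrm_sqn sqnE -sqrtr_sqr ler_sqrt ?lerDl ?sqr_ge0 //.
by rewrite addr_ge0 ?sqr_ge0.
Qed.

Lemma nrm_im z : `|im z| <= nrm z.
Proof.
rewrite nrm_sqn sqnE -sqrtr_sqr ler_sqrt ?lerDr ?sqr_ge0 //.
by rewrite addr_ge0 ?sqr_ge0.
Qed.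

Lemma nrm_le z : nrm z <= `|re z| + `|im z|.
Proof.
rewrite -(ler_pXn2r (_ : 0 < 2)%N) ?nnegrE ?addr_ge0 //.
by rewrite -/(sqn z) sqnE sqrrD !real_normK ?num_real // addrAC lerDl mulrn_wge0
  // mulr_ge0.
Qed.

Lemma discE z : @disc R z <-> nrm z < 1.
Proof. by rewrite /disc /= nrmE -rc1 rc_lt. Qed.

End ComplexModulus.
Arguments rc {R}.
Arguments re {R}.
Arguments im {R}.
Arguments nrm {R}.
Arguments sqn {R}.
#[global] Hint Extern 0 (is_true (0 <= nrm _)) => exact: nrm_ge0 : core.
#[global] Hint Extern 0 (is_true (0 <= sqn _)) => exact: sqn_ge0 : core.

Section ComplexConvergence.
Variable R : realType.
Notation C := (cplx R).
Variables (T : Type) (F : set_system T).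
Context {FF : Filter F}.
Implicit Types (u : T -> C) (l : C).

Lemma cvgCP u l : u x @[x --> F] --> l <->
  nrm (u x - l) @[x --> F] --> (0 : R).
Proof.
split => [/cvgrPdist_lt h|/cvgrPdist_lt h]; apply/cvgrPdist_lt => e e0.
  have e0' : 0 < rc e by rewrite -rc0 rc_lt.
  near=> x; rewrite sub0r normrN (ger0_norm (nrm_ge0 _)).
  by rewrite -rc_lt -nrmE distrC; near: x; exact: h.
(* Radii of neighbourhoods are elements of [cplx R]; a positive one is real. *)
have eE : e = rc (re e).
  by rewrite /rc /re RRe_real // realE ltW.
rewrite eE; near=> x; rewrite nrmE rc_lt nrmB.
have -> : nrm (u x - l) = `|0 - nrm (u x - l)|.
  by rewrite sub0r normrN ger0_norm.
near: x; apply: h; by rewrite -rc_lt -eE.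
Unshelve. all: by end_near. Qed.

End ComplexConvergence.

Lemma cvg_dist_le (R : realType) (T : Type) (F : set_system T) {FF : Filter F}
    (v w : T -> R) (b : R) :
  (forall x, `|v x - b| <= w x) -> w x @[x --> F] --> 0 ->
  v x @[x --> F] --> b.
Proof.
move=> vw /cvgrPdist_lt w0; apply/cvgrPdist_lt => e e0.
near=> x; rewrite distrC; apply: le_lt_trans (vw x) _.
have : `|0 - w x| < e by near: x; exact: w0.
by rewrite sub0r normrN; apply: le_lt_trans; exact: ler_norm.
Unshelve. all: by end_near. Qed.

Section ComplexLimits.
Variable R : realType.
Notation C := (cplx R).
Variables (T : Type) (F : set_system T).
Context {FF : Filter F}.
Implicit Types (u : T -> C) (l : C).

Lemma cvg_re u l : u x @[x --> F] --> l -> re (u x) @[x --> F] --> re l.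
Proof.
move=> /cvgCP; apply: cvg_dist_le => x.
by rewrite -reN -reD; exact: nrm_re.
Qed.

Lemma cvg_nrm u l : u x @[x --> F] --> l -> nrm (u x) @[x --> F] --> nrm l.
Proof.
move=> /cvgCP; apply: cvg_dist_le => x; rewrite ler_norml; apply/andP; split.
  by rewrite lerNl opprB lerBlDr nrmB (le_trans _ (nrmD _ _)) // subrK.
by rewrite lerBlDr (le_trans _ (nrmD _ _)) // subrK.
Qed.

Lemma cvg_sqn u l : u x @[x --> F] --> l -> sqn (u x) @[x --> F] --> sqn l.
Proof. by move=> /cvg_nrm h; rewrite /sqn !expr2; exact: cvgM. Qed.

Lemma cvg_reim u l : re (u x) @[x --> F] --> re l ->
  im (u x) @[x --> F] --> im l -> u x @[x --> F] --> l.
Proof.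
move=> hr hi; apply/cvgCP.
apply: (@cvg_dist_le _ _ _ _ _ (fun x =>
  `|re (u x) - re l| + `|im (u x) - im l|)).
  by move=> x; rewrite subr0 ger0_norm // (le_trans (nrm_le _)) // reD imD reN
    imN.
rewrite -[X in _ --> X]addr0; apply: cvgD.
  by rewrite -(@normr0 _ R); apply: cvg_norm; rewrite -(subrr (re l));
    apply: cvgB hr (cvg_cst _).
by rewrite -(@normr0 _ R); apply: cvg_norm; rewrite -(subrr (im l));
  apply: cvgB hi (cvg_cst _).
Qed.

Lemma cvg_rc (v : T -> R) b : v x @[x --> F] --> b ->
  rc (v x) @[x --> F] --> rc b.
Proof. by move=> h; apply: cvg_reim => //=; exact: cvg_cst. Qed.

Lemma cvg_conj u l : u x @[x --> F] --> l -> (u x)^* @[x --> F] --> l^*.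
Proof.
move=> /cvgCP h; apply/cvgCP; 
by under eq_fun do rewrite -rmorphB /= nrmJ.
Qed.

Lemma nrm_lim_le {PF : ProperFilter F} u l M : u x @[x --> F] --> l ->
  (\forall x \near F, nrm (u x) <= M) -> nrm l <= M.
Proof. by move=> /cvg_nrm ul uM; exact: cvgr_to_le ul uM. Qed.

End ComplexLimits.

Section Series.
Variable R : realType.
Notation C := (cplx R).
Implicit Types (a b : nat -> C) (u : nat -> R) (M : R).

Definition psums_le u M := forall n, series u n <= M.
Definition abs_summable a := exists M, psums_le (nrm \o a) M.
Definition csum a : C := limn (series a).

Lemma psums_le_cvg u M : (forall n, 0 <= u n) -> psums_le u M ->
  [/\ cvgn (series u), limn (series u) <= M &
      forall n, series u n <= limn (series u)].
Proof.
move=> u0 uM.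
have nd : {homo series u : n m / (n <= m)%N >-> n <= m} by exact:
  nondecreasing_series.
have cu : cvgn (series u).
  by apply: nondecreasing_is_cvgn => //; exists M => _ [n _ <-].
split => //; first by apply: limr_le => //; exact: nearW.
by move=> n; exact: nondecreasing_cvgn_le.
Qed.

Lemma series_re a n : re (series a n) = series (re \o a) n.
Proof. exact: re_sum. Qed.

Lemma series_im a n : im (series a n) = series (im \o a) n.
Proof. exact: im_sum. Qed.

(** Real and imaginary parts are dominated by the moduli, so both series converge absolutely in
    [R]. *)
Lemma abs_summable_cvg a : abs_summable a -> series a @ \oo --> csum a.
Proof.
move=> [M aM].
have key (f : C -> R) : (forall z, `|f z| <= nrm z) -> cvgn (series (f \o a)).
  move=> fle; apply: normed_cvg.
  have fM : psums_le (fun n => `|f (a n)|) M.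
    by move=> n; apply: le_trans (aM n); apply: ler_sum => i _; exact: fle.
  by have [] := psums_le_cvg (fun n => normr_ge0 (f (a n))) fM.
have [cr ci] := (key _ (@nrm_re R), key _ (@nrm_im R)).
suff : cvgn (series a) by [].
apply/cvg_ex; exists ((limn (series (re \o a)) +i* limn (series (im \o a)))%C :
  C).
apply: cvg_reim => /=.
  by under eq_fun do rewrite series_re.
by under eq_fun do rewrite series_im.
Qed.

Lemma csumE a l : series a @ \oo --> l -> csum a = l.
Proof. by move=> h; exact: cvg_lim. Qed.

Lemma series_bounded a (l : C) : series a @ \oo --> l ->
    exists M, forall n, nrm (a n) <= M.
Proof.
move=> al; have ca : cvgn (series a) by apply: cvgP al.
have /cvg_nrm := cvg_series_cvg_0 ca; rewrite nrm0 => a0.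
have /cvg_seq_bounded [M [Mr hM]] : cvgn (nrm \o a) by apply: cvgP a0.
exists (M + 1) => n; have := hM (M + 1); rewrite ltrDl ltr01 => /(_ isT n I) /=.
by rewrite ger0_norm.
Qed.

End Series.

(** * Power series *)

Section PowerSeries.
Variable R : realType.
Notation C := (cplx R).
Implicit Types (a b : nat -> C) (f g : C -> C) (z w : C) (q r M : R).

Lemma psums_geometric q n : 0 <= q < 1 -> series (GRing.exp q) n <= (1 - q)^-1.
Proof.
move=> /andP[q0 q1]; have d0 : 0 < 1 - q by rewrite subr_gt0.
rewrite -[leRHS]mul1r ler_pdivlMr //.
have -> : series (GRing.exp q) n * (1 - q) = 1 - q ^+ n.
  elim: n => [|n IH]; first by rewrite /series /= big_geq // mul0r subrr.
  by rewrite seriesSr mulrDl IH exprS; ring.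
by rewrite gerBl exprn_ge0.
Qed.

Lemma summable_geometric a M q : 0 <= q < 1 ->
  (forall n, nrm (a n) <= M * q ^+ n) -> abs_summable a.
Proof.
move=> q01 aM; exists (M * (1 - q)^-1) => n.
have M0 : 0 <= M by apply: le_trans (nrm_ge0 (a 0%N)) _; rewrite -[M]mulr1;
  exact: aM.
apply: le_trans (_ : M * series (GRing.exp q) n <= _).
  by rewrite /series /= mulr_sumr; apply: ler_sum => i _; exact: aM.
by apply: ler_wpM2l => //; exact: psums_geometric.
Qed.

(** This is the condition that the power series with coefficients [a] has radius of convergence at
    least 1. *)
Definition subgeometric a :=
  forall r, 0 < r < 1 -> exists M, forall n, nrm (a n) * r ^+ n <= M.

Lemma subgeometricS a : subgeometric a -> subgeometric (fun n => a n.+1).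
Proof.
move=> ga r r01; have [M aM] := ga r r01; exists (M / r) => n.
have /andP[r0 _] := r01.
by rewrite ler_pdivlMr // -mulrA -exprSr.
Qed.

Lemma subgeometric_bound a z : subgeometric a -> @disc R z ->
  exists M q, 0 <= q < 1 /\ forall n, nrm (a n * z ^+ n) <= M * q ^+ n.
Proof.
(* The midpoint serves as a radius strictly between [nrm z] and 1; the ratio [q] is then
   [nrm z / r]. *)
move=> ga /discE z1; pose r := (1 + nrm z) / 2.
have r01 : 0 < r < 1 by have := nrm_ge0 z; rewrite /r; lra.
have [M aM] := ga _ r01; exists M, (nrm z / r); split.
  have zr : nrm z < r by rewrite /r; lra.
  by move: r01 => /andP[r0 _]; rewrite divr_ge0 ?(ltW r0) //= ltr_pdivrMr //
    mul1r.
move=> n; have /andP[r0 _] := r01.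
rewrite nrmM nrmX expr_div_n mulrA ler_pdivlMr ?exprn_gt0 // mulrAC.
by rewrite ler_wpM2r ?exprn_ge0.
Qed.

Lemma subgeometric_summable a z : subgeometric a -> @disc R z ->
  abs_summable (fun n => a n * z ^+ n).
Proof.
move=> ga z1; have [M [q [q01 aM]]] := subgeometric_bound ga z1.
exact: summable_geometric q01 aM.
Qed.

Lemma taylor_subgeometric f a : has_taylor f a -> subgeometric a.
Proof.
move=> fa r /andP[r0 r1].
have zr : @disc R (rc r) by apply/discE; rewrite nrm_rc gtr0_norm.
have [M aM] := series_bounded (fa _ zr); exists M => n.
by apply: le_trans (aM n); rewrite nrmM nrmX nrm_rc gtr0_norm.
Qed.

Lemma subgeometric_taylor a : subgeometric a ->
  has_taylor (fun z => csum (fun n => a n * z ^+ n)) a.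
Proof. by move=> ga z z1; exact/abs_summable_cvg/subgeometric_summable. Qed.

Lemma taylorE f a z : has_taylor f a -> @disc R z ->
  f z = csum (fun n => a n * z ^+ n).
Proof. by move=> fa z1; apply/esym/csumE; exact: fa. Qed.

Lemma has_taylorD f g a b : has_taylor f a -> has_taylor g b ->
  has_taylor (fun z => f z + g z) (fun n => a n + b n).
Proof.
move=> fa gb z z1; rewrite (_ : series _ = fun n =>
  series (fun n => a n * z ^+ n) n + series (fun n => b n * z ^+ n) n).
  exact: cvgD (fa z z1) (gb z z1).
apply/funext => n; rewrite /series /= -big_split.
by apply: eq_bigr => i _; rewrite mulrDl.
Qed.

Lemma has_taylorZ (c : C) f a : has_taylor f a ->
  has_taylor (fun z => c * f z) (fun n => c * a n).
Proof.
move=> fa z z1; rewrite (_ : series _ = fun n =>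
  c * series (fun n => a n * z ^+ n) n).
  exact: cvgM (cvg_cst c) (fa z z1).
apply/funext => n; rewrite /series /= mulr_sumr.
by apply: eq_bigr => i _; rewrite mulrA.
Qed.

Lemma eq_has_taylor f g a : (forall z, @disc R z -> f z = g z) ->
  has_taylor f a -> has_taylor g a.
Proof. by move=> fg fa z z1; rewrite -fg //; exact: fa. Qed.

Lemma series_eventually0 (a : nat -> C) N : (forall n, (N <= n)%N -> a n = 0) ->
  series a @ \oo --> \sum_(i < N) a i.
Proof.
move=> a0; apply: cvg_near_cst; exists N => // n /= Nn.
rewrite /series /= (big_cat_nat (n := N)) //= big_mkord.
have -> : \sum_(N <= i < n) a i = 0.
  by rewrite big_nat big1 // => i /andP[Ni _]; exact: a0.
by rewrite addr0.
Qed.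

Definition trunc N a n : C := if (n < N)%N then a n else 0.

Lemma has_taylor_poly N a :
  has_taylor (fun z => \sum_(i < N) a i * z ^+ i) (trunc N a).
Proof.
move=> z _; have /series_eventually0 :
    forall n, (N <= n)%N -> trunc N a n * z ^+ n = 0.
  by move=> n; rewrite /trunc leqNgt => /negbTE ->; rewrite mul0r.
by under eq_bigr do rewrite /trunc ltn_ord.
Qed.

(** Each of the first [n] powers of [q] is at least [q ^+ n], and their sum is at most
    [(1 - q)^-1]. *)
Lemma expr_mul_bound q n : 0 <= q < 1 -> n%:R * q ^+ n <= (1 - q)^-1.
Proof.
move=> q01; apply: le_trans (psums_geometric n q01).
rewrite -[n%:R](_ : \sum_(0 <= i < n) 1 = _);
  last by rewrite sumr_const_nat subn0.
rewrite mulr_suml; apply: ler_sum_nat => i /andP[_ iN]; rewrite mul1r.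
by case/andP: q01 => q0 q1; rewrite ler_wiXn2l ?(ltW q1) ?(ltnW iN).
Qed.

(** With [s] the square root of [q], one factor [s ^+ n] keeps [n%:R * s ^+ n] bounded while the
    other tends to 0. *)
Lemma cvg_natM_expr q : 0 <= q < 1 -> n%:R * q ^+ n @[n --> \oo] --> (0 : R).
Proof.
move=> /andP[q0 q1]; pose s := Num.sqrt q.
have s0 : 0 <= s by exact: sqrtr_ge0.
have s1 : s < 1 by rewrite -[ltRHS]sqrtr1 ltr_sqrt.
have qE : q = s * s by rewrite -expr2 sqr_sqrtr.
apply: (@cvg_dist_le _ _ _ _ _ (fun n => (1 - s)^-1 * s ^+ n)).
  move=> n; rewrite subr0 ger0_norm ?mulr_ge0 ?exprn_ge0 //.
  rewrite qE exprMn mulrA ler_wpM2r ?exprn_ge0 // expr_mul_bound //.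
  by rewrite s0.
have s1' : `|s| < 1 by rewrite ger0_norm.
exact: (cvg_geometric (1 - s)^-1 s1').
Qed.

Definition conv a b n : C := \sum_(i < n.+1) a i * b (n - i)%N.

(** The products [a i * b j] with [i + j < n] are grouped by [i]. *)
Lemma series_conv a b n :
  series (conv a b) n = \sum_(i < n) a i * series b (n - i)%N.
Proof.
elim: n => [|n IH]; first by rewrite /series /= big_geq // big_ord0.
rewrite seriesSr IH big_ord_recr /= subSn // subnn seriesSr.
rewrite [X in a n * X](_ : _ = b 0%N);
  last by rewrite /series /= big_geq ?add0r.
rewrite /conv big_ord_recr /= subnn addrA -big_split /=; congr (_ + _).
by apply: eq_bigr => i _; rewrite -mulrDr -seriesSr subSn // ltnW.
Qed.

Lemma abs_summable_tail b M q N : 0 <= q < 1 ->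
  (forall n, nrm (b n) <= M * q ^+ n) ->
  nrm (csum b - series b N) <= M * (1 - q)^-1 * q ^+ N.
Proof.
move=> q01 bM; have /abs_summable_cvg bl := summable_geometric q01 bM.
have M0 : 0 <= M by apply: le_trans (nrm_ge0 (b 0%N)) _; rewrite -[M]mulr1;
  exact: bM.
have tl : series b n - series b N @[n --> \oo] --> csum b - series b N.
  by apply: cvgB; [exact: bl|exact: cvg_cst].
apply: (nrm_lim_le tl).
exists N => // n /= Nn; rewrite sub_series Nn.
apply: le_trans (nrm_sum _ _ _) _.
apply: le_trans (ler_sum_nat (fun i _ => bM i)) _.
rewrite -{1}[N]add0n -{1}(subnK Nn) big_addn addnK.
under eq_bigr do rewrite exprD mulrA.
rewrite -mulr_suml -mulr_sumr ler_wpM2r ?exprn_ge0 ?ler_wpM2l //.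
  by case/andP: q01.
exact: psums_geometric.
Qed.

(** The partial sum of the Cauchy product differs from [series A n * g z] by products of [A i] with
    the tail of [B] from [n - i] on. Geometric bounds with a common ratio [p] make each product at
    most a constant times [p ^+ n], so the total error is of order [n p^n]. *)
Lemma has_taylorM f g a b : has_taylor f a -> has_taylor g b ->
  has_taylor (fun z => f z * g z) (conv a b).
Proof.
move=> fa gb z z1.
have [M [q [q01 aM]]] := subgeometric_bound (taylor_subgeometric fa) z1.
have [M' [q' [q'01 bM']]] := subgeometric_bound (taylor_subgeometric gb) z1.
pose p := Num.max q q'.
have p01 : 0 <= p < 1 by rewrite /p; case: (leP q q') => _.
have M0 : 0 <= M by apply: le_trans (nrm_ge0 (a 0%N * z ^+ 0)) _;
  rewrite -[M]mulr1; exact: aM.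
have M'0 : 0 <= M' by apply: le_trans (nrm_ge0 (b 0%N * z ^+ 0)) _;
  rewrite -[M']mulr1; exact: bM'.
have [p0 p1] := andP p01.
have aMp n : nrm (a n * z ^+ n) <= M * p ^+ n.
  apply: le_trans (aM n) _; rewrite ler_wpM2l // lerXn2r ?nnegrE //.
    by case/andP: q01.
  by rewrite /p le_max lexx.
have bMp n : nrm (b n * z ^+ n) <= M' * p ^+ n.
  apply: le_trans (bM' n) _; rewrite ler_wpM2l // lerXn2r ?nnegrE //.
    by case/andP: q'01.
  by rewrite /p le_max lexx orbT.
set A := fun n => a n * z ^+ n; set B := fun n => b n * z ^+ n.
have -> : (fun n => conv a b n * z ^+ n) = conv A B.
  apply/funext => n; rewrite /conv mulr_suml; apply: eq_bigr => i _.
  rewrite /A /B mulrACA -exprD subnKC //; by case: i.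
rewrite (_ : series _ = fun n => series A n * g z -
    \sum_(i < n) A i * (g z - series B (n - i)%N)); last first.
  apply/funext => n; rewrite series_conv /series /= [in X in X - _]big_mkord.
  rewrite mulr_suml -sumrB; apply: eq_bigr => i _.
  by rewrite mulrBr opprB addrC subrK.
rewrite -[X in _ --> X]subr0; apply: cvgB.
  by apply: cvgM; [exact: fa|exact: cvg_cst].
apply/cvgCP.
apply: (@cvg_dist_le _ _ _ _ _ (fun n =>
  M * (M' * (1 - p)^-1) * (n%:R * p ^+ n))).
  move=> n; rewrite !subr0 ger0_norm //; apply: le_trans (nrm_sum _ _ _) _.
  have -> : M * (M' * (1 - p)^-1) * (n%:R * p ^+ n) =
      \sum_(i < n) (M * (M' * (1 - p)^-1) * p ^+ n).
    by rewrite sumr_const card_ord -[RHS]mulr_natr; ring.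
  apply: ler_sum => i _; rewrite nrmM.
  have -> : M * (M' * (1 - p)^-1) * p ^+ n =
      (M * p ^+ i) * (M' * (1 - p)^-1 * p ^+ (n - i)%N).
    by rewrite mulrACA -exprD subnKC // ltnW.
  apply: ler_pM; [exact: nrm_ge0|exact: nrm_ge0|exact: aMp|].
  by rewrite (taylorE gb z1) abs_summable_tail.
rewrite -(mulr0 (M * (M' * (1 - p)^-1))).
by apply: cvgM; [exact: cvg_cst|exact: cvg_natM_expr].
Qed.

Lemma csum_shift a : abs_summable a ->
  csum a = a 0%N + csum (fun n => a n.+1).
Proof.
move=> sa; have sE n : series a n.+1 = a 0%N + series (fun n => a n.+1) n.
  by rewrite /series /= big_nat_recl.
have sS : abs_summable (fun n => a n.+1).
  have [M aM] := sa; exists M => n; apply: le_trans (aM n.+1).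
  by rewrite /series /= big_nat_recl // lerDr.
apply: csumE; rewrite -cvg_shiftS.
rewrite (_ : (fun n => _) = fun n => a 0%N + series (fun n => a n.+1) n).
  by apply: cvgD; [exact: cvg_cst|exact: abs_summable_cvg].
by apply/funext => n; rewrite sE.
Qed.

Lemma csumZ (c : C) a : abs_summable a ->
  csum (fun n => c * a n) = c * csum a.
Proof.
move=> sa; apply: csumE.
rewrite (_ : series _ = fun n => c * series a n).
  by apply: cvgM; [exact: cvg_cst|exact: abs_summable_cvg].
by apply/funext => n; rewrite /series /= mulr_sumr.
Qed.

Lemma csumD a b : abs_summable a -> abs_summable b ->
  csum (fun n => a n + b n) = csum a + csum b.
Proof.
move=> sa sb; apply: csumE.
rewrite (_ : series _ = fun n => series a n + series b n).
  by apply: cvgD; exact: abs_summable_cvg.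
by apply/funext => n; rewrite /series /= big_split.
Qed.

Lemma nrm_csum_geometric a M q : 0 <= q < 1 ->
  (forall n, nrm (a n) <= M * q ^+ n) -> nrm (csum a) <= M * (1 - q)^-1.
Proof.
move=> q01 aM; have := abs_summable_tail 0 q01 aM.
by rewrite expr0 mulr1 /series /= big_geq // subr0.
Qed.

(* [k] is the coefficient sequence of [(f z - f w) / (z - w)]. *)
Lemma taylor_div f a w : has_taylor f a -> @disc R w -> f w = 0 ->
  exists k, [/\ subgeometric k,
    forall M, (forall n, nrm (a n) <= M) ->
      forall n, nrm (k n) <= M / (1 - nrm w),
    forall n, k n = a n.+1 + w * k n.+1
    & forall z, @disc R z -> f z = (z - w) * csum (fun n => k n * z ^+ n)].
Proof.
move=> fa w1 fw0; have /discE w1' := w1.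
pose x n m := a (n.+1 + m)%N * w ^+ m.
pose k n := csum (x n).
have bnd r : nrm w < r < 1 -> exists M, forall n m,
    nrm (x n m) <= M / r ^+ n.+1 * (nrm w / r) ^+ m.
  move=> /andP[wr r1]; have r0 : 0 < r by apply: le_lt_trans wr.
  have [|M aM] := taylor_subgeometric fa (_ : 0 < r < 1); first by rewrite r0.
  exists M => n m; have -> : M / r ^+ n.+1 * (nrm w / r) ^+ m =
      M * nrm w ^+ m / r ^+ (n.+1 + m)%N.
    by rewrite exprD expr_div_n invfM; ring.
  rewrite ler_pdivlMr ?exprn_gt0 // /x nrmM nrmX mulrAC.
  by rewrite ler_wpM2r ?exprn_ge0.
pose r0 := (1 + nrm w) / 2.
have r0w : nrm w < r0 < 1 by apply/andP; split; rewrite /r0; lra.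
have q01 r : nrm w < r < 1 -> 0 <= nrm w / r < 1.
  move=> /andP[wr r1]; have r0' : 0 < r by apply: le_lt_trans wr.
  by rewrite divr_ge0 ?(ltW r0') //= ltr_pdivrMr // mul1r.
have sx n : abs_summable (x n).
  by have [M xM] := bnd _ r0w; exact: summable_geometric (q01 _ r0w) (xM n).
have kS n : k n = a n.+1 + w * k n.+1.
  rewrite /k (csum_shift (sx n)) -(csumZ w (sx n.+1)) {1}/x addn0 expr0 mulr1.
  congr (_ + csum _); apply/funext => m;
    by rewrite /x addnS -addSn exprS mulrCA.
have sk : subgeometric k.
  move=> s /andP[s0 s1]; pose r := Num.max s r0.
  have rw : nrm w < r < 1.
    have /andP[h1 h2] := r0w.
    by rewrite /r lt_max h1 orbT gt_max s1 h2.
  have r_gt0 : 0 < r by have /andP[wr _] := rw; apply: le_lt_trans wr.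
  have [M xM] := bnd _ rw; exists (M / r * (1 - nrm w / r)^-1) => n.
  apply: le_trans (_ : nrm (k n) * r ^+ n <= _).
    by rewrite ler_wpM2l // lerXn2r ?nnegrE ?(ltW s0) ?(ltW r_gt0) // /r le_max
      lexx.
  apply: le_trans (_ : M / r ^+ n.+1 * (1 - nrm w / r)^-1 * r ^+ n <= _).
    by rewrite ler_wpM2r ?exprn_ge0 ?(ltW r_gt0) // nrm_csum_geometric // q01.
  rewrite exprSr invfM le_eqVlt; apply/orP; left; apply/eqP.
  have rn : r ^+ n != 0 by rewrite expf_neq0 // gt_eqF.
  set Y := (1 - _)^-1; rewrite -[RHS]mulr1 -(mulVf rn); ring.
exists k; split => //.
  move=> M aM n; apply: nrm_csum_geometric; first by rewrite nrm_ge0.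
  by move=> m; rewrite /x nrmM nrmX ler_wpM2r ?exprn_ge0.
move=> z z1; set g := csum _.
have shift b : subgeometric b ->
    csum (fun n => b n * z ^+ n) = b 0%N + z * csum (fun n => b n.+1 * z ^+ n).
  move=> gb; rewrite csum_shift; last exact: subgeometric_summable.
  rewrite expr0 mulr1 -csumZ.
    by congr (_ + csum _); apply/funext => m; rewrite exprS mulrCA.
  by apply: subgeometric_summable => //; exact: subgeometricS.
have ga : subgeometric a := taylor_subgeometric fa.
(* The zero of [f] at [w] enters here: it removes the constant remainder of the division. *)
have gw : a 0%N = - (w * k 0%N).
  have := taylorE fa w1; rewrite fw0 csum_shift;
    last exact: subgeometric_summable.
  rewrite expr0 mulr1 => /esym/eqP; rewrite addr_eq0 => /eqP ->; congr (- _).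
  rewrite /k -(csumZ w (sx 0%N)); congr csum; apply/funext => m.
  by rewrite /x add1n exprS mulrCA.
have e1 : csum (fun n => a n.+1 * z ^+ n) =
    g - w * csum (fun n => k n.+1 * z ^+ n).
  rewrite -mulNr -csumZ; last first.
    by apply: subgeometric_summable => //; exact: subgeometricS.
  rewrite -csumD.
  - congr csum; apply/funext => n.
    by rewrite [in RHS]kS; ring.
  - exact: subgeometric_summable.
  - have := subgeometric_summable (subgeometricS sk) z1; move=> [M kM].
    exists (nrm w * M) => n; apply: le_trans (_ : nrm w * _ <= _).
      2: by apply: ler_wpM2l; [exact: nrm_ge0|exact: kM].
    rewrite /series /= mulr_sumr; apply: ler_sum => i _.
    by rewrite nrmM nrmN.
rewrite (taylorE fa z1) (shift a ga) gw e1.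
have := shift k sk; rewrite -/g => ->.
by ring.
Qed.

End PowerSeries.

(** * Square-summable sequences *)

Section SquareSummable.
Variable R : realType.
Notation C := (cplx R).
Implicit Types (a b c : nat -> C) (M : R).

Definition l2 a := exists M, psums_le (sqn \o a) M.
Definition dot a b : C := csum (fun n => a n * (b n)^*).
Definition nsq a : R := limn (series (sqn \o a)).

Lemma nrm_sqnP (z w : C) : nrm (z * w^*) <= sqn z + sqn w.
Proof. by rewrite nrmM nrmJ /sqn; have := sqr_ge0 (nrm z - nrm w);
  have := sqr_ge0 (nrm z + nrm w); nra. Qed.

Lemma sqnD_le (z w : C) : sqn (z + w) <= 2 * sqn z + 2 * sqn w.
Proof.
apply: le_trans (_ : (nrm z + nrm w) ^+ 2 <= _).
  by rewrite lerXn2r ?nnegrE ?nrm_ge0 ?addr_ge0 // nrmD.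
by rewrite /sqn; have := sqr_ge0 (nrm z - nrm w); nra.
Qed.

Lemma l2_dot a b : l2 a -> l2 b -> abs_summable (fun n => a n * (b n)^*).
Proof.
move=> [M aM] [M' bM]; exists (M + M') => n.
apply: le_trans (lerD (aM n) (bM n)); rewrite /series /= -big_split.
by apply: ler_sum => i _; exact: nrm_sqnP.
Qed.

Lemma l2D a b : l2 a -> l2 b -> l2 (fun n => a n + b n).
Proof.
move=> [M aM] [M' bM]; exists (2 * M + 2 * M') => n.
apply: le_trans (_ : 2 * series (sqn \o a) n + 2 * series (sqn \o b) n <= _).
  rewrite /series /= !mulr_sumr -big_split.
  by apply: ler_sum => i _; exact: sqnD_le.
by rewrite lerD // ler_wpM2l.
Qed.

Lemma l2Z (x : C) a : l2 a -> l2 (fun n => x * a n).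
Proof.
move=> [M aM]; exists (sqn x * M) => n.
apply: le_trans (_ : sqn x * series (sqn \o a) n <= _).
  by rewrite /series /= mulr_sumr; apply: ler_sum => i _; rewrite sqnM.
by rewrite ler_wpM2l.
Qed.

Lemma sqn0 : sqn (0 : C) = 0. Proof. by rewrite /sqn nrm0 expr0n. Qed.
Lemma sqn1 : sqn (1 : C) = 1. Proof. by rewrite /sqn nrm1 expr1n. Qed.

Lemma l2_trunc a N : l2 (trunc N a).
Proof.
exists (\sum_(i < N) sqn (a i)) => n.
have [M [_ h]] : exists M, (0 <= M) /\ series (sqn \o trunc N a) N <= \sum_(i <
  N) sqn (a i).
  exists 0; split => //; rewrite /series /= big_mkord.
  by apply: ler_sum => i _; rewrite /trunc ltn_ord.
apply: le_trans h; have [nN|Nn] := leqP n N.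
  by apply: (nondecreasing_series (R := R)) => // k _ _; exact: sqn_ge0.
rewrite /series /= (big_cat_nat (n := N)) ?(ltnW Nn) //=.
have -> : \sum_(N <= i < n) sqn (trunc N a i) = 0.
  by rewrite big_nat big1 // => i /andP[Ni _]; rewrite /trunc ltnNge Ni sqn0.
by rewrite addr0.
Qed.

Lemma dotDl a b c : l2 a -> l2 b -> l2 c ->
  dot (fun n => a n + b n) c = dot a c + dot b c.
Proof.
move=> la lb lc; rewrite /dot -csumD; [|exact: l2_dot..].
by congr csum; apply/funext => n; rewrite mulrDl.
Qed.

Lemma dotZl (x : C) a b : l2 a -> l2 b ->
  dot (fun n => x * a n) b = x * dot a b.
Proof.
move=> la lb; rewrite /dot -csumZ; last exact: l2_dot.
by congr csum; apply/funext => n; rewrite mulrA.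
Qed.

Lemma dotC a b : l2 a -> l2 b -> dot b a = (dot a b)^*.
Proof.
move=> la lb; apply: csumE.
rewrite (_ : series _ = fun n => (series (fun n => a n * (b n)^*) n)^*).
  by apply: cvg_conj; apply: abs_summable_cvg; exact: l2_dot.
apply/funext => n; rewrite /series /= rmorph_sum; apply: eq_bigr => i _.
by rewrite rmorphM /= conjCK mulrC.
Qed.

Lemma nsq_series a : l2 a ->
  [/\ cvgn (series (sqn \o a)), forall M, psums_le (sqn \o a) M -> nsq a <= M
    & forall n, series (sqn \o a) n <= nsq a].
Proof.
move=> [M aM]; have p (n : nat) : 0 <= (sqn \o a) n by exact: sqn_ge0.
have [h1 _ h3] := psums_le_cvg p aM; split => // M' aM'.
by have [] := psums_le_cvg p aM'.
Qed.

Lemma nsqE a : l2 a -> dot a a = rc (nsq a).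
Proof.
move=> la; have [cv _ _] := nsq_series la; apply: csumE.
rewrite (_ : series _ = fun n => rc (series (sqn \o a) n)).
  by apply: cvg_rc.
by apply/funext => n; rewrite /series /= rc_sum; apply: eq_bigr => i _;
  rewrite sqnJ.
Qed.

Lemma nsq_ge0 a : l2 a -> 0 <= nsq a.
Proof.
move=> la; have [_ _ /(_ 0%N)] := nsq_series la.
by rewrite /series /= big_geq.
Qed.

Lemma sqn_le_nsq a n : l2 a -> sqn (a n) <= nsq a.
Proof.
move=> la; have [_ _ /(_ n.+1)] := nsq_series la; apply: le_trans.
rewrite seriesSr lerDr; apply: sumr_ge0 => i _; exact: sqn_ge0.
Qed.

Lemma nsq_eq0 a : l2 a -> nsq a = 0 -> forall n, a n = 0.
Proof.
move=> la a0 n; have := sqn_le_nsq n la; rewrite a0 => h.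
have : sqn (a n) == 0 by rewrite eq_le h sqn_ge0.
by rewrite /sqn sqrf_eq0 nrm_eq0 => /eqP.
Qed.

Lemma dotDr a b c : l2 a -> l2 b -> l2 c ->
  dot a (fun n => b n + c n) = dot a b + dot a c.
Proof.
move=> la lb lc; have lbc := l2D lb lc.
by rewrite (dotC lbc la) (dotC lb la) (dotC lc la) -rmorphD dotDl.
Qed.

Lemma dotZr (x : C) a b : l2 a -> l2 b ->
  dot a (fun n => x * b n) = x^* * dot a b.
Proof.
move=> la lb; have lxb := l2Z x lb.
by rewrite (dotC lxb la) (dotC lb la) -rmorphM dotZl.
Qed.

Lemma conj_rc (r : R) : (rc r)^* = rc r :> C.
Proof. by rewrite /rc; exact: conjc_real. Qed.

Lemma dot_CauchySchwarz a b : l2 a -> l2 b ->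
  sqn (dot a b) <= nsq a * nsq b.
Proof.
move=> la lb; have [b0|b0] := eqVneq (nsq b) 0.
  rewrite b0 mulr0 (_ : dot a b = 0) ?sqn0 //; apply: csumE.
  rewrite (_ : series _ = fun=> 0); first exact: cvg_cst.
  apply/funext => n; rewrite /series /= big1 // => i _.
  by rewrite (nsq_eq0 lb b0) rmorph0 mulr0.
have bp : 0 < nsq b by rewrite lt_def b0 nsq_ge0.
pose x := dot a b / rc (nsq b).
have lx : l2 (fun n => - x * b n) by exact: l2Z.
have ls := l2D la lx.
have := nsq_ge0 ls; rewrite -(rc_le 0) -(nsqE ls) (dotDl la lx ls).
rewrite (dotDr la la lx) (dotDr lx la lx) (dotZl _ lb la) (dotZl _ lb lx).
rewrite !(dotZr _ _ lb) // (dotC la lb) !nsqE //.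
have n0 : rc (nsq b) != 0 by rewrite -(rc0 R) (inj_eq (@rc_inj R)).
have -> : (- x)^* = - ((dot a b)^* / rc (nsq b)).
  by rewrite rmorphN /x rmorphM fmorphV /= conj_rc.
have -> : rc (nsq a) + - ((dot a b)^* / rc (nsq b)) * dot a b +
   (- x * (dot a b)^* + - x * (- ((dot a b)^* / rc (nsq b)) * rc (nsq b))) =
   rc (nsq a) - dot a b * (dot a b)^* / rc (nsq b) by rewrite /x; field.
rewrite -sqnJ rc0 subr_ge0 ler_pdivrMr; last by rewrite -(rc0 R) rc_lt.
by rewrite -rcM rc_le.
Qed.

Lemma l2_subgeometric a : l2 a -> subgeometric a.
Proof.
move=> la r /andP[r0 r1]; exists (Num.sqrt (nsq a)) => n.
rewrite -[leRHS]mulr1; apply: ler_pM => //; first by rewrite exprn_ge0 // ltW.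
  by rewrite nrm_sqn ler_wsqrtr // sqn_le_nsq.
by rewrite exprn_ile1 // ltW.
Qed.

(** This is the bridge to the definition of [hardy], where the squared moduli are summed as complex
    numbers. *)
Lemma l2_series a : l2 a <-> cvgn (series (fun n => `|a n| ^+ 2)).
Proof.
have sE : series (fun n => `|a n| ^+ 2) = (fun n => rc (series (sqn \o a) n)).
  apply/funext => n; rewrite /series /= rc_sum; apply: eq_bigr => i _.
  by rewrite nrmE /sqn rcX.
rewrite sE; split => [la|/cvg_ex[l hl]].
  have [cv _ _] := nsq_series la.
  by apply/cvg_ex; exists (rc (nsq a)); apply: cvg_rc.
have hl' : series (sqn \o a) @ \oo --> re l by exact: cvg_re hl.
exists (re l) => n.
have cv : cvgn (series (sqn \o a)) by apply: cvgP hl'.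
rewrite -(cvg_lim _ hl') //; apply: nondecreasing_cvgn_le => //.
by apply: nondecreasing_series => i _ _; exact: sqn_ge0.
Qed.

(** The difference is written with [-1 *] so that [l2D] and [l2Z] apply to it as it stands. *)
Lemma l2_trunc_cvg a : l2 a ->
  nsq (fun n => a n + -1 * trunc N a n) @[N --> \oo] --> (0 : R).
Proof.
move=> la; have [cv _ h] := nsq_series la.
apply: (@cvg_dist_le _ _ _ _ _ (fun N => nsq a - series (sqn \o a) N)).
  move=> N; have lt := l2D la (l2Z (-1) (l2_trunc a N)).
  rewrite subr0 ger0_norm ?nsq_ge0 //.
  have [_ hM _] := nsq_series lt; apply: hM => n.
  rewrite lerBrDr; apply: le_trans (h (maxn n N)).
  rewrite /series /= [leRHS](big_cat_nat (n := N)) ?leq_maxr //= addrC.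
  apply: lerD => //.
  have [nN|Nn] := leqP n N.
    rewrite big_nat big1 => [|i /andP[_ ni]].
      by apply: sumr_ge0 => i _; exact: sqn_ge0.
    by rewrite /trunc (leq_trans ni nN) mulN1r subrr sqn0.
  rewrite (big_cat_nat (n := N)) ?(ltnW Nn) //= big_nat big1 ?add0r.
    apply: ler_sum_nat => i /andP[Ni _].
    by rewrite /trunc ltnNge Ni /= mulr0 addr0.
  by move=> i /andP[_ ni]; rewrite /trunc ni mulN1r subrr sqn0.
rewrite -(subrr (nsq a)); apply: cvgB; [exact: cvg_cst|exact: cv].
Qed.

Lemma dot_trunc a b N : dot a (trunc N b) = \sum_(i < N) a i * (b i)^*.
Proof.
have h n : (N <= n)%N -> a n * (trunc N b n)^* = 0.
  by move=> Nn; rewrite /trunc ltnNge Nn /= rmorph0 mulr0.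
rewrite /dot (csumE (series_eventually0 h)).
by apply: eq_bigr => i _; rewrite /trunc ltn_ord.
Qed.

Lemma nsq_trunc a N : nsq (trunc N a) = \sum_(i < N) sqn (a i).
Proof.
apply: rc_inj; rewrite -nsqE; last exact: l2_trunc.
rewrite dot_trunc rc_sum; apply: eq_bigr => i _.
by rewrite /trunc ltn_ord sqnJ.
Qed.

(** Convexity of the square with weights [1 - s] and [s], where [s] is the modulus of [w], gives
    [step]. On summation the shifted sum of the [sqn (k _)] returns with the factor [s < 1] and is
    absorbed on the left; the shift leaves one boundary term, at most [M ^+ 2]. *)
Lemma l2_div a k (w : C) M : l2 a -> nrm w < 1 ->
  (forall n, nrm (k n) <= M) -> (forall n, k n = a n.+1 + w * k n.+1) -> l2 k.
Proof.
move=> la w1 kM kS; set s := nrm w in w1 *.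
have s0 : 0 <= s by exact: nrm_ge0.
have d0 : 0 < 1 - s by lra.
have step n : sqn (k n) <= sqn (a n.+1) / (1 - s) + s * sqn (k n.+1).
  apply: le_trans (_ : (nrm (a n.+1) + s * nrm (k n.+1)) ^+ 2 <= _).
    rewrite lerXn2r ?nnegrE ?nrm_ge0 ?addr_ge0 ?mulr_ge0 ?nrm_ge0 //.
    by rewrite kS (le_trans (nrmD _ _)) // nrmM.
  rewrite /sqn; move: (nrm (a n.+1)) (nrm (k n.+1)) => y x.
  rewrite -subr_ge0 (_ : _ - _ = s * (y / (1 - s) - x) ^+ 2 * (1 - s)).
    by rewrite mulr_ge0 ?(ltW d0) // mulr_ge0 // sqr_ge0.
  by field; rewrite gt_eqF.
have A0 := nsq_ge0 la.
have [_ _ aA] := nsq_series la.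
exists ((nsq a / (1 - s) + s * M ^+ 2) / (1 - s)) => n.
rewrite ler_pdivlMr // mulrBr mulr1 lerBlDr -addrA.
apply: le_trans (_ : \sum_(0 <= i < n) (sqn (a i.+1) / (1 - s) + s * sqn (k
  i.+1)) <= _).
  by apply: ler_sum => i _; exact: step.
rewrite big_split /= -mulr_suml -mulr_sumr; apply: lerD.
  rewrite ler_wpM2r ?invr_ge0 ?(ltW d0) //; apply: le_trans (aA n.+1).
  by rewrite /series /= big_nat_recl // lerDr sqn_ge0.
rewrite [_ * s]mulrC -mulrDr ler_wpM2l //.
apply: le_trans (_ : series (sqn \o k) n.+1 <= _).
  by rewrite /series /= big_nat_recl // lerDr sqn_ge0.
rewrite seriesSr addrC lerD2r /= /sqn lerXn2r ?nnegrE ?nrm_ge0 //.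
by apply: le_trans (kM 0%N); exact: nrm_ge0.
Qed.

End SquareSummable.

(** * Parseval's identity *)

Section Circle.
Variable R : realType.
Notation C := (cplx R).
Notation mu := (@lebesgue_measure R).
Notation circle := (`[(0 : R), pi *+ 2]%classic).
Implicit Types (a b : nat -> C) (t : R).

Lemma expiX t n : expi t ^+ n = (expi (n%:R * t) : C).
Proof.
elim: n => [|n IH]; first by rewrite expr0 mul0r /expi cos0 sin0.
rewrite exprS IH mulrS mulrDl mul1r /expi cosD sinD.
apply/eqP; rewrite eq_complex /=; apply/andP; split => //.
by apply/eqP; ring.
Qed.

Lemma sqn_expi t : sqn (expi t : C) = 1.
Proof. by rewrite sqnE /= cos2Dsin2. Qed.

Lemma expi_pi2 : expi (pi *+ 2) = 1 :> C.
Proof. by rewrite /expi cos2pi sin2pi. Qed.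

Lemma nrm_expi t : nrm (expi t : C) = 1.
Proof. by rewrite nrm_sqn sqn_expi sqrtr1. Qed.

Lemma cvg_expi t0 : expi t @[t --> t0] --> (expi t0 : C).
Proof.
apply: cvg_reim => /=; [exact: continuous_cos|exact: continuous_sin].
Qed.

Lemma cvg_poly (T : Type) (F : set_system T) (FF : Filter F) N a (u : T ->
    C) (l : C) :
  u x @[x --> F] --> l ->
  \sum_(i < N) a i * u x ^+ i @[x --> F] --> \sum_(i < N) a i * l ^+ i.
Proof.
move=> ul; have pw i : u x ^+ i @[x --> F] --> l ^+ i.
  elim: i => [|i IH]; first by under eq_fun do rewrite expr0; exact: cvg_cst.
  rewrite (_ : (fun x => _) = fun x => u x * u x ^+ i); last first.
    by apply/funext => x; rewrite exprS.
  by rewrite exprS; exact: (cvgM ul IH).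
elim: N => [|N IH].
  by under eq_fun do rewrite big_ord0; rewrite big_ord0; exact: cvg_cst.
rewrite (_ : (fun x => _) = fun x =>
    \sum_(i < N) a i * u x ^+ i + a N * u x ^+ N); last first.
  by apply/funext => x; rewrite big_ord_recr.
by rewrite big_ord_recr; exact: (cvgD IH (cvgM (cvg_cst (a N)) (pw N))).
Qed.

Definition primitive (f F : R -> R) := forall t, is_derive t 1 F (f t).

(** An explicit primitive reduces the integral to the fundamental theorem of calculus. Adding the
    term of index [N] contributes its own square and cross terms of frequency [N - i]; this
    frequency is nonzero, so their primitives are periodic and contribute nothing over a full
    turn. *)
Lemma trig_poly_primitive N a : exists F,
  primitive (fun t => sqn (\sum_(i < N) a i * expi t ^+ i)) F /\
  F (pi *+ 2) - F 0 = pi *+ 2 * \sum_(i < N) sqn (a i).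
Proof.
elim: N => [|N [F [dF eF]]].
  exists (cst 0); split; last by rewrite !big_ord0 mulr0 subrr.
  by move=> t; rewrite big_ord0 sqn0; exact: is_derive_cst.
pose w i := a i * (a N)^*; pose m i : R := (N - i)%:R.
(* [G i] is an antiderivative of [g i], the real part of [w i] times the conjugate of
   [expi (m i * t)]. *)
pose G i t := (re (w i) * sin (m i * t) - im (w i) * cos (m i * t)) / m i.
pose g i t := re (w i) * cos (m i * t) + im (w i) * sin (m i * t).
have dG (i : 'I_N) : primitive (g i) (G i).
  move=> t; have m0 : m i != 0 by rewrite pnatr_eq0 -lt0n subn_gt0.
  have dm : is_derive t 1 ( *%R (m i)) (m i).
    by apply: is_derive_eq (is_deriveZ _ _) _;
      rewrite ?scaler1 // /GRing.scale /= mulr1.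
  have ds : is_derive t 1 (sin \o *%R (m i)) (cos (m i * t) * m i).
    exact: is_derive1_comp.
  have dc : is_derive t 1 (cos \o *%R (m i)) (- sin (m i * t) * m i).
    exact: is_derive1_comp.
  rewrite /G; have -> : (fun t =>
    (re (w i) * sin (m i * t) - im (w i) * cos (m i * t)) / m i) =
      (re (w i) / m i) *: (sin \o *%R (m i)) + (- im (w i) / m i) *: (cos \o *%R
        (m i)).
    by apply/funext => u; rewrite !fctE /GRing.scale /=; ring.
  apply: (is_derive_eq (is_deriveD (is_deriveZ (re (w i) / m i) ds)
    (is_deriveZ (- im (w i) / m i) dc))).
  by rewrite /GRing.scale /= /g; field.
have eG (i : 'I_N) : G i (pi *+ 2) - G i 0 = 0.
  have := expiX (pi *+ 2) (N - i); rewrite expi_pi2 expr1n => -[ec es].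
  by rewrite /G -es -ec !mulr0 cos0 sin0 mulr0 mulr1 subrr.
have gE t : sqn (\sum_(i < N.+1) a i * expi t ^+ i) =
    sqn (\sum_(i < N) a i * expi t ^+ i) + sqn (a N) + 2 * \sum_(i < N) g i t.
  rewrite big_ord_recr /= sqnD; congr (_ + _ + 2 * _).
    rewrite sqnM [X in _ * X](_ : _ = 1) ?mulr1 //.
    by rewrite /sqn nrmX nrm_expi !expr1n.
  rewrite mulr_suml re_sum; apply: eq_bigr => i _;
    rewrite rmorphM /= mulrACA -/(w i).
  have -> : expi t ^+ i * (expi t ^+ N)^* = (expi (m i * t))^* :> C.
    have -> : expi t ^+ N = expi t ^+ i * expi t ^+ (N - i) :> C.
      by rewrite -exprD subnKC // ltnW.
    rewrite -expiX rmorphM /= mulrA.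
    by rewrite -sqnJ /sqn nrmX nrm_expi !expr1n mul1r.
  by rewrite /g /re /im; case: (w i) => x y /=; rewrite mulrN opprK.
exists (fun t => F t + sqn (a N) * t + 2 * \sum_(i < N) G i t); split.
  move=> t; rewrite gE.
  have -> : (fun t => F t + sqn (a N) * t + 2 * \sum_(i < N) G i t) =
      F + sqn (a N) *: id + 2 *: \sum_(i < N) G i.
    apply/funext => u; rewrite !fctE /GRing.scale /= fct_sumE.
    by [].
  have := dF t => dFt.
  have dS : is_derive t 1 (\sum_(i < N) G i) (\sum_(i < N) g i t).
    by apply: is_derive_sum => i; exact: dG.
  apply: (is_derive_eq (is_deriveD (is_deriveD dFt
    (is_deriveZ (sqn (a N)) (is_derive_id t 1))) (is_deriveZ 2 dS))).
  by rewrite /GRing.scale /= mulr1.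
have : \sum_(i < N) G i (pi *+ 2) - \sum_(i < N) G i 0 = 0.
  by rewrite -sumrB big1 // => i _; exact: eG.
move=> e0; rewrite big_ord_recr [RHS]mulrDr -eF /=.
move: e0; set S1 := \sum_(i < N) G i _; set S0 := \sum_(i < N) G i _ => e0.
by rewrite (_ : S1 = S0); [ring|exact: subr0_eq].
Qed.

Lemma integral_primitive (f F : R -> R) : primitive f F ->
  (forall t0, f t @[t --> t0] --> f t0) ->
  (\int[mu]_(t in circle) (f t)%:E = (F (pi *+ 2) - F 0)%:E)%E.
Proof.
move=> dF cf; rewrite EFinB; apply: continuous_FTC2.
- by rewrite mulrn_wgt0 // pi_gt0.
- exact: continuous_subspaceT.
- have cF t0 : F t @[t --> t0] --> F t0.
    by apply/differentiable_continuous/derivable1_diffP; have [] := dF t0.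
  split.
  + by move=> x _; have [] := dF x.
  + exact: cvg_at_right_filter.
  + exact: cvg_at_left_filter.
- by move=> x _; rewrite derive1E; have [] := dF x.
Qed.

Lemma bounded_convergence (fn : nat -> R -> R) (f : R -> R) (M : R) (An : nat ->
    R) :
  (forall n, measurable_fun circle (fn n)) -> measurable_fun circle f ->
  {ae mu, forall t, circle t -> fn n t @[n --> \oo] --> f t} ->
  (forall n t, `|fn n t| <= M) ->
  (forall n, \int[mu]_(t in circle) (fn n t)%:E = (An n)%:E)%E ->
  ((An n)%:E @[n --> \oo] --> \int[mu]_(t in circle) (f t)%:E)%E.
Proof.
move=> mfn mf cv bd In.
have mD : measurable circle by exact: measurable_itv.
have muD : (mu circle < +oo)%E.
  rewrite lebesgue_measure_itv /=; case: ifP => _ //.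
  by rewrite -EFinB ltry.
have [|||||_ _] := @dominated_convergence _ _ _ mu _ mD
   (fun n t => (fn n t)%:E) (fun t => (f t)%:E) (fun=> M%:E).
- by move=> n; apply/measurable_EFinP; exact: mfn.
- by apply/measurable_EFinP; exact: mf.
- have [N [mN N0 sN]] := cv; exists N; split => //.
  apply: subset_trans sN; apply: subsetC => t /= h Dt.
  by apply: cvg_EFin; [exact: nearW|exact: h].
- apply: (@measurable_bounded_integrable _ _ _ mu (fun=> M)) => //.
  exists M; split; first exact: num_real.
  move=> x Mx t _ /=; apply: ltW; apply: le_lt_trans Mx.
  by have := bd 0%N t; move/(le_trans (normr_ge0 _)) => M0; rewrite ger0_norm.
- by apply: aeW => t n _; rewrite lee_fin.
rewrite (_ : (fun n => _) = (fun n => (An n)%:E)) //.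
by apply/funext => n; rewrite In.
Qed.

Lemma measurable_continuous (f : R -> R) :
  (forall t0, f t @[t --> t0] --> f t0) -> measurable_fun circle f.
Proof. by move=> cf; apply: measurable_funTS;
  exact: continuous_measurable_fun. Qed.

Definition fourier a t : C := csum (fun n => a n * expi t ^+ n).

Lemma trig_poly_continuous N a t0 :
  sqn (\sum_(i < N) a i * expi t ^+ i) @[t --> t0] -->
  sqn (\sum_(i < N) a i * expi t0 ^+ i).
Proof. by apply: cvg_sqn; apply: cvg_poly; exact: cvg_expi. Qed.

Lemma nrm_fourier_term a t n : nrm (a n * expi t ^+ n) = nrm (a n).
Proof. by rewrite nrmM nrmX nrm_expi expr1n mulr1. Qed.

Lemma integral_trig_poly N a :
  (\int[mu]_(t in circle) (sqn (\sum_(i < N) a i * expi t ^+ i))%:E =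
   (pi *+ 2 * \sum_(i < N) sqn (a i))%:E)%E.
Proof.
have [F [dF <-]] := trig_poly_primitive N a.
by apply: integral_primitive => // t0; exact: trig_poly_continuous.
Qed.

Lemma abs_summable_l2 a : abs_summable a -> l2 a.
Proof.
move=> [M aM]; exists (M * M) => n.
have M0 : 0 <= M by apply: le_trans (aM 0%N); rewrite /series /= big_geq.
apply: le_trans (_ : series (fun k => M * nrm (a k)) n <= _).
  apply: ler_sum => i _; rewrite /= /sqn expr2 ler_wpM2r ?nrm_ge0 //.
  apply: le_trans (aM i.+1); rewrite seriesSr /= lerDr.
  by apply: sumr_ge0 => j _; exact: nrm_ge0.
rewrite /series /= -mulr_sumr ler_wpM2l //; exact: aM.
Qed.

(** Absolute summability bounds all partial sums by [M] uniformly in [t], which is the dominating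
    constant. It is available on every circle of radius less than 1, which is where the identity
    gets applied. *)
Lemma parseval a : abs_summable a ->
  measurable_fun circle (sqn \o fourier a) /\
  (\int[mu]_(t in circle) (sqn (fourier a t))%:E = (pi *+ 2 * nsq a)%:E)%E.
Proof.
move=> sa; have la := abs_summable_l2 sa.
have [M aM] := sa.
have M0 : 0 <= M by apply: le_trans (aM 0%N); rewrite /series /= big_geq.
pose fn N t := sqn (\sum_(i < N) a i * expi t ^+ i).
have cv t : fn N t @[N --> \oo] --> sqn (fourier a t).
  apply: cvg_sqn; rewrite (_ : (fun N => _) = series (fun n =>
    a n * expi t ^+ n)).
    apply: abs_summable_cvg; exists M => n; apply: le_trans (aM n).
    by apply: ler_sum => i _; rewrite /= nrm_fourier_term.
  by apply/funext => N; rewrite /series /= big_mkord.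
have mfn N : measurable_fun circle (fn N).
  by apply: measurable_continuous => t0; exact: trig_poly_continuous.
have mf : measurable_fun circle (sqn \o fourier a).
  by apply: (measurable_fun_cvg mfn) => t _; exact: cv.
split=> //.
have bd N t : `|fn N t| <= M ^+ 2.
  rewrite ger0_norm ?sqn_ge0 // /fn /sqn lerXn2r ?nnegrE ?nrm_ge0 //.
  apply: le_trans (nrm_sum _ _ _) _; apply: le_trans (aM N).
  rewrite /series /= big_mkord; apply: ler_sum => i _.
  by rewrite nrm_fourier_term.
have aecv : {ae mu, forall t, circle t ->
  fn n t @[n --> \oo] --> (sqn \o fourier a) t}.
  by apply: aeW => t _; exact: cv.
have lim1 := bounded_convergence mfn mf aecv bd (fun N =>
  integral_trig_poly N a).
have [cvn _ _] := nsq_series la.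
have lim2 : ((pi *+ 2 * \sum_(i < N) sqn (a i))%:E @[N --> \oo] --> (pi *+ 2 *
  nsq a)%:E)%E.
  apply: cvg_EFin; first exact: nearW.
  rewrite (_ : _ \o _ = fun N => pi *+ 2 * series (sqn \o a) N).
    by apply: cvgM; [exact: cvg_cst|exact: cvn].
  by apply/funext => N; rewrite /series /= big_mkord.
exact: (cvg_unique (@ereal_hausdorff R) lim1 lim2).
Qed.

Lemma pi2_neq0 : pi *+ 2 != 0 :> R.
Proof. by rewrite gt_eqF // mulrn_wgt0 // pi_gt0. Qed.

Lemma abs_summable_radius f a r : has_taylor f a -> 0 < r < 1 ->
  abs_summable (fun n => a n * rc r ^+ n).
Proof.
move=> fa /andP[r0 r1]; apply: subgeometric_summable.
  exact: taylor_subgeometric fa.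
by apply/discE; rewrite nrm_rc gtr0_norm.
Qed.

Lemma fourier_radius f a r t : has_taylor f a -> 0 < r < 1 ->
  fourier (fun n => a n * rc r ^+ n) t = f (rc r * expi t).
Proof.
move=> fa /andP[r0 r1]; rewrite (taylorE fa); last first.
  by apply/discE; rewrite nrmM nrm_expi mulr1 nrm_rc gtr0_norm.
apply: (congr1 (@csum R)); apply/funext => n.
by rewrite exprMn mulrA.
Qed.

(** Parseval on the circle of radius 1/2 makes the sum of the squared moduli of [a n / 2^n]
    vanish. *)
Lemma taylor_eq0 f a : has_taylor f a -> (forall z, @disc R z -> f z = 0) ->
  forall n, a n = 0.
Proof.
move=> fa f0 n; have h01 : 0 < (2^-1 : R) < 1 by lra.
have sb := abs_summable_radius fa h01.
have [_] := parseval sb.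
have -> : (\int[mu]_(t in circle)
    (sqn (fourier (fun n => a n * rc 2^-1 ^+ n) t))%:E = 0)%E.
  rewrite (eq_integral (fun=> 0%E)) ?integral0 // => t _.
  rewrite (fourier_radius _ fa) // f0 ?sqn0 //.
  by apply/discE; rewrite nrmM nrm_expi mulr1 nrm_rc gtr0_norm; lra.
move=> /esym[] /eqP; rewrite mulf_eq0 (negbTE pi2_neq0) /= => /eqP b0.
have /eqP := nsq_eq0 (abs_summable_l2 sb) b0 n.
rewrite mulf_eq0 expf_eq0 -(rc0 R) (inj_eq (@rc_inj R)) invr_eq0 pnatr_eq0 andbF
  orbF.
by move/eqP.
Qed.

Lemma taylor_unique f a b : has_taylor f a -> has_taylor f b -> a = b.
Proof.
move=> fa fb; apply/funext => n; apply/eqP; rewrite -subr_eq0; apply/eqP.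
have fc := has_taylorD fa (has_taylorZ (c := -1) fb).
rewrite -(taylor_eq0 fc _ n) ?mulN1r // => z _.
by rewrite mulN1r subrr.
Qed.

End Circle.

(** * Multiplication by an inner function *)

Section InnerIsometry.
Variable R : realType.
Notation C := (cplx R).
Notation mu := (@lebesgue_measure R).
Notation circle := (`[(0 : R), pi *+ 2]%classic).
Implicit Types (a b c d : nat -> C) (t : R) (theta : C -> C).

(** Dominated convergence needs a sequence of radii; the shift by 2 keeps every term, including the
    first, strictly between 0 and 1. *)
Definition radius n : R := 1 - n.+2%:R^-1.

Lemma radius01 n : 0 < radius n < 1.
Proof.
rewrite /radius subr_gt0 invf_lt1 ?ltr0n // ltr1n /= gtrBl invr_gt0.
by rewrite ltr0n.
Qed.

Lemma radius_cvg : radius @ \oo --> (1 : R).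
Proof.
rewrite -[X in _ --> X]subr0; apply: cvgB; first exact: cvg_cst.
by have h := @cvg_harmonic R; rewrite -cvg_shiftS in h.
Qed.

Lemma radius_cvg_left : radius @ \oo --> (1 : R)^'-.
Proof.
move=> P; rewrite /at_left /= nbhs_simpl => h.
have : \forall n \near \oo, (radius n < 1 -> P (radius n)).
  exact: radius_cvg h.
apply: filterS => n; apply.
by case/andP: (radius01 n).
Qed.

(** By Parseval, the integral of the squared modulus of [theta p] over the circle of radius
    [radius n] is [2 pi] times the squared norm of the damped coefficients [e n]. Since [theta] has
    boundary modulus 1 almost everywhere, the integrals tend to that of the squared modulus of [p].
    The damping is then removed, one inequality at a time. *)
Lemma inner_poly_isometry theta c N b : inner theta -> has_taylor theta c ->
  l2 (conv c (trunc N b)) /\ nsq (conv c (trunc N b)) = \sum_(i < N) sqn (b i).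
Proof.
move=> [_ [B thB] bdry] thc; set d := conv c _; set S := \sum_(i < N) _.
pose p (z : C) := \sum_(i < N) b i * z ^+ i.
have hd : has_taylor (fun z => theta z * p z) d.
  by have := has_taylorM thc (@has_taylor_poly R N b).
have r01 := radius01.
pose e n k := d k * rc (radius n) ^+ k.
have se n : abs_summable (e n) := abs_summable_radius hd (r01 n).
have le n : l2 (e n) := abs_summable_l2 (se n).
pose fn n t := sqn (fourier (e n) t).
have fnE n t : fn n t = sqn (theta (rc (radius n) * expi t)) * sqn (p (rc
  (radius n) * expi t)).
  by rewrite /fn (fourier_radius _ hd) // sqnM.
have rdisc n t : @disc R (rc (radius n) * expi t).
  apply/discE; rewrite nrmM nrm_expi mulr1 nrm_rc.
  by have /andP[r0 r1] := r01 n; rewrite gtr0_norm.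
(* [theta] is bounded by the real part of the complex constant [B], and [p] by the sum of the moduli
   of its coefficients. *)
pose M := (re B) ^+ 2 * (\sum_(i < N) nrm (b i)) ^+ 2.
have bd n t : `|fn n t| <= M.
  rewrite ger0_norm ?sqn_ge0 // fnE; apply: ler_pM; rewrite ?sqn_ge0 //.
    have nB : nrm (theta (rc (radius n) * expi t)) <= re B.
      by have := thB _ (rdisc n t); rewrite lecE => /andP[_].
    by rewrite /sqn lerXn2r ?nnegrE ?nrm_ge0 // (le_trans _ nB) ?nrm_ge0.
  rewrite /sqn lerXn2r ?nnegrE ?nrm_ge0 ?sumr_ge0 //.
  apply: le_trans (nrm_sum _ _ _) _; apply: ler_sum => i _.
  rewrite nrmM ler_piMr ?nrm_ge0 // nrmX exprn_ile1 ?nrm_ge0 // ltW //.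
  by apply/discE; exact: rdisc.
pose f t := sqn (p (expi t)).
have rcv : rc (radius n) @[n --> \oo] --> (1 : C) by exact: cvg_rc radius_cvg.
have aecv : {ae mu, forall t, circle t -> fn n t @[n --> \oo] --> f t}.
  have [Z [mZ Z0 sZ]] := bdry; exists Z; split => //.
  apply: subset_trans sZ; apply: subsetC => t /= h ct.
  have [l l1 thl] := h ct.
  under eq_fun do rewrite fnE.
  have -> : f t = sqn l * f t.
    by rewrite /sqn (_ : nrm l = 1) ?expr1n ?mul1r //; apply: rc_inj;
      rewrite -nrmE l1.
  apply: cvgM; apply: cvg_sqn.
    exact: (cvg_comp _ _ radius_cvg_left thl).
  apply: cvg_poly; rewrite -[X in _ --> X]mul1r.
  exact: (cvgM rcv (cvg_cst (expi t))).
have mf : measurable_fun circle f.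
  by apply: measurable_continuous => t0; exact: trig_poly_continuous.
have mfn n : measurable_fun circle (fn n) by have [] := parseval (se n).
have In n : (\int[mu]_(t in circle) (fn n t)%:E = (pi *+ 2 * nsq (e n))%:E)%E.
  by have [] := parseval (se n).
have := bounded_convergence mfn mf aecv bd In.
rewrite [X in _ --> X](integral_trig_poly N b) -/S => /fine_cvg /= lim.
have limS : nsq (e n) @[n --> \oo] --> S.
  rewrite (_ : (fun n => _) = fun n => (pi *+ 2)^-1 * (pi *+ 2 * nsq (e n)));
    last first.
    by apply/funext => n; rewrite mulKf // pi2_neq0.
  rewrite -[S](mulKf (pi2_neq0 R)); exact: (cvgM (cvg_cst _) lim).
(* Upper bound: a partial sum of fixed length [K] is the limit of damped partial sums, each at most
   [nsq (e n)]. *)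
have dS : psums_le (sqn \o d) S.
  move=> K.
  have lim' : series (sqn \o e n) K @[n --> \oo] --> series (sqn \o d) K.
    rewrite /series /=.
    elim: K => [|K IH].
      by under eq_fun do rewrite big_geq //; rewrite big_geq //; exact: cvg_cst.
    under eq_fun do rewrite big_nat_recr //=; rewrite big_nat_recr //=.
    apply: cvgD => //; apply: cvg_sqn; rewrite -[X in _ --> X]mulr1.
    apply: cvgM; first exact: cvg_cst.
    elim: K {IH} => [|K IH]; first by under eq_fun do rewrite expr0;
      exact: cvg_cst.
    rewrite (_ : (fun n => _) = fun n => rc (radius n) * rc (radius n) ^+ K);
      last first.
      by apply/funext => n; rewrite exprS.
    by rewrite -[X in _ --> X]mulr1; exact: (cvgM rcv IH).
  apply: (ler_cvg_to lim' limS); apply: nearW => n.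
  by have [_ _] := nsq_series (le n); exact.
have ld : l2 d by exists S.
split=> //; apply/eqP; rewrite eq_le; apply/andP; split.
  by have [_ h _] := nsq_series ld; exact: h.
(* Lower bound: damping only decreases moduli, so [nsq (e n)] is at most [nsq d] for every [n]. *)
apply: (cvgr_to_le limS); apply: nearW => n.
have [_ h _] := nsq_series (le n); apply: h => K.
have [_ _ h'] := nsq_series ld; apply: le_trans (h' K).
apply: ler_sum => i _; rewrite /= /e sqnM ler_piMr ?sqn_ge0 //.
have /andP[r0 r1] := r01 n.
by rewrite /sqn nrmX nrm_rc gtr0_norm // !exprn_ile1 ?exprn_ge0 // ltW.
Qed.

End InnerIsometry.

(** * Multiplication by an inner function on square-summable sequences, and its adjoint *)

Section InnerMultiplication.
Variable R : realType.
Notation C := (cplx R).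
Implicit Types (a b c d : nat -> C) (theta : C -> C).

Lemma convDr c a b : conv c (fun n => a n + b n) = (fun n =>
    conv c a n + conv c b n).
Proof.
apply/funext => n; rewrite /conv -big_split; apply: eq_bigr => i _.
by rewrite mulrDr.
Qed.

Lemma convZr c (x : C) a : conv c (fun n => x * a n) = (fun n =>
    x * conv c a n).
Proof.
apply/funext => n; rewrite /conv mulr_sumr; apply: eq_bigr => i _.
by rewrite mulrCA.
Qed.

Lemma conv_trunc c a N n : (n < N)%N -> conv c (trunc N a) n = conv c a n.
Proof.
move=> nN; apply: eq_bigr => i _.
by rewrite /trunc (leq_ltn_trans (leq_subr _ _) nN).
Qed.

Lemma nsqD a b : l2 a -> l2 b ->
  nsq (fun n => a n + b n) = nsq a + nsq b + 2 * re (dot a b).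
Proof.
move=> la lb; have ls := l2D la lb; apply: rc_inj.
rewrite -nsqE // (dotDl la lb ls) (dotDr la la lb) (dotDr lb la lb) (dotC la
  lb).
rewrite !nsqE // !rcD rcM.
have -> : rc (re (dot a b)) = (dot a b + (dot a b)^*) / 2.
  by rewrite /rc /re complexRe ReE.
rewrite (_ : rc 2 = 2); last by rewrite /rc rmorph_nat.
by field.
Qed.

Lemma dot_cvg0 a (e : nat -> nat -> C) : l2 a -> (forall N, l2 (e N)) ->
  nsq (e N) @[N --> \oo] --> (0 : R) -> dot a (e N) @[N --> \oo] --> (0 : C).
Proof.
move=> la le e0; apply/cvgCP.
apply: (@cvg_dist_le _ _ _ _ _ (fun N => Num.sqrt (nsq a * nsq (e N)))).
  move=> N; rewrite !subr0 ger0_norm ?nrm_ge0 // nrm_sqn ler_wsqrtr //.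
  exact: dot_CauchySchwarz.
rewrite -(@sqrtr0 R); apply: continuous_cvg; first exact: sqrt_continuous.
rewrite -(mulr0 (nsq a)); exact: (cvgM (cvg_cst _) e0).
Qed.

(** The first [N] coefficients of [conv c a] involve only [trunc N a], so the polynomial case gives
    square-summability and one inequality. For equality, the product with [trunc N a] is the product
    with [a] minus the product with the tail [D N], and the latter tends to 0 in norm by the
    inequality already obtained. *)
Lemma inner_isometry theta c a : inner theta -> has_taylor theta c -> l2 a ->
  l2 (conv c a) /\ nsq (conv c a) = nsq a.
Proof.
move=> inth thc; have le a' : l2 a' -> psums_le (sqn \o conv c a') (nsq a').
  move=> la N; have [_ _ ha] := nsq_series la.
  have [lN nN] := inner_poly_isometry N a' inth thc.
  have [_ _ hN] := nsq_series lN.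
  apply: le_trans (ha N); rewrite [leRHS]/series /= big_mkord -nN.
  apply: le_trans (hN N); rewrite /series /= !big_mkord.
  by apply: ler_sum => i _; rewrite /= conv_trunc.
move=> la; have lA : l2 (conv c a) by exists (nsq a); exact: le.
split=> //.
pose D N n := a n + -1 * trunc N a n.
have lD N : l2 (D N) by apply: l2D => //; apply: l2Z; exact: l2_trunc.
have lcD N : l2 (conv c (D N)) by exists (nsq (D N)); exact: le.
have cD0 : nsq (conv c (D N)) @[N --> \oo] --> (0 : R).
  apply: (@cvg_dist_le _ _ _ _ _ (fun N => nsq (D N)));
    last exact: l2_trunc_cvg.
  move=> N; rewrite subr0 ger0_norm ?nsq_ge0 //.
  by have [_ h _] := nsq_series (lcD N); apply: h; exact: le.
have lcD' N : l2 (fun n => -1 * conv c (D N) n) by exact: l2Z.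
have E N : \sum_(i < N) sqn (a i) =
    nsq (conv c a) + nsq (conv c (D N)) - 2 * re (dot (conv c a) (conv c (D
      N))).
  have [lN <-] := inner_poly_isometry N a inth thc.
  have -> : conv c (trunc N a) = (fun n => conv c a n + -1 * conv c (D N) n).
    have {1}-> : trunc N a = (fun n => a n + -1 * D N n).
      by apply/funext => n; rewrite /D; ring.
    by rewrite (convDr c a) (convZr c _ (D N)).
  rewrite nsqD // dotZr // rmorphN rmorph1 mulN1r reN mulrN; congr (_ + _ - _).
  apply: rc_inj; rewrite -!nsqE // dotZl // dotZr //.
  by rewrite rmorphN rmorph1 mulN1r mulN1r opprK.
have dc := dot_cvg0 lA lcD cD0.
have [cv _ _] := nsq_series la.
rewrite -[nsq a]/(limn (series (sqn \o a))).
apply/esym; apply: cvg_lim => //;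
  rewrite (_ : series _ = fun N => nsq (conv c a) + nsq (conv c (D N)) -
    2 * re (dot (conv c a) (conv c (D N)))); last first.
  by apply/funext => N; rewrite -E /series /= big_mkord.
rewrite [X in _ --> X](_ : _ = nsq (conv c a) + 0 - 2 * re (0 : C)); last first.
  by rewrite /re /= mulr0 addr0 subr0.
apply: cvgB.
  exact: (cvgD (cvg_cst _) cD0).
exact: (cvgM (cvg_cst _) (cvg_re dc)).
Qed.

Lemma cplx_eq (z w : C) : re z = re w ->
    re ((0 -i* 1)%C * z) = re ((0 -i* 1)%C * w) ->
  z = w.
Proof.
case: z w => [x y] [x' y'] /= -> /=.
by rewrite /re /= !mul0r !sub0r !mulN1r !opprK => ->.
Qed.

(** Polarization: the norm of [a + b] determines the real part of the inner product, and replacing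
    [b] by [i b] the imaginary part. Conjugate-linearity in the second argument turns [i] into [-i],
    the multiplier in [cplx_eq]. *)
Lemma inner_dot theta c a b : inner theta -> has_taylor theta c -> l2 a ->
    l2 b ->
  dot (conv c a) (conv c b) = dot a b.
Proof.
move=> inth thc la lb.
have iso x : l2 x -> l2 (conv c x) /\ nsq (conv c x) = nsq x.
  exact: inner_isometry inth thc.
have key x : l2 x -> re (dot (conv c a) (conv c x)) = re (dot a x).
  move=> lx; have [lA nA] := iso _ la; have [lX nX] := iso _ lx.
  have [_] := iso _ (l2D la lx).
  rewrite convDr !nsqD // nA nX => /addrI /mulfI; apply.
  by rewrite pnatr_eq0.
apply: cplx_eq; first exact: key.
have := key _ (l2Z (0 +i* 1)%C lb); rewrite convZr.
by rewrite !dotZr //; have [] := iso _ la; have [] := iso _ lb.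
Qed.

Definition unit_seq (N n : nat) : C := (n == N)%:R.

Lemma truncS a (N : nat) :
  trunc N.+1 a = (fun n => trunc N a n + a N * unit_seq N n).
Proof.
apply/funext => n; rewrite /trunc /unit_seq ltnS leq_eqVlt.
case: eqVneq => [->|_] /=; first by rewrite ltnn add0r mulr1.
by rewrite mulr0 addr0.
Qed.

Lemma l2_unit_seq N : l2 (unit_seq N).
Proof.
suff <- : trunc N.+1 (unit_seq N) = unit_seq N by exact: l2_trunc.
apply/funext => n; rewrite /trunc /unit_seq ltnS.
by case: eqVneq => [->|]; rewrite ?leqnn // if_same.
Qed.

(** The coefficients of the adjoint image are forced by testing on unit sequences. Testing on a
    truncation of this candidate itself makes it square-summable: a partial sum [s] of its squared
    moduli satisfies [s^2 <= nsq a * s]. *)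
Lemma inner_adjoint theta c a : inner theta -> has_taylor theta c -> l2 a ->
  exists a', l2 a' /\ forall b, l2 b -> dot a (conv c b) = dot a' b.
Proof.
move=> inth thc la.
have iso x : l2 x -> l2 (conv c x) /\ nsq (conv c x) = nsq x.
  exact: inner_isometry inth thc.
pose a' n := dot a (conv c (unit_seq n)).
have dt b N : dot a (conv c (trunc N b)) = \sum_(i < N) a' i * (b i)^*.
  elim: N => [|N IH].
    have -> : conv c (trunc 0 b) = trunc 0 b.
      by apply/funext => n; rewrite /conv big1 // => i _; rewrite /trunc mulr0.
    by rewrite dot_trunc !big_ord0.
  rewrite big_ord_recr -IH truncS convDr convZr.
  have [lt _] := iso _ (l2_trunc b N); have [lu _] := iso _ (l2_unit_seq N).
  by rewrite dotDr ?dotZr //; [rewrite mulrC|exact: l2Z].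
have la' : l2 a'.
  exists (nsq a) => N; set s := series _ N.
  have sE : s = \sum_(i < N) sqn (a' i) by rewrite /s /series /= big_mkord.
  have [lt nt] := iso _ (l2_trunc a' N).
  have := dot_CauchySchwarz la lt; rewrite nt nsq_trunc -sE dt.
  rewrite (_ : \sum_(i < N) _ = rc s); last first.
    by rewrite sE rc_sum; apply: eq_bigr => i _; rewrite sqnJ.
  rewrite /sqn nrm_rc real_normK ?num_real // expr2.
  have s0 : 0 <= s by rewrite sE; apply: sumr_ge0 => i _; exact: sqn_ge0.
  have [->|sn] := eqVneq s 0; first by rewrite nsq_ge0.
  by rewrite ler_pM2r // lt_def sn.
exists a'; split => // b lb.
have cv := abs_summable_cvg (l2_dot la' lb).
apply/esym; apply: (csumE (l := dot a (conv c b))).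
rewrite (_ : series _ = fun N => dot a (conv c (trunc N b))); last first.
  by apply/funext => N; rewrite dt /series /= big_mkord.
pose D N n := b n + -1 * trunc N b n.
have lD N : l2 (D N) by apply: l2D => //; apply: l2Z; exact: l2_trunc.
have lcD N : l2 (conv c (D N)) by have [] := iso _ (lD N).
have d0 : dot a (conv c (D N)) @[N --> \oo] --> (0 : C).
  apply: dot_cvg0 => //.
  rewrite (_ : (fun N => _) = fun N => nsq (D N)); first exact: l2_trunc_cvg.
  by apply/funext => N; have [] := iso _ (lD N).
have [lB _] := iso _ lb.
rewrite (_ : (fun N => _) = fun N => dot a (conv c b) - dot a (conv c (D N))).
  rewrite -[X in _ --> X]subr0; exact: (cvgB (cvg_cst _) d0).
apply/funext => N; have [lt _] := iso _ (l2_trunc b N).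
by rewrite /D convDr convZr dotDr ?dotZr ?rmorphN ?rmorph1 //;
  [ring|exact: l2Z].
Qed.

End InnerMultiplication.

(** * Inner functions *)

Section InnerFunctions.
Variable R : realType.
Notation C := (cplx R).
Notation mu := (@lebesgue_measure R).
Implicit Types (a b c d : nat -> C) (t : R) (theta psi f g : C -> C) (z w : C).

Lemma ae_imply2 (P Q S : R -> Prop) :
  {ae mu, forall t, P t} -> {ae mu, forall t, Q t} ->
  (forall t, P t -> Q t -> S t) -> {ae mu, forall t, S t}.
Proof.
move=> hP hQ PQS; have := negligibleU hP hQ; apply: negligibleS.
move=> t /= nS; apply: contrapT => /not_orP[/contrapT hp /contrapT hq].
by apply: nS; exact: PQS.
Qed.

Lemma near1_disc t : \forall r \near (1 : R)^'-, @disc R (rc r * expi t).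
Proof.
near=> r; apply/discE; rewrite nrmM nrm_expi mulr1 nrm_rc gtr0_norm.
  by near: r; exact: nbhs_left_lt.
by near: r; exact: nbhs_left_gt.
Unshelve. all: by end_near. Qed.

Lemma radial_cvg t : rc r * expi t @[r --> (1 : R)^'-] --> (expi t : C).
Proof.
rewrite -[X in _ --> X]mul1r; apply: (cvgM _ (cvg_cst (expi t))).
apply: (@cvg_rc _ _ _ _ id 1); exact: cvg_at_left_filter.
Qed.

Lemma eq_inner theta psi : (forall z, @disc R z -> theta z = psi z) ->
  inner theta -> inner psi.
Proof.
move=> e [[c thc] [B thB] bdry]; split.
- by exists c; exact: eq_has_taylor e thc.
- by exists B => z z1; rewrite -e //; exact: thB.
- apply: (ae_imply2 bdry bdry) => t h _ /h[l l1 hl]; exists l => //.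
  apply: cvg_trans hl; apply: near_eq_cvg.
  by apply: filterS (near1_disc t) => r rd; rewrite e.
Qed.

Lemma innerM theta psi : inner theta -> inner psi ->
  inner (fun z => theta z * psi z).
Proof.
move=> [[c thc] [B thB] bdry] [[d psd] [B' psB] bdry']; split.
- by exists (conv c d); exact: has_taylorM.
- by exists (B * B') => z z1; rewrite normrM ler_pM ?thB ?psB.
- apply: (ae_imply2 bdry bdry') => t h h' ct.
  have [l l1 hl] := h ct; have [l' l1' hl'] := h' ct.
  exists (l * l'); first by rewrite normrM l1 l1' mulr1.
  exact: (cvgM hl hl').
Qed.

Lemma taylor_const (x : C) : has_taylor (fun=> x) (trunc 1 (fun=> x)).
Proof.
apply: (eq_has_taylor _ (@has_taylor_poly R 1 (fun=> x))) => z _.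
by rewrite big_ord_recl big_ord0 expr0 mulr1 addr0.
Qed.

Lemma inner_const (x : C) : `|x| = 1 -> inner (fun=> x).
Proof.
move=> x1; split.
- by eexists; exact: taylor_const.
- by exists 1 => z _; rewrite x1.
- by apply: aeW => t _; exists x => //; exact: cvg_cst.
Qed.

Lemma inner_id : inner (id : C -> C).
Proof.
split.
- exists (trunc 2 (fun n => n%:R)).
  apply: (eq_has_taylor _ (@has_taylor_poly R 2 (fun n => n%:R))) => z _.
  by rewrite !big_ord_recl big_ord0 /= mul0r expr1 mul1r add0r addr0.
- by exists 1 => z; rewrite /disc /= => /ltW.
- apply: aeW => t _; exists (expi t); last exact: radial_cvg.
  by rewrite nrmE nrm_expi.
Qed.

Lemma convC a b : conv a b = conv b a.
Proof.
apply/funext => n; rewrite /conv (reindex_inj rev_ord_inj) /=.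
by apply: eq_bigr => i _; rewrite subSS subKn -1?ltnS // mulrC.
Qed.

(** Both sides are the Taylor coefficients of the same product of three functions. *)
Lemma convA a b c : subgeometric a -> subgeometric b -> subgeometric c ->
  conv (conv a b) c = conv a (conv b c).
Proof.
move=> /subgeometric_taylor ha /subgeometric_taylor hb /subgeometric_taylor hc.
apply: taylor_unique (has_taylorM (has_taylorM ha hb) hc) _.
apply: (eq_has_taylor _ (has_taylorM ha (has_taylorM hb hc))) => z _.
by rewrite mulrA.
Qed.

Lemma conv_unit_seqS c N : conv (unit_seq R N.+1) c =
  conv (unit_seq R 1) (conv (unit_seq R N) c).
Proof.
apply/funext => -[|n].
  by rewrite /conv !big_ord_recl !big_ord0 /unit_seq /= !mulr0n !mul0r.
rewrite /conv [RHS](bigD1 (inord 1)) //= [X in _ + X]big1; last first.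
  move=> i ni; rewrite /unit_seq; have /negbTE -> : nat_of_ord i != 1%N.
    by apply: contraNneq ni => i1; apply/eqP/val_inj; rewrite /= inordK.
  by rewrite mul0r.
rewrite addr0 /unit_seq inordK // eqxx mul1r subSS subn0 big_ord_recl mul0r
  add0r.
by apply: eq_bigr => i _; rewrite /= /bump /= add1n eqSS subSS.
Qed.

Lemma has_taylor_id : has_taylor (id : C -> C) (unit_seq R 1).
Proof.
have := @has_taylor_poly R 2 (unit_seq R 1).
rewrite (_ : trunc 2 _ = unit_seq R 1).
  apply: eq_has_taylor => z _.
  by rewrite !big_ord_recl big_ord0 /unit_seq /= mul0r expr1 mul1r add0r addr0.
by apply/funext => n; rewrite /trunc /unit_seq; case: n => [|[|n]].
Qed.

(** By linearity this reduces to unit sequences, and convolution with one of them is repeated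
    multiplication by the inner function [id]. *)
Lemma l2_conv_trunc c b N : l2 c -> l2 (conv c (trunc N b)).
Proof.
move=> lc; elim: N => [|N IH].
  suff -> : conv c (trunc 0 b) = trunc 0 b by exact: l2_trunc.
  by apply/funext => n; rewrite /conv big1 // => i _; rewrite /trunc mulr0.
rewrite truncS convDr convZr; apply: l2D => //; apply: l2Z; rewrite convC.
elim: N {IH} => [|N IH].
  suff -> : conv (unit_seq R 0) c = c by [].
  apply/funext => n; rewrite /conv big_ord_recl big1 /unit_seq /= ?mul1r ?subn0
    ?addr0 //.
  by move=> i _; rewrite mul0r.
rewrite conv_unit_seqS.
by have [] := inner_isometry inner_id has_taylor_id IH.
Qed.

(* Testing the multiplication by [g] on truncations of the reproducing kernel
   at [w]. *)
Lemma multiplier_le1 g c w : has_taylor g c ->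
  (forall N b, l2 (conv c (trunc N b)) /\
    nsq (conv c (trunc N b)) <= \sum_(i < N) sqn (b i)) ->
  @disc R w -> nrm (g w) <= 1.
Proof.
move=> gc ctr w1; have /discE w1' := w1.
pose b n := (w ^+ n)^*.
have lb : l2 b.
  apply: abs_summable_l2; apply: (@summable_geometric _ _ 1 (nrm w)).
    by rewrite nrm_ge0.
  by move=> n; rewrite nrmJ nrmX mul1r.
pose S N := \sum_(i < N) sqn (b i).
have Scv : S N @[N --> \oo] --> nsq b.
  have [cv _ _] := nsq_series lb.
  rewrite (_ : S = series (sqn \o b)); first exact: cv.
  by apply/funext => N; rewrite /series /= big_mkord.
have K1 : 1 <= nsq b.
  by have := sqn_le_nsq 0 lb; rewrite /b expr0 rmorph1 sqn1.
(* The inner product of the multiplied truncation with [b] is its value at [w], namely [g w] times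
   [S N]. Cauchy-Schwarz then carries a factor [S N] on both sides, which cancels unless it is 0. *)
have bound N : sqn (g w) * S N <= nsq b.
  have [ld nd] := ctr N b.
  have := dot_CauchySchwarz ld lb.
  have -> : dot (conv c (trunc N b)) b = g w * rc (S N).
    have := taylorE (has_taylorM gc (@has_taylor_poly R N b)) w1.
    rewrite (_ : \sum_(i < N) b i * w ^+ i = rc (S N)); last first.
      by rewrite rc_sum; apply: eq_bigr => i _; rewrite sqnJ conjCK.
    move=> ->; rewrite /dot; congr csum; apply/funext => n.
    by rewrite /b conjCK.
  have S0 : 0 <= S N by apply: sumr_ge0 => i _; exact: sqn_ge0.
  rewrite sqnM [sqn (rc _)]/sqn nrm_rc real_normK ?num_real // expr2 mulrA.
  move=> /le_trans /(_ (ler_wpM2r (nsq_ge0 lb) nd));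
    rewrite [leRHS]mulrC -/(S N).
  have [->|sn] := eqVneq (S N) 0; first by move=> _; rewrite mulr0 nsq_ge0.
  by rewrite ler_pM2r // lt_def sn.
have : sqn (g w) * nsq b <= nsq b.
  apply: (cvgr_to_le (cvgM (cvg_cst (sqn (g w))) Scv)).
  exact: nearW.
have K0 : 0 < nsq b by apply: lt_le_trans K1.
by rewrite ger_pMl // /sqn expr_le1 ?nrm_ge0.
Qed.

Lemma inner_le1 theta w : inner theta -> @disc R w -> nrm (theta w) <= 1.
Proof.
move=> ith w1; have [[c thc] _ _] := ith.
apply: (multiplier_le1 thc _ w1) => N b.
by have [h ->] := inner_poly_isometry N b ith thc.
Qed.

Lemma inner_l2 theta c : inner theta -> has_taylor theta c -> l2 c /\ nsq c = 1.
Proof.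
move=> ith thc; have := inner_poly_isometry 1 (fun=> 1) ith thc.
rewrite big_ord_recl big_ord0 addr0 sqn1.
suff -> : conv c (trunc 1 (fun=> 1)) = c by [].
apply/funext => n; rewrite /conv big_ord_recr /= subnn big1 ?add0r.
  by rewrite /trunc mulr1.
by move=> i _; rewrite /trunc ltnS leqn0 subn_eq0 leqNgt ltn_ord mulr0.
Qed.

(** Multiplying by [psi2] does not change norms, so [g p] has the norm of [psi1 p], which is that of
    [p], for every polynomial [p]. This makes [g] a contractive multiplier, hence bounded by 1; its
    radial limits are quotients of those of [psi1] and [psi2]. *)
Lemma inner_div psi1 psi2 g c : inner psi1 -> inner psi2 -> has_taylor g c ->
  l2 c -> (forall z, @disc R z -> psi1 z = psi2 z * g z) -> inner g.
Proof.
move=> i1 i2 gc lc e; have [_ _ bd1] := i1; have [[c2 h2] _ bd2] := i2; split.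
- by exists c.
- exists 1 => z z1; rewrite nrmE -(rc1 R) rc_le.
  apply: (multiplier_le1 gc _ z1) => N b.
  have lx := l2_conv_trunc b N lc; split => //.
  have [_ <-] := inner_isometry i2 h2 lx.
  rewrite -convA; [|exact: taylor_subgeometric h2|exact: l2_subgeometric|].
    have h1 : has_taylor psi1 (conv c2 c).
      by apply: (eq_has_taylor _ (has_taylorM h2 gc)) => y y1; rewrite e.
    by have [_ ->] := inner_poly_isometry N b i1 h1.
  by apply: l2_subgeometric; exact: l2_trunc.
- apply: (ae_imply2 bd1 bd2) => t h1 h2' ct.
  have [l l1 hl] := h1 ct; have [l' l1' hl'] := h2' ct.
  have l'0 : l' != 0 by rewrite -normr_eq0 l1' oner_eq0.
  exists (l / l'); first by rewrite normrM normfV l1 l1' invr1 mulr1.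
  apply: cvg_trans (cvgM hl (cvgV l'0 hl')); apply: near_eq_cvg.
  near=> r; have rd : disc (rc r * expi t) by near: r; exact: near1_disc.
  have nz : psi2 (rc r * expi t) != 0 by near: r; exact: cvgr_neq0 hl' l'0.
  rewrite /= /unstable.inv_fun /= [psi1 _](e _ rd) // mulrAC mulfV ?mul1r.
Unshelve. all: by end_near. Qed.

Lemma nrm_conj_lt1 (a z : C) : nrm a < 1 -> nrm z <= 1 -> nrm (a^* * z) < 1.
Proof.
move=> a1 z1; rewrite nrmM nrmJ; apply: le_lt_trans a1.
by rewrite ler_piMr ?nrm_ge0.
Qed.

Lemma one_sub_neq0 (x : C) : nrm x < 1 -> 1 - x != 0.
Proof.
by apply: contraTneq => /eqP; rewrite subr_eq0 => /eqP <-; rewrite nrm1 ltxx.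
Qed.

Definition blaschke_factor (a z : C) : C := (z - a) / (1 - a^* * z).

Lemma has_taylor_geometric (x : C) : nrm x < 1 ->
  has_taylor (fun z => (1 - x * z)^-1) (fun n => x ^+ n).
Proof.
move=> x1; have sx : subgeometric (fun n => x ^+ n).
  move=> r /andP[r0 r1]; exists 1 => n; rewrite nrmX -exprMn.
  by rewrite exprn_ile1 ?mulr_ge0 ?nrm_ge0 ?(ltW r0) // mulr_ile1 ?nrm_ge0 //
    ltW.
apply: (eq_has_taylor _ (subgeometric_taylor sx)) => z /[dup] z1 /discE z1'.
have xz : 1 - x * z != 0.
  apply: one_sub_neq0; rewrite nrmM; apply: le_lt_trans x1.
  by rewrite ler_piMr ?nrm_ge0 ?(ltW z1').
apply: (mulfI xz); rewrite divff //.
have sz := subgeometric_summable sx z1.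
rewrite mulrBl mul1r [X in X - _]csum_shift // !expr0 mulr1 -(csumZ (x * z)) //.
rewrite -addrA [X in _ + X](_ : _ = 0) ?addr0 //.
apply/eqP; rewrite subr_eq0; apply/eqP; congr csum; apply/funext => n.
by rewrite !exprS; ring.
Qed.

Lemma inner_blaschke_factor (a : C) : @disc R a -> inner (blaschke_factor a).
Proof.
move=> /discE a1; have a1' : nrm (a^*) < 1 by rewrite nrmJ.
split.
- have h1 := has_taylor_geometric a1'.
  have h2 := has_taylorD has_taylor_id (taylor_const (x := - a)).
  by eexists; exact: has_taylorM h2 h1.
(* A crude bound is enough: the numerator is at most 2 and the denominator at least [1 - nrm a]. *)
- exists (rc (2 / (1 - nrm a))) => z /discE z1; rewrite nrmE rc_le nrmM nrmV.
  apply: ler_pM; rewrite ?nrm_ge0 ?invr_ge0 ?nrm_ge0 //.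
    by rewrite (le_trans (nrmD _ _)) // nrmN -[2]/(1 + 1); apply: lerD;
      exact: ltW.
  have d0 : 0 < 1 - nrm a by rewrite subr_gt0.
  rewrite lef_pV2 ?posrE // ?lt_def ?nrm_ge0 ?nrm_eq0 ?one_sub_neq0 ?andbT //.
    rewrite lerBlDr -(nrm1 R) -[X in nrm X <= _](subrK (a^* * z)).
    apply: le_trans (nrmD _ _) _; rewrite lerD2l nrmM nrmJ.
    by rewrite ler_piMr ?nrm_ge0 ?(ltW z1).
  by apply: nrm_conj_lt1 => //; exact: ltW.
- apply: aeW => t _.
  have nz : 1 - a^* * expi t != 0.
    by apply: one_sub_neq0; apply: nrm_conj_lt1; rewrite ?nrm_expi.
  exists (blaschke_factor a (expi t)).
    have ee : expi t * (expi t)^* = 1 :> C by rewrite -sqnJ sqn_expi.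
    rewrite /blaschke_factor nrmE nrmM nrmV.
    (* On the circle the numerator is, up to a unimodular factor, the conjugate of the
       denominator. *)
    have -> : expi t - a = expi t * (1 - a^* * expi t)^*.
      rewrite rmorphB rmorph1 rmorphM /= conjCK mulrBr mulr1.
      by rewrite mulrCA ee mulr1.
    by rewrite nrmM nrm_expi mul1r nrmJ mulfV ?nrm_eq0.
  have h1 : rc r * expi t - a @[r --> (1 : R)^'-] --> expi t - a.
    by apply: cvgB; [exact: radial_cvg|exact: cvg_cst].
  have h2 : 1 - a^* * (rc r * expi t) @[r --> (1 : R)^'-] --> 1 - a^* * expi t.
    apply: cvgB; first exact: cvg_cst.
    exact: (cvgM (cvg_cst (a^*)) (radial_cvg (t := t))).
  exact: (cvgM h1 (cvgV nz h2)).
Qed.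

End InnerFunctions.

(** * The Hardy space *)

Section HardySpace.
Variable R : realType.
Notation C := (cplx R).
Implicit Types (f g h u theta psi : C -> C) (x w z : C).

Lemma taylor_eq f a : has_taylor f a -> taylor f = a.
Proof.
move=> fa; rewrite /taylor; case: xgetP => [b _ fb|/(_ a)//].
exact: taylor_unique fb fa.
Qed.

Lemma hardyP f : hardy f <->
  [/\ has_taylor f (taylor f), l2 (taylor f) & forall z, ~ @disc R z ->
    f z = 0].
Proof.
split=> [[[a fa /l2_series la] f0]|[ft lt f0]].
  by rewrite (taylor_eq fa).
by split=> //; exists (taylor f) => //; apply/l2_series.
Qed.

(** Elements of [hardy] vanish outside the disc, so an analytic function has to be cut off there to
    become one. *)
Definition restr f z : C := if nrm z < 1 then f z else 0.

Lemma restrE f z : @disc R z -> restr f z = f z.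
Proof. by move=> /discE z1; rewrite /restr z1. Qed.

Lemma restr0 f z : ~ @disc R z -> restr f z = 0.
Proof. by move=> z1; rewrite /restr; case: ifPn => // /discE. Qed.

Lemma has_taylor_restr f a : has_taylor f a -> has_taylor (restr f) a.
Proof. by apply: eq_has_taylor => z z1; rewrite restrE. Qed.

Lemma hardy_restr f a : has_taylor f a -> l2 a -> hardy (restr f).
Proof.
move=> fa la; apply/hardyP; rewrite (taylor_eq (has_taylor_restr fa)).
by split; [exact: has_taylor_restr|exact: la|exact: restr0].
Qed.

Lemma hardy_ext f g : hardy f -> hardy g ->
  (forall z, @disc R z -> f z = g z) -> f = g.
Proof.
move=> /hardyP[_ _ f0] /hardyP[_ _ g0] fg; apply/funext => z.
by have [z1|z1] := pselect (@disc R z); [exact: fg|rewrite f0 ?g0].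
Qed.

Lemma has_taylor_lin x f g a b : has_taylor f a -> has_taylor g b ->
  has_taylor (x *: f + g) (fun n => x * a n + b n).
Proof. by move=> fa gb; have := has_taylorD (has_taylorZ (c := x) fa) gb. Qed.

Lemma hardy_subspace : is_subspace (@hardy R).
Proof.
split=> [|x f g hf hg].
  apply/hardyP; suff h : has_taylor (0 : C -> C) (trunc 0 (fun=> 0)).
    by rewrite (taylor_eq h); split; [exact: h|exact: l2_trunc|by []].
  by apply: (eq_has_taylor _ (@has_taylor_poly R 0 (fun=> 0))) => z _;
    rewrite big_ord0.
have [[fa la f0] [gb lb g0]] := (proj1 (hardyP f) hf, proj1 (hardyP g) hg).
have h := has_taylor_lin (x := x) fa gb.
apply/hardyP; rewrite (taylor_eq h); split.
- exact: h.
- by apply: l2D => //; exact: l2Z.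
- by move=> z z1; rewrite !fctE f0 ?g0 // /GRing.scale /= mulr0 addr0.
Qed.

Lemma hardy0 : hardy (0 : C -> C). Proof. by case: hardy_subspace. Qed.
Lemma hardyB f g : hardy f -> hardy g -> hardy (f - g).
Proof. exact: subspaceB hardy_subspace. Qed.

Lemma hardy_dotT f g : hardy_dot f g = dot (taylor f) (taylor g).
Proof. by []. Qed.

(* Comparing unfolded instances of these constants makes unification diverge. *)
Local Opaque hardy hardy_dot taylor.

Lemma hardy_dot_lin x f g h : hardy f -> hardy g -> hardy h ->
  hardy_dot (x *: f + g) h = x * hardy_dot f h + hardy_dot g h.
Proof.
move=> /hardyP[fa la _] /hardyP[gb lb _] /hardyP[hc lc _].
rewrite (hardy_dotT (_ + _)) (hardy_dotT f) (hardy_dotT g) (taylor_eq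
  (has_taylor_lin (x := x) fa gb)).
etransitivity; first exact: (dotDl (l2Z x la) lb lc).
by rewrite (dotZl x la lc).
Qed.

Lemma hardy_dot_linear h : hardy h ->
  linear_on (@hardy R) (fun f => hardy_dot f h : C^o).
Proof. by move=> hh x f g hf hg; exact: hardy_dot_lin. Qed.

Lemma hardy_dotC f g : hardy f -> hardy g -> hardy_dot g f = (hardy_dot f g)^*.
Proof. by move=> /hardyP[_ la _] /hardyP[_ lb _];
  rewrite (hardy_dotT g) (hardy_dotT f); exact: dotC. Qed.

Lemma hardy_dotBl f g h : hardy f -> hardy g -> hardy h ->
  hardy_dot (f - g) h = hardy_dot f h - hardy_dot g h.
Proof. by move=> hf hg hh; exact: linear_onB (hardy_dot_linear hh) hf hg. Qed.

Lemma hardy_dotBr f g h : hardy f -> hardy g -> hardy h ->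
  hardy_dot f (g - h) = hardy_dot f g - hardy_dot f h.
Proof.
move=> hf hg hh; rewrite (hardy_dotC (hardyB hg hh) hf) hardy_dotBl //.
by rewrite (hardy_dotC hg hf) (hardy_dotC hh hf); exact: rmorphB.
Qed.

Lemma hardy_dot0l h : hardy h -> hardy_dot 0 h = 0.
Proof. by move=> hh; exact: linear_on0 hardy_subspace (hardy_dot_linear hh).
  Qed.

Lemma hardy_dotE f : hardy f -> hardy_dot f f = rc (nsq (taylor f)).
Proof. by move=> /hardyP[_ la _]; rewrite hardy_dotT nsqE. Qed.

Lemma hardy_dot_eq0 f : hardy f -> hardy_dot f f = 0 -> f = 0.
Proof.
move=> hf; have [fa la f0] := proj1 (hardyP f) hf.
rewrite hardy_dotE // => /(@rc_inj R) /(nsq_eq0 la) a0.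
apply: (hardy_ext hf hardy0) => z z1.
rewrite (taylorE fa z1); apply: csumE.
rewrite (_ : series _ = fun=> 0); first exact: cvg_cst.
by apply/funext => n; rewrite /series /= big1 // => i _; rewrite a0 mul0r.
Qed.

Lemma hardy_dot_ge0 f : hardy f -> 0 <= hardy_dot f f.
Proof.
move=> hf; have [_ la _] := proj1 (hardyP f) hf.
by rewrite hardy_dotE // -(rc0 R) rc_le nsq_ge0.
Qed.

Lemma hardy_mul theta f : inner theta -> hardy f -> hardy (theta * f).
Proof.
move=> ith /hardyP[fa la f0]; have [[c thc] _ _] := ith.
have h : has_taylor (theta * f) (conv c (taylor f)) by exact: has_taylorM thc
  fa.
apply/hardyP; rewrite (taylor_eq h); split.
- exact: h.
- by have [] := inner_isometry ith thc la.
- by move=> z z1; rewrite !fctE f0 // mulr0.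
Qed.

Lemma hardy_dot_mul theta f g : inner theta -> hardy f -> hardy g ->
  hardy_dot (theta * f) (theta * g) = hardy_dot f g.
Proof.
move=> ith /hardyP[fa la _] /hardyP[gb lb _]; have [[c thc] _ _] := ith.
have hM h : has_taylor h (taylor h) -> taylor (theta * h) = conv c (taylor h).
  by move=> hh; apply: taylor_eq; exact: has_taylorM thc hh.
rewrite (hardy_dotT (_ * _)) (hardy_dotT f) !hM //.
exact: inner_dot ith thc la lb.
Qed.

(** The isometry gives [f - g] the norm of [theta * (f - g)], which is 0; the zeros of [theta] thus
    do no harm. *)
Lemma inner_cancel theta f g : inner theta -> hardy f -> hardy g ->
  (forall z, @disc R z -> theta z * f z = theta z * g z) -> f = g.
Proof.
move=> ith hf hg e; have hB := hardyB hf hg.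
apply/eqP; rewrite -subr_eq0; apply/eqP; apply: hardy_dot_eq0 => //.
rewrite -(hardy_dot_mul ith hB hB) (_ : theta * (f - g) = 0) ?hardy_dot0l //.
  exact: hardy0.
apply: hardy_ext; [exact: hardy_mul|exact: hardy0|].
by move=> z z1; rewrite !fctE mulrBr e // subrr.
Qed.

(** This is the Hilbert space adjoint of multiplication by [theta], selected by its defining
    identity; [inner_adjoint] provides existence for inner [theta]. *)
Definition adjoint theta g : C -> C := xget 0
  [set u | hardy u /\ forall f, hardy f ->
    hardy_dot g (theta * f) = hardy_dot u f].

Lemma adjointP theta g : inner theta -> hardy g ->
  hardy (adjoint theta g) /\
  forall f, hardy f -> hardy_dot g (theta * f) = hardy_dot (adjoint theta g) f.
Proof.
move=> ith /hardyP[gb lb _]; have [[c thc] _ _] := ith.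
rewrite /adjoint; case: xgetP => [u _ //|no].
have [a' [la' ha']] := inner_adjoint ith thc lb.
have ta := subgeometric_taylor (l2_subgeometric la').
case: (no (restr (fun z => csum (fun n => a' n * z ^+ n)))); split.
  exact: hardy_restr ta la'.
move=> f /hardyP[fa la _].
rewrite (hardy_dotT g) (hardy_dotT (restr _)) (taylor_eq (has_taylor_restr ta)).
have -> : taylor (theta * f) = conv c (taylor f).
  by apply: taylor_eq; exact: has_taylorM thc fa.
exact: ha'.
Qed.

Local Opaque adjoint.

Lemma adjoint_hardy theta g : inner theta -> hardy g -> hardy (adjoint theta g).
Proof. by move=> ith /(adjointP ith)[]. Qed.

Lemma adjointE theta f g : inner theta -> hardy f -> hardy g ->
  hardy_dot g (theta * f) = hardy_dot (adjoint theta g) f.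
Proof. by move=> ith hf hg; have [_ h] := adjointP ith hg; rewrite h. Qed.

Lemma hardy_dot_inj f g : hardy f -> hardy g ->
  (forall h, hardy h -> hardy_dot f h = hardy_dot g h) -> f = g.
Proof.
move=> hf hg fg; have hB := hardyB hf hg.
apply/eqP; rewrite -subr_eq0; apply/eqP; apply: hardy_dot_eq0 => //.
by rewrite hardy_dotBl // fg // subrr.
Qed.

Lemma adjoint_uniq theta g u : inner theta -> hardy g -> hardy u ->
  (forall f, hardy f -> hardy_dot g (theta * f) = hardy_dot u f) ->
  adjoint theta g = u.
Proof.
move=> ith hg hu e; apply: hardy_dot_inj; [exact: adjoint_hardy|exact: hu|].
by move=> h hh; rewrite -(adjointE ith hh hg) (e h hh).
Qed.

Lemma adjoint_linear theta : inner theta ->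
    linear_on (@hardy R) (adjoint theta).
Proof.
move=> ith x f g hf hg.
have haf := adjoint_hardy ith hf; have hag := adjoint_hardy ith hg.
apply: (adjoint_uniq ith).
- exact: (proj2 hardy_subspace).
- exact: (proj2 hardy_subspace).
move=> h hh; have ht := hardy_mul ith hh.
rewrite (hardy_dot_lin x hf hg ht) (hardy_dot_lin x haf hag hh).
by rewrite (adjointE ith hh hf) (adjointE ith hh hg).
Qed.

Lemma adjoint_mul theta f : inner theta -> hardy f ->
    adjoint theta (theta * f) = f.
Proof.
move=> ith hf; apply: (adjoint_uniq ith); [exact: hardy_mul|exact: hf|].
by move=> h hh; exact: hardy_dot_mul.
Qed.

(** An isometry composed with its adjoint is the projection onto its range. The two cases check that
    this vector qualifies and that any vector chosen by [xget] equals it. *)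
Lemma inner_projE theta g : inner theta -> hardy g ->
  inner_proj theta g = theta * adjoint theta g.
Proof.
move=> ith hg; have ha := adjoint_hardy ith hg; have hta := hardy_mul ith ha.
have orth h : hardy h -> hardy_dot (g - theta * adjoint theta g) (theta * h) =
  0.
  move=> hh; rewrite (hardy_dotBl hg hta (hardy_mul ith hh)).
  by rewrite (hardy_dot_mul ith ha hh) (adjointE ith hh hg) subrr.
rewrite /inner_proj /orth_proj; case: xgetP => [m _ [[f hf <-] om]|no].
  congr (_ * _); symmetry; apply: (adjoint_uniq ith hg hf) => h hh.
  have htf := hardy_mul ith hf; have hth := hardy_mul ith hh.
  have := om (theta * h) (imageP _ hh).
  by rewrite (hardy_dotBl hg htf hth) (hardy_dot_mul ith hf hh) => /subr0_eq.
case: (no (theta * adjoint theta g)); split; first by exists (adjoint theta g).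
by move=> _ [h hh <-]; exact: orth.
Qed.

(** Such a [u] is [x] times the reproducing kernel at [w]. *)
Lemma hardy_dot_kernel f u w x : hardy f -> @disc R w ->
  (forall n, taylor u n = (w^*) ^+ n * x) -> hardy_dot f u = x^* * f w.
Proof.
move=> /hardyP[fa la _] w1 hu; have sa :=
  subgeometric_summable (l2_subgeometric la) w1.
rewrite (taylorE fa w1) -(csumZ _ sa) hardy_dotT /dot; congr (csum _).
apply/funext => n.
by rewrite hu rmorphM rmorphXn /= conjCK mulrA mulrC.
Qed.

Lemma hardy_inner theta : inner theta -> hardy (restr theta).
Proof.
move=> ith; have [[c thc] _ _] := ith.
have [lc _] := inner_l2 ith thc; exact: hardy_restr thc lc.
Qed.

Lemma inner_div_hardy psi1 psi2 g : inner psi1 -> inner psi2 -> hardy g ->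
  (forall z, @disc R z -> psi1 z = psi2 z * g z) -> inner g.
Proof. by move=> i1 i2 /hardyP[gb lb _] e; exact: inner_div i1 i2 gb lb e. Qed.

(** Division by [z - w] stays square-summable by [l2_div]; multiplying the quotient [k] by the
    denominator of the Blaschke factor gives the cofactor. *)
Lemma hardy_div_blaschke_factor f w : hardy f -> @disc R w -> f w = 0 ->
  exists2 g, hardy g & f = blaschke_factor w * g.
Proof.
move=> hf w1 fw0; have [fa la f0] := proj1 (hardyP f) hf.
have [k [sk bk kS fk]] := taylor_div fa w1 fw0.
have w1' : nrm w < 1 by apply/discE.
have lk : l2 k.
  apply: (l2_div la w1' (bk (Num.sqrt (nsq (taylor f))) _) kS) => n.
  by rewrite nrm_sqn ler_wsqrtr // sqn_le_nsq.
have kt := subgeometric_taylor sk.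
have [lzk _] := inner_isometry (@inner_id R) (@has_taylor_id R) lk.
have gt := has_taylorD kt (has_taylorZ (c :=
  - w^*) (has_taylorM (@has_taylor_id R) kt)).
have hg := hardy_restr gt (l2D lk (l2Z (- w^*) lzk)).
eexists; first exact: hg.
apply: hardy_ext => //; first by apply: hardy_mul => //;
  exact: inner_blaschke_factor.
move=> z z1; rewrite !fctE restrE // fk // /blaschke_factor.
have nz : 1 - w^* * z != 0.
  by apply: one_sub_neq0; apply: nrm_conj_lt1 => //; apply/ltW/discE.
by field.
Qed.

End HardySpace.

Local Opaque hardy hardy_dot taylor adjoint inner_proj.

(** * Projections onto the subspaces [theta H^2] *)

Section Projections.
Variable R : realType.
Notation C := (cplx R).
Implicit Types (f g h u theta psi : C -> C) (x w z : C).

Definition inner_space theta : set (C -> C) := [set theta * f | f in @hardy R].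

Lemma inner_space_hardy theta f : inner theta -> inner_space theta f -> hardy f.
Proof. by move=> ith [g hg <-]; exact: hardy_mul. Qed.

Lemma mul_linear theta (c : C) f g : theta * (c *: f + g) = c *: (theta * f) +
    theta * g.
Proof. by apply/funext => z; rewrite !fctE /GRing.scale /=; ring. Qed.

Lemma mul_sum theta n (c : 'I_n -> C) (e : 'I_n -> C -> C) :
  theta * (\sum_i c i *: e i) = \sum_i c i *: (theta * e i).
Proof.
elim: n c e => [|n IH] c e.
  by rewrite !big_ord0; apply/funext => z; rewrite !fctE mulr0.
by rewrite !big_ord_recl mul_linear IH.
Qed.

Lemma subspace_inner_space theta : is_subspace (inner_space theta).
Proof.
split; first by exists 0; [exact: hardy0|apply/funext => z;
  rewrite !fctE mulr0].
move=> c _ _ [f hf <-] [g hg <-]; exists (c *: f + g); last exact: mul_linear.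
exact: (proj2 (@hardy_subspace R)).
Qed.

Lemma hardy_inner_proj theta f : inner theta -> hardy f ->
    hardy (inner_proj theta f).
Proof.
move=> ith hf; rewrite inner_projE //; apply: hardy_mul => //.
exact: adjoint_hardy.
Qed.

Lemma inner_proj_space theta f : inner theta -> hardy f ->
  inner_space theta (inner_proj theta f).
Proof.
move=> ith hf; rewrite inner_projE //; exists (adjoint theta f) => //.
exact: adjoint_hardy.
Qed.

Lemma inner_proj_id theta f : inner theta -> inner_space theta f ->
  inner_proj theta f = f.
Proof.
move=> ith [g hg <-]; rewrite inner_projE //; last exact: hardy_mul.
by rewrite adjoint_mul.
Qed.

Lemma inner_proj_linear theta : inner theta ->
  linear_on (@hardy R) (inner_proj theta).
Proof.
move=> ith c f g hf hg; rewrite !inner_projE //;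
  last exact: (proj2 (@hardy_subspace R)).
by rewrite (adjoint_linear ith c hf hg) mul_linear.
Qed.

Lemma inner_proj_orth theta f g : inner theta -> hardy f ->
    inner_space theta g ->
  hardy_dot (f - inner_proj theta f) g = 0.
Proof.
move=> ith hf [h hh <-]; have ha := adjoint_hardy ith hf.
rewrite inner_projE // (hardy_dotBl hf (hardy_mul ith ha) (hardy_mul ith hh)).
by rewrite (hardy_dot_mul ith ha hh) (adjointE ith hh hf) subrr.
Qed.

Lemma image_inner_proj theta : inner theta ->
  [set inner_proj theta f | f in @hardy R] = inner_space theta.
Proof.
move=> ith; apply/seteqP; split=> [_ [f hf <-]|f fM].
  exact: inner_proj_space.
by exists f; [exact: inner_space_hardy fM|exact: inner_proj_id].
Qed.

Lemma hardy_dot_span n (c : 'I_n -> C) (e : 'I_n -> C -> C) f :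
  (forall i, hardy (e i)) -> hardy f -> (forall i, hardy_dot f (e i) = 0) ->
  hardy_dot (\sum_i c i *: e i) f = 0.
Proof.
move=> he hf f0.
rewrite (linear_on_sum _ (@hardy_subspace R) (hardy_dot_linear hf)) // big1 //
  => i _.
by rewrite (hardy_dotC hf (he i)) f0 rmorph0 /GRing.scale /= mulr0.
Qed.

Lemma hardy_dot_sym0 f g : hardy f -> hardy g -> hardy_dot f g = 0 ->
    hardy_dot g f = 0.
Proof. by move=> hf hg fg; rewrite (hardy_dotC hf hg) fg rmorph0. Qed.

Lemma inner_proj_le theta f : inner theta -> hardy f ->
  hardy_dot (inner_proj theta f) (inner_proj theta f) <= hardy_dot f f.
Proof.
move=> ith hf; set p := inner_proj theta f.
have hp : hardy p by exact: hardy_inner_proj.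
have hd := hardyB hf hp.
have o : hardy_dot (f - p) p = 0 by apply: inner_proj_orth => //;
  exact: inner_proj_space.
have := hardy_dot_sym0 hd hp o; rewrite (hardy_dotBr hp hf hp) => /subr0_eq <-.
have := hardy_dot_ge0 hd; rewrite (hardy_dotBr hd hf hp) o subr0 (hardy_dotBl hf
  hp hf).
by rewrite subr_ge0.
Qed.

End Projections.

(** * The subspace of multipliers into [psi H^2] and the functionals that vanish on it *)

Section CommonZero.
Variable R : realType.
Notation C := (cplx R).
Variables psi1 psi2 : C -> C.
Hypotheses (i1 : inner psi1) (i2 : inner psi2).
Implicit Types (f g h u : C -> C).

(** This is the analogue of a colon ideal; for the quotients of the two inner functions by their gcd
    it is the invariant subspace [N]. *)
Definition inner_colon (theta psi : C -> C) : set (C -> C) :=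
  [set f | hardy f /\ inner_space psi (theta * f)].

Notation N := (inner_colon psi1 psi2).

Lemma subspace_inner_colon : is_subspace N.
Proof.
have [h0 hL] := @hardy_subspace R; have [s0 sL] := subspace_inner_space psi2.
split.
  by split => //; rewrite (_ : psi1 * 0 = 0) //; apply/funext => z;
    rewrite !fctE mulr0.
move=> c f g [hf Nf] [hg Ng]; split; first exact: hL.
by rewrite mul_linear; exact: sL.
Qed.

(** The component of [psi1 * f] orthogonal to [psi2 H^2]. Its kernel is [N], so it embeds the
    quotient by [N] in the Hardy space, where inner products are available. *)
Definition defect f : C -> C := psi1 * f - inner_proj psi2 (psi1 * f).

Lemma hardy_defect f : hardy f -> hardy (defect f).
Proof.
by move=> hf; apply: hardyB; [|apply: hardy_inner_proj => //]; exact: hardy_mul.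
Qed.

Lemma defect_linear : linear_on (@hardy R) defect.
Proof.
move=> c f g hf hg; rewrite /defect mul_linear.
rewrite (inner_proj_linear i2 c (hardy_mul i1 hf) (hardy_mul i1 hg)).
by rewrite opprD addrACA -scalerBr.
Qed.

Lemma defect_eq0 f : hardy f -> (N f <-> defect f = 0).
Proof.
move=> hf; split => [[_ /(inner_proj_id i2) e]|/subr0_eq e].
  by rewrite /defect e subrr.
split => //; rewrite e; apply: inner_proj_space => //; exact: hardy_mul.
Qed.

Lemma defect_dot f g : hardy f -> hardy g ->
  hardy_dot (psi1 * f) (defect g) = hardy_dot (defect f) (defect g).
Proof.
move=> hf hg; have hp := hardy_inner_proj i2 (hardy_mul i1 hf).
rewrite [in RHS]/defect (hardy_dotBl (hardy_mul i1 hf) hp (hardy_defect hg)).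
rewrite [X in _ - X](hardy_dot_sym0 (hardy_defect hg) hp) ?subr0 //.
apply: inner_proj_orth => //; first exact: hardy_mul.
by apply: inner_proj_space => //; exact: hardy_mul.
Qed.

(* The representing element is [psi1^* (\sum_j x_j^* (defect e_j))], where [x] is
   found by inverting the Gram matrix of the [defect e_j]. *)
Lemma represent_functional n (e : 'I_n -> C -> C) (l : (C -> C) -> C^o) :
  quotient_basis (@hardy R) N e -> linear_on (@hardy R) l ->
  (forall f, N f -> l f = 0) ->
  exists2 u, hardy u & forall f, hardy f -> l f = hardy_dot f u.
Proof.
move=> eb lL lN; have [he gen ind] := eb.
have hde i : hardy (defect (e i)) by exact: hardy_defect.
pose G := \matrix_(i < n, j < n) hardy_dot (defect (e i)) (defect (e j)).
(* A row killed by [G] gives a combination whose defect is orthogonal to every [defect (e j)], hence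
   to itself; so it lies in [N] and is trivial. *)
have Gu : G \in unitmx.
  rewrite -row_free_unit; apply/inj_row_free => y yG; apply/rowP => i;
    rewrite mxE.
  apply: (ind (fun i => y 0 i)); apply/defect_eq0.
    exact: subspace_sum (@hardy_subspace R) he.
  rewrite (linear_on_sum _ (@hardy_subspace R) defect_linear he).
  have hs := subspace_sum (fun i => y 0 i) (@hardy_subspace R) hde.
  apply: hardy_dot_eq0 => //; apply: hardy_dot_span => // j.
  have := congr1 (fun A : 'rV_n => A 0 j) yG; rewrite !mxE => <-.
  rewrite (linear_on_sum _ (@hardy_subspace R) (hardy_dot_linear (hde j))) //.
  by apply: eq_bigr => k _; rewrite mxE.
pose v := \col_i (l (e i) : C); pose x := invmx G *m v.
pose w := \sum_j (x j 0)^* *: defect (e j).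
have hw : hardy w by exact: subspace_sum (@hardy_subspace R) hde.
have lw f : hardy f -> l f = (hardy_dot w (psi1 * f))^*.
  have wE g : hardy g -> (hardy_dot w (psi1 * g))^* =
      \sum_j hardy_dot (defect g) (defect (e j)) * x j 0.
    move=> hg; have hpg := hardy_mul i1 hg.
    rewrite (linear_on_sum _ (@hardy_subspace R) (hardy_dot_linear hpg)) //.
    rewrite rmorph_sum; apply: eq_bigr => j _.
    rewrite rmorphM /= conjCK mulrC -(hardy_dotC (hde j) hpg) defect_dot //.
  move=> hf; have [c Nc] := gen _ hf.
  have hs := subspace_sum c (@hardy_subspace R) he.
  have -> : l f = l (\sum_i c i *: e i).
    by apply/subr0_eq; rewrite -(linear_onB lL) // lN.
  rewrite wE //.
  have -> : defect f = \sum_i c i *: defect (e i).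
    apply/subr0_eq; rewrite -(linear_on_sum _ (@hardy_subspace R) defect_linear
      he).
    by rewrite -(linear_onB defect_linear) //; apply/defect_eq0 => //;
      exact: hardyB.
  rewrite (linear_on_sum _ (@hardy_subspace R) lL he).
  have vE i : l (e i) = \sum_j G i j * x j 0.
    have := congr1 (fun A : 'cV_n => A i 0) (mulKVmx Gu v).
    by rewrite !mxE.
  under [RHS]eq_bigr => j _ do
    rewrite (linear_on_sum _ (@hardy_subspace R) (hardy_dot_linear (hde j))) //
      mulr_suml.
  rewrite exchange_big; apply: eq_bigr => i _ /=.
  rewrite vE /GRing.scale /= mulr_sumr; apply: eq_bigr => j _.
  by rewrite mxE mulrA.
exists (adjoint psi1 w); first exact: adjoint_hardy.
move=> f hf; rewrite lw // (adjointE i1 hf hw).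
by rewrite -(hardy_dotC (adjoint_hardy i1 hw) hf).
Qed.

End CommonZero.

(** * Invariant subspaces of finite codimension *)

Section BlaschkeExtraction.
Variable R : realType.
Notation C := (cplx R).
Implicit Types (f g h u psi theta : C -> C) (z w : C).

Definition hardy1 : C -> C := restr (fun=> 1).

Lemma hardy_hardy1 : hardy hardy1.
Proof. by apply: hardy_inner; apply: inner_const; rewrite normr1. Qed.

Lemma inner_exp n : inner (fun z : C => z ^+ n).
Proof.
elim: n => [|n IH]; first by apply: inner_const; rewrite normr1.
apply: (eq_inner _ (innerM (@inner_id R) IH)) => z _; by rewrite exprS.
Qed.

Lemma has_taylor_exp n : has_taylor (fun z : C => z ^+ n) (unit_seq R n).
Proof.
rewrite (_ : unit_seq R n = trunc n.+1 (unit_seq R n)).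
  apply: (eq_has_taylor _ (@has_taylor_poly R n.+1 (unit_seq R n))) => z _.
  rewrite big_ord_recr /= big1 ?add0r /unit_seq ?eqxx ?mul1r // => i _.
  by rewrite ltn_eqF // mul0r.
apply/funext => k; rewrite /trunc /unit_seq ltnS.
by case: eqVneq => [->|_]; rewrite ?leqnn // if_same.
Qed.

Lemma hardy_dot_exp n u : hardy u ->
  hardy_dot ((fun z => z ^+ n) * hardy1) u = (taylor u n)^*.
Proof.
move=> hu; rewrite hardy_dotT.
have -> : taylor ((fun z => z ^+ n) * hardy1) = unit_seq R n.
  apply: taylor_eq; apply: (eq_has_taylor _ (has_taylor_exp (n := n))) => z z1.
  by rewrite !fctE /hardy1 restrE // mulr1.
have h k : (n.+1 <= k)%N -> unit_seq R n k * (taylor u k)^* = 0.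
  by move=> nk; rewrite /unit_seq gtn_eqF // mul0r.
rewrite /dot (csumE (series_eventually0 h)) big_ord_recr big1 /=.
  by rewrite add0r /unit_seq eqxx mul1r.
by move=> i _; rewrite /unit_seq ltn_eqF // mul0r.
Qed.

(* An eigenvector of the transpose of multiplication by [z] on [hardy / N] is a
   functional [l] with [l (z f) = alpha * l f]; the element representing it is a
   multiple of the reproducing kernel at [alpha]. *)
Lemma inner_colon_common_zero psi1 psi2 n (e : 'I_n.+1 -> C -> C) :
  inner psi1 -> inner psi2 -> quotient_basis (@hardy R) (inner_colon psi1 psi2)
    e ->
  exists2 w, @disc R w & forall f, inner_colon psi1 psi2 f -> f w = 0.
Proof.
move=> i1 i2 eb; set N := inner_colon psi1 psi2 in eb *.
have [he _ _] := eb.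
have sH := @hardy_subspace R.
have sN : is_subspace N by exact: subspace_inner_colon.
have hz f : hardy f -> hardy (id * f) by exact: hardy_mul (@inner_id R).
have Nz f : N f -> N (id * f).
  move=> [hf [g hg e']]; split; first exact: hz.
  exists (id * g); first exact: hz.
  by rewrite [RHS]mulrCA -e' mulrCA.
have [q [qL qN qe qg]] := quotient_basis_coords sH sN eb.
pose M := \matrix_(i < n.+1) q (id * e i).
have qM f : hardy f -> q (id * f) = q f *m M.
  move=> hf; set s := \sum_i q f 0 i *: e i.
  have hs : hardy s by exact: subspace_sum.
  have : q (id * (f - s)) = 0.
    by apply/qN; [apply: hz; exact: hardyB|apply: Nz; exact: qg].
  rewrite mulrBr (linear_onB qL) //; try exact: hz.
  move=> /subr0_eq ->; rewrite /s mul_sum (linear_on_sum _ sH qL) => [|i];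
    last exact: hz.
  by rewrite mulmx_sum_row; apply: eq_bigr => i _; rewrite rowK.
(* The matrix has positive size [n.+1], so an eigenvalue exists. The transpose is used because a
   functional on the quotient is wanted, not a vector of it. *)
have [alpha /eigenvalueP[y yM y0]] := spectral.eigenvalue_closed M^T (ltn0Sn n).
pose v := y^T.
have Mv : M *m v = alpha *: v.
  by rewrite /v -[M]trmxK -trmx_mul yM linearZ.
pose l f : C^o := (q f *m v) 0 0.
have lL : linear_on (@hardy R) l.
  move=> c f g hf hg; rewrite /l (qL c f g hf hg) mulmxDl -scalemxAl !mxE.
  by [].
have lN f : N f -> l f = 0.
  by move=> Nf; rewrite /l (proj1 (qN f (proj1 Nf)) Nf) mul0mx mxE.
have lz f : hardy f -> l (id * f) = alpha * l f.
  by move=> hf; rewrite /l qM // -mulmxA Mv -scalemxAr mxE.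
have [u hu lu] := represent_functional i1 i2 eb lL lN.
have un k : (taylor u k)^* = alpha ^+ k * (taylor u 0)^*.
  rewrite -!(hardy_dot_exp _ hu).
  have hk j : hardy ((fun z => z ^+ j) * hardy1).
    by apply: hardy_mul; [exact: inner_exp|exact: hardy_hardy1].
  rewrite -!lu //; elim: k => [|k IH]; first by rewrite expr0 mul1r.
  rewrite exprS -mulrA -IH -(lz _ (hk k)); congr (l _).
  by apply/funext => z; rewrite !fctE exprS mulrA.
(* If the constant coefficient vanished, [un] would kill all of [u], hence the values of [l] on the
   basis, which are the entries of [v]. *)
have u0 : taylor u 0 != 0.
  apply: contra_neq y0 => u0.
  have -> : y = v^T by rewrite /v trmxK.
  suff -> : v = 0 by rewrite trmx0.
  apply/colP => i; rewrite [RHS]mxE.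
  have <- : l (e i) = v i 0 by rewrite /l qe -rowE mxE.
  rewrite lu // (hardy_dotC hu (he i)).
  rewrite [X in hardy_dot X _](_ : u = 0);
    first by rewrite (hardy_dot0l (he i)) rmorph0.
  have [ut _ _] := proj1 (hardyP u) hu.
  apply: (hardy_ext hu (@hardy0 R)) => z z1; rewrite (taylorE ut z1).
  apply: csumE; rewrite (_ : series _ = fun=> 0); first exact: cvg_cst.
  apply/funext => k; rewrite /series /= big1 // => j _.
  by rewrite -[taylor u j]conjCK un u0 rmorph0 mulr0 rmorph0 mul0r.
(* Otherwise no coefficient of [u] has smaller modulus than the first one, which is nonzero, and
   they could not tend to 0. *)
have a1 : nrm alpha < 1.
  rewrite ltNge; apply/negP => a1.
  have [_ lt _] := proj1 (hardyP u) hu.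
  have [cv _ _] := nsq_series lt.
  have := cvg_series_cvg_0 cv => t0.
  have : sqn (taylor u 0) <= 0.
    apply: (cvgr_to_ge t0); apply: nearW => k /=.
    rewrite -[leRHS]mul1r /sqn -(nrmJ (taylor u k)) un nrmM nrmJ exprMn.
    rewrite mul1r ler_peMl ?sqr_ge0 // nrmX -exprM exprn_ege1 //.
  by rewrite leNgt lt_def sqn_ge0 /sqn sqrf_eq0 nrm_eq0 u0.
have ad : @disc R alpha by apply/discE.
exists alpha => // f Nf; have hf := proj1 Nf.
have := lN _ Nf; rewrite lu // (@hardy_dot_kernel _ f u alpha (taylor u 0)) //.
  by move/eqP; rewrite mulf_eq0 conjC_eq0 (negbTE u0) => /eqP.
by move=> k; rewrite -[taylor u k]conjCK un rmorphM /= conjCK rmorphXn.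
Qed.

Lemma finite_blaschke_const (x : C) : `|x| = 1 -> finite_blaschke (fun=> x).
Proof.
move=> x1; exists 0%N, x, (fun=> 0); split => [//|[]//|z _].
by rewrite big_ord0 mulr1.
Qed.

Lemma blaschke_productM n f w : @disc R w -> blaschke_product n f ->
  blaschke_product n.+1 (fun z => blaschke_factor w z * f z).
Proof.
move=> w1 [x [a [x1 a1 fE]]].
exists x, (fun i => oapp a w (unlift ord0 i)); split => //.
  by move=> i; case: unliftP => [j|] _ /=.
move=> z z1; rewrite fE // big_ord_recl unlift_none /= mulrCA;
  congr (_ * (_ * _)).
by apply: eq_bigr => i _; rewrite liftK.
Qed.

Lemma blaschke_productS n f : blaschke_product n.+1 f ->
  exists w g, [/\ @disc R w, blaschke_product n g &
    forall z, @disc R z -> f z = blaschke_factor w z * g z].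
Proof.
move=> [x [a [x1 a1 fE]]].
exists (a ord0), (fun z => x * \prod_i ((z - a (lift ord0 i)) / (1 - (a (lift
  ord0 i))^* * z))).
split => //.
  by exists x, (fun i => a (lift ord0 i)); split.
by move=> z z1; rewrite fE // big_ord_recl mulrCA.
Qed.

Lemma inner_blaschke n f : blaschke_product n f -> inner f.
Proof.
elim: n f => [|n IH] f.
  move=> [x [a [x1 _ fE]]]; apply: (eq_inner _ (inner_const x1)) => z z1.
  by rewrite fE // big_ord0 mulr1.
move=> /blaschke_productS[w [g [w1 /IH ig fE]]].
apply: (eq_inner _ (innerM (inner_blaschke_factor w1) ig)) => z z1.
by rewrite fE.
Qed.

(** If the constant 1 lies in the colon space, [psi1] is [psi2] times an element of [H^2], which is
    then inner; so the Blaschke part can be taken to be 1. *)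
Lemma inner_colon_hardy1 psi1 psi2 : inner psi1 -> inner psi2 ->
  inner_colon psi1 psi2 hardy1 ->
  exists B psi, [/\ finite_blaschke B, inner psi,
    forall z, @disc R z -> psi2 z = B z * psi z & inner_dvd psi psi1].
Proof.
move=> i1 i2 [_ [g hg e1]].
have e2 z : @disc R z -> psi1 z = psi2 z * g z.
  move=> z1; have := congr1 (fun f => f z) e1.
  by rewrite !fctE /hardy1 restrE // mulr1 => <-.
exists (fun=> 1), psi2; split.
- by apply: finite_blaschke_const; rewrite normr1.
- exact: i2.
- by move=> z _; rewrite mul1r.
- by exists g => //; exact: inner_div_hardy i1 i2 hg e2.
Qed.

(** The constant 1 outside the colon space rules out the empty basis, so the size can be written
    [m.+1], as the eigenvalue argument requires. *)
Lemma inner_colon_proper n psi1 psi2 :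
  (forall m (e : 'I_m -> C -> C), (forall i, hardy (e i)) ->
    indep_mod (inner_colon psi1 psi2) e -> (m <= n)%N) ->
  ~ inner_colon psi1 psi2 hardy1 ->
  exists m (e : 'I_m.+1 -> C -> C),
    quotient_basis (@hardy R) (inner_colon psi1 psi2) e /\ (m.+1 <= n)%N.
Proof.
move=> bnd N1; have sN := subspace_inner_colon psi1 psi2.
have [[|m] [e eb]] := findim_mod_bound (@hardy_subspace R) sN bnd.
  by have [_ gen _] := eb; have [c] := gen _ hardy_hardy1;
    rewrite big_ord0 subr0.
by exists m, e; split => //; have [he _ ie] := eb; exact: bnd ie.
Qed.

(** The induction is on the bound, with [psi1] fixed and [psi2] losing one Blaschke factor at a
    time, until the constant 1 enters the colon space. *)
Lemma inner_colon_blaschke n psi1 psi2 : inner psi1 -> inner psi2 ->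
  (forall m (e : 'I_m -> C -> C), (forall i, hardy (e i)) ->
    indep_mod (inner_colon psi1 psi2) e -> (m <= n)%N) ->
  exists B psi, [/\ finite_blaschke B, inner psi,
    forall z, @disc R z -> psi2 z = B z * psi z & inner_dvd psi psi1].
Proof.
elim: n psi2 => [|n IH] psi2 i1 i2 bnd.
  have [N1|N1] := pselect (inner_colon psi1 psi2 hardy1).
    exact: inner_colon_hardy1.
  by have [m [e [_]]] := inner_colon_proper bnd N1; rewrite ltn0.
have [N1|N1] := pselect (inner_colon psi1 psi2 hardy1).
  exact: inner_colon_hardy1.
have [m [e [eb _]]] := inner_colon_proper bnd N1.
have [w w1 Nw] := inner_colon_common_zero i1 i2 eb.
(* By commutativity [psi2] belongs to its own colon space, so the common zero [w] is a zero of
   [psi2]. *)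
have N2 : inner_colon psi1 psi2 (restr psi2).
  split; first exact: hardy_inner.
  exists (restr psi1); first exact: hardy_inner.
  apply: hardy_ext; try by apply: hardy_mul => //; exact: hardy_inner.
  by move=> z z1; rewrite !fctE !restrE // mulrC.
have hr2 := hardy_inner i2.
have [g hg e2] := hardy_div_blaschke_factor hr2 w1 (Nw _ N2).
have ib := inner_blaschke_factor w1.
have e3 z : @disc R z -> psi2 z = blaschke_factor w z * g z.
  by move=> z1; rewrite -(restrE psi2 z1) e2.
have ig : inner g := inner_div_hardy i2 ib hg e3.
have [k f hf indf|B [psi [[d dB] ip gE dv]]] := IH g i1 ig.
  (* A family independent for the smaller function [g] is multiplied by the Blaschke factor and
     extended by the constant 1. The new family is independent for [psi2] and one longer, which is
     the drop by one in the bound. *)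
  rewrite -ltnS; pose f' (i : 'I_k.+1) := oapp (fun j =>
    blaschke_factor w * f j) hardy1 (unlift ord0 i).
  apply: (bnd _ f').
    move=> i; rewrite /f'; case: unliftP => [j|] _ /=; last exact: hardy_hardy1.
    exact: hardy_mul.
  move=> c; rewrite big_ord_recl /f' unlift_none /=.
  under eq_bigr do rewrite liftK /=.
  rewrite -mul_sum; set s := \sum_i _ => Ns.
  have hs : hardy s by exact: subspace_sum (@hardy_subspace R) hf.
  have bw : blaschke_factor w w = 0 by rewrite /blaschke_factor subrr mul0r.
  (* At [w] the Blaschke factor vanishes, and so does every element of the colon space; only the
     coefficient of the constant survives. *)
  have c0 : c ord0 = 0.
    have := Nw _ Ns; rewrite !fctE bw mul0r addr0 /hardy1 restrE //.
    by rewrite /GRing.scale /= mulr1.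
  move: Ns; rewrite c0 scale0r add0r => -[_ [h hh e4]].
  have Ns : inner_colon psi1 g s.
    split => //; exists h => //; apply/esym.
    apply: (inner_cancel ib); [exact: hardy_mul|exact: hardy_mul|].
    move=> z z1; have := congr1 (fun f => f z) e4; rewrite !fctE e3 // => e5.
    by rewrite mulrCA -e5 mulrA.
  move=> i; case: (unliftP ord0 i) => [j|] -> //.
  exact: (indf (fun j => c (lift ord0 j))).
exists (fun z => blaschke_factor w z * B z), psi; split => //.
  by exists d.+1; exact: blaschke_productM.
by move=> z z1; rewrite e3 // gE // mulrA.
Qed.

End BlaschkeExtraction.

(** * Fredholm pairs *)

Section FredholmPair.
Variable R : realType.
Notation C := (cplx R).
Implicit Types (f g h u psi theta phi : C -> C) (z w : C).

Lemma eq_inner_space f g : (forall z, @disc R z -> f z = g z) ->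
  inner_space f = inner_space g.
Proof.
move=> fg; have sub p q : (forall z, @disc R z -> p z = q z) ->
  inner_space p `<=` inner_space q.
  move=> pq _ [h hh <-]; exists h => //; apply/funext => z; rewrite !fctE.
  have [z1|z1] := pselect (@disc R z); first by rewrite pq.
  by have [_ _ h0] := proj1 (hardyP h) hh; rewrite h0 // !mulr0.
by apply/seteqP; split; apply: sub => // z z1; rewrite fg.
Qed.

(** Removing one factor at [w] leaves [g], and [g H^2] exceeds [f H^2] by one dimension, spanned by
    [g] itself: any [y] is [y w] plus a multiple of the Blaschke factor. *)
Lemma blaschke_codim n f : blaschke_product n f ->
  exists e : 'I_n -> C -> C, quotient_basis (@hardy R) (inner_space f) e.
Proof.
have sH := @hardy_subspace R.
elim: n f => [|n IH] f bf.
  have [x [a [x1 _ fE]]] := bf; exists (fun=> 0); split; first by case.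
    move=> y hy; exists (fun=> 0); rewrite big_ord0 subr0.
    have x0 : x != 0 by rewrite -normr_eq0 x1 oner_eq0.
    rewrite (eq_inner_space (g := fun=> x)); last first.
      by move=> z z1; rewrite fE // big_ord0 mulr1.
    exists (x^-1 *: y).
      by have [h0 hL] := sH; rewrite -[_ *: _]addr0; exact: hL.
    by apply/funext => z; rewrite !fctE /GRing.scale /= mulrA divff // mul1r.
  by move=> c _ [].
have [w [g [w1 /[dup] bg /IH[e eb] fE]]] := blaschke_productS bf.
have ig := inner_blaschke bg; have ib := inner_blaschke_factor w1.
have [he gen ind] := eb.
have sg := subspace_inner_space g.
rewrite (eq_inner_space fE).
have bw : blaschke_factor w w = 0 by rewrite /blaschke_factor subrr mul0r.
pose e' (i : 'I_n.+1) := oapp e (g * @hardy1 R) (unlift ord0 i).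
have e'0 : e' ord0 = g * @hardy1 R by rewrite /e' unlift_none.
have e'S i : e' (lift ord0 i) = e i by rewrite /e' liftK.
exists e'; split.
- move=> i; case: (unliftP ord0 i) => [j|] ->; first by rewrite e'S.
  by rewrite e'0; apply: hardy_mul => //; exact: hardy_hardy1.
- move=> x hx; have [c [y hy ey]] := gen _ hx.
  have hy' : hardy (y - y w *: @hardy1 R).
    by apply: hardyB => //; apply: subspaceZ => //; exact: hardy_hardy1.
  have [|y' hy'' e''] := hardy_div_blaschke_factor hy' w1.
    by rewrite !fctE /hardy1 restrE // /GRing.scale /= mulr1 subrr.
  exists (fun i => oapp c (y w) (unlift ord0 i)); exists y' => //.
  rewrite big_ord_recl unlift_none /= e'0.
  under eq_bigr do rewrite liftK /= e'S.
  rewrite opprD addrA addrAC -ey.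
  transitivity (g * (blaschke_factor w * y')).
    by apply/funext => z; rewrite !fctE; ring.
  by rewrite -e''; apply/funext => z; rewrite !fctE /GRing.scale /=; ring.
move=> c; rewrite big_ord_recl e'0; under eq_bigr do rewrite e'S.
move=> [y hy ey].
have cl j : c (lift ord0 j) = 0.
  apply: (ind (fun j => c (lift ord0 j))).
  have -> : \sum_i c (lift ord0 i) *: e i =
      g * (blaschke_factor w * y) - g * (c ord0 *: @hardy1 R).
    apply/eqP; rewrite eq_sym subr_eq; apply/eqP.
    rewrite (_ : g * (blaschke_factor w * y) = (fun z =>
      blaschke_factor w z * g z) * y).
      rewrite ey addrC; congr (_ + _); apply/funext => z.
      by rewrite !fctE /GRing.scale /=; ring.
    by apply/funext => z; rewrite !fctE; ring.
  have h1 := hardy_mul ib hy.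
  by apply: subspaceB => //; [exists (blaschke_factor w * y)|
    exists (c ord0 *: @hardy1 R) => //; apply: subspaceZ => //;
      exact: hardy_hardy1].
move=> i; case: (unliftP ord0 i) => [j|] -> //.
move: ey; rewrite big1 ?addr0 => [ey|j _]; last by rewrite cl scale0r.
have : blaschke_factor w * y = c ord0 *: @hardy1 R.
  apply: (inner_cancel ig); [exact: hardy_mul|by apply: subspaceZ => //;
    exact: hardy_hardy1|].
  move=> z z1; have := congr1 (fun f => f z) ey;
    rewrite !fctE /GRing.scale /= => e3.
  by rewrite mulrCA mulrA e3; ring.
move/(congr1 (fun f => f w)); rewrite !fctE bw mul0r /hardy1 restrE //.
by rewrite /GRing.scale /= mulr1.
Qed.

(** The number of factors is the codimension of [f H^2], hence the same in every factorization. *)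
Lemma blaschke_degreeE n f : blaschke_product n f -> blaschke_degree f = n.
Proof.
move=> bf; rewrite /blaschke_degree; case: xgetP => [m _ bm|/(_ n)//].
have sH := @hardy_subspace R; have sf := subspace_inner_space f.
have [e /(dim_modE sH sf) <-] := blaschke_codim bf.
by have [e' /(dim_modE sH sf)] := blaschke_codim bm.
Qed.

(** This turns the vanishing of a vector in a finite-dimensional span into finitely many linear
    conditions. *)
Lemma hardy_span_eq0 n (t : 'I_n -> C -> C) f :
  (forall i, hardy (t i)) -> hardy f -> (exists c : 'I_n ->
    C, f = \sum_i c i *: t i) ->
  (forall i, hardy_dot f (t i) = 0) -> f = 0.
Proof.
move=> ht hf [c fE] f0; apply: hardy_dot_eq0 => //.
by rewrite {1}fE; exact: hardy_dot_span.
Qed.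

Definition dots n (t : 'I_n -> C -> C) f : 'rV[C]_n := \row_i hardy_dot f (t i).

Lemma dotsE n (t : 'I_n -> C -> C) f i : dots t f 0 i = hardy_dot f (t i).
Proof. by rewrite mxE. Qed.

Lemma dots_linear n (t : 'I_n -> C -> C) (F : (C -> C) -> C -> C) :
  (forall i, hardy (t i)) -> (forall f, hardy f -> hardy (F f)) ->
  linear_on (@hardy R) F -> linear_on (@hardy R) (fun f => dots t (F f)).
Proof.
move=> ht hF FL c f g hf hg; apply/rowP => i /=.
move: (FL c f g hf hg) (hF _ hf) (hF _ hg).
move: (F (c *: f + g)) (F f) (F g) => x y z -> hy hz.
have lin (u v : 'rV[C]_n) : (c *: u + v) 0 i = c * u 0 i + v 0 i.
  by rewrite mxE mxE.
rewrite [RHS](lin (dots t y) (dots t z)) [LHS]mxE (hardy_dot_lin c hy hz (ht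
  i)).
by congr (c * _ + _); rewrite mxE.
Qed.

(** * Codimension bounds from a finite-rank commutator and a Fredholm pair *)

Section Commutator.
Variables phi1 phi2 : C -> C.
Hypotheses (i1 : inner phi1) (i2 : inner phi2).

Notation P1 := (inner_proj phi1).
Notation P2 := (inner_proj phi2).
Notation T := (commutator P1 P2).

Lemma hardy_commutator f : hardy f -> hardy (T f).
Proof.
move=> hf; have h1 := hardy_inner_proj i1 hf; have h2 := hardy_inner_proj i2 hf.
by apply: hardyB; exact: hardy_inner_proj.
Qed.

Lemma commutator_linear : linear_on (@hardy R) T.
Proof.
move=> c f g hf hg; rewrite /commutator.
rewrite (inner_proj_linear i1 c hf hg) (inner_proj_linear i2 c hf hg).
rewrite (inner_proj_linear i1 c (hardy_inner_proj i2 hf) (hardy_inner_proj i2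
  hg)).
rewrite (inner_proj_linear i2 c (hardy_inner_proj i1 hf) (hardy_inner_proj i1
  hg)).
by rewrite opprD addrACA -scalerBr.
Qed.

Lemma inner_proj_defect_linear theta psi : inner theta -> inner psi ->
  linear_on (@hardy R) (fun f => theta * f - inner_proj psi (theta * f)).
Proof. by move=> it ip; exact: defect_linear. Qed.

Lemma commutator_span : finite_rank T ->
  exists n (t : 'I_n -> C -> C), (forall i, hardy (t i)) /\
    forall f, hardy f -> exists c : 'I_n -> C, T f = \sum_i c i *: t i.
Proof.
move=> [n [t [tT gen _]]]; exists n, t; split.
  by move=> i; have [f hf <-] := tT i; exact: hardy_commutator.
move=> f hf; have [c /subr0_eq ->] := gen _ (imageP T hf).
by exists c.
Qed.

Lemma bounded_indep k m (ls : (C -> C) -> 'rV[C]_k) (lr : (C -> C) ->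
    'rV[C]_m) (N : set (C -> C)) :
  linear_on (@hardy R) ls -> linear_on (@hardy R) lr ->
  (forall f, hardy f -> ls f = 0 -> lr f = 0 -> N f) ->
  forall p (e : 'I_p -> C -> C), (forall i, hardy (e i)) -> indep_mod N e ->
    (p <= k + m)%N.
Proof.
move=> lsL lrL lN p e he ie.
apply: (indep_mod_leq (l := fun f =>
  row_mx (ls f) (lr f)) (@hardy_subspace R) _ _ he ie).
  by move=> c f g hf hg; rewrite lsL // lrL // scale_row_mx add_row_mx.
by move=> f hf; rewrite -row_mx0 => /eq_row_mx[]; exact: lN.
Qed.

(** For [x] in [M_1], the [k] conditions make the commutator vanish, so [P2 x] is fixed by [P1] and
    lies in [M_1]. Then [x - P2 x] is in the kernel of the pair, and the other [p] conditions make
    it 0, so that [x] lies in [M_2]. *)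
Lemma fredholm_bound1 : finite_rank T -> fredholm_pair P1 P2 ->
  exists n, forall m (e : 'I_m -> C -> C), (forall i, hardy (e i)) ->
    indep_mod (inner_colon phi1 phi2) e -> (m <= n)%N.
Proof.
move=> /commutator_span[k [t [ht tspan]]] [_ _ _ [p [y [yK ygen _]]] _].
have hy i : hardy (y i).
  by have [[f hf <-] _] := yK i; exact: hardy_inner_proj.
have yM i : P2 (y i) = 0.
  have [[f hf e1] /= e2] := yK i; rewrite -e1 in e2 *.
  by rewrite (inner_proj_id i1 (inner_proj_space i1 hf)) in e2.
exists (k + p)%N; apply: (bounded_indep (ls := fun f => dots t (T (phi1 * f)))
    (lr := fun f => dots y (phi1 * f - P2 (phi1 * f)))).
- apply: (dots_linear (F := fun f => T (phi1 * f))) => //.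
    by move=> f hf; apply: hardy_commutator; exact: hardy_mul.
  move=> c f g hf hg; rewrite mul_linear commutator_linear //; exact: hardy_mul.
- apply: (dots_linear (F := fun f => phi1 * f - P2 (phi1 * f))) => //.
    by move=> f hf; apply: hardyB; [|apply: hardy_inner_proj => //];
      exact: hardy_mul.
  exact: inner_proj_defect_linear.
move=> f hf /rowP t0 /rowP y0; set x := phi1 * f in t0 y0.
have hx : hardy x by exact: hardy_mul.
have xM : inner_space phi1 x by exists f.
have P1x : P1 x = x by exact: inner_proj_id.
have hp := hardy_inner_proj i2 hx.
have Tx : T x = 0.
  apply: (hardy_span_eq0 ht (hardy_commutator hx) (tspan _ hx)) => i.
  by have := t0 i; rewrite dotsE mxE.
have P2M : inner_space phi1 (P2 x).
  have /subr0_eq := Tx; rewrite P1x => <-; exact: inner_proj_space.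
have d0 : x - P2 x = 0.
  have hd := hardyB hx hp.
  apply: (hardy_span_eq0 hy hd) => [|i]; last by have := y0 i;
    rewrite dotsE mxE.
  have dM : inner_space phi1 (x - P2 x).
    by apply: subspaceB => //; exact: subspace_inner_space.
  have [|c /subr0_eq ->] := ygen (x - P2 x); last by exists c.
  split; first by rewrite image_inner_proj.
  rewrite /= (inner_proj_id i1 dM) (linear_onB (inner_proj_linear i2) hx hp).
  by rewrite (inner_proj_id i2 (inner_proj_space i2 hx)) subrr.
split => //; rewrite -/x; have /subr0_eq -> := d0.
exact: inner_proj_space.
Qed.

(** Here the cokernel is used. For [x] in [M_2] with vanishing commutator, [x - P1 x] lies in [M_2]
    and is orthogonal to [M_1], hence to [P_2 M_1]; orthogonality to representatives of a basis of
    the cokernel then makes it orthogonal to all of [M_2], in particular to itself. *)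
Lemma fredholm_bound2 : finite_rank T -> fredholm_pair P1 P2 ->
  exists n, forall m (e : 'I_m -> C -> C), (forall i, hardy (e i)) ->
    indep_mod (inner_colon phi2 phi1) e -> (m <= n)%N.
Proof.
move=> /commutator_span[k [t [ht tspan]]] [_ _ _ _ [p [y [yM ygen _]]]].
have hy i : hardy (y i).
  by have [f hf <-] := yM i; exact: hardy_inner_proj.
exists (k + p)%N; apply: (bounded_indep (ls := fun f => dots t (T (phi2 * f)))
    (lr := fun f => dots y (phi2 * f - P1 (phi2 * f)))).
- apply: (dots_linear (F := fun f => T (phi2 * f))) => //.
    by move=> f hf; apply: hardy_commutator; exact: hardy_mul.
  move=> c f g hf hg; rewrite mul_linear commutator_linear //; exact: hardy_mul.
- apply: (dots_linear (F := fun f => phi2 * f - P1 (phi2 * f))) => //.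
    by move=> f hf; apply: hardyB; [|apply: hardy_inner_proj => //];
      exact: hardy_mul.
  exact: inner_proj_defect_linear.
move=> f hf /rowP t0 /rowP y0; set x := phi2 * f in t0 y0.
have hx : hardy x by exact: hardy_mul.
have xM : inner_space phi2 x by exists f.
have P2x : P2 x = x by exact: inner_proj_id.
have hp := hardy_inner_proj i1 hx.
have Tx : T x = 0.
  apply: (hardy_span_eq0 ht (hardy_commutator hx) (tspan _ hx)) => i.
  by have := t0 i; rewrite dotsE mxE.
have P1M : inner_space phi2 (P1 x).
  have /subr0_eq := Tx; rewrite P2x => ->; exact: inner_proj_space.
have hd := hardyB hx hp.
have dM : inner_space phi2 (x - P1 x).
  by apply: subspaceB => //; exact: subspace_inner_space.
have d0 : x - P1 x = 0.
  have [|c [m mM /= cE]] := ygen (x - P1 x); first by rewrite image_inner_proj.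
  rewrite (image_inner_proj i1) in mM.
  have hm := inner_space_hardy i1 mM.
  have hP2m := hardy_inner_proj i2 hm.
  rewrite (inner_proj_id i1 mM) in cE.
  have hs := subspace_sum c (@hardy_subspace R) hy.
  have dE : x - P1 x = P2 m + \sum_i c i *: y i by rewrite cE subrK.
  apply: hardy_dot_eq0 => //; rewrite {1}dE.
  rewrite (linear_onD (hardy_dot_linear hd) hP2m hs) (hardy_dot_span _ hy hd) =>
    [|i]; last first.
    by have := y0 i; rewrite dotsE mxE.
  rewrite addr0.
  (* Since [x - P1 x] lies in [M_2], it has the same inner product with [m] and with [P2 m], and it
     is orthogonal to [m], an element of [M_1]. *)
  have e1 : hardy_dot (m - P2 m) (x - P1 x) = 0 by exact: inner_proj_orth.
  have e2 : hardy_dot m (x - P1 x) = 0.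
    exact: (hardy_dot_sym0 hd hm (inner_proj_orth i1 hx mM)).
  move: e1; rewrite (hardy_dotBl hm hP2m hd) e2 sub0r => /eqP;
    rewrite oppr_eq0 => /eqP.
  by [].
split => //; rewrite -/x; have /subr0_eq -> := d0.
exact: inner_proj_space.
Qed.

End Commutator.
End FredholmPair.

(** * Quotients by the common divisor and computation of the index *)

Section Index.
Variable R : realType.
Notation C := (cplx R).
Implicit Types (f g h u psi theta : C -> C) (z w : C).

(** Both factors are bounded by 1, so [theta 0] has modulus 1. The coefficients of an inner function
    have squared norm 1, and the constant one already exhausts it. *)
Lemma inner_unit theta k : inner theta -> inner k ->
  (forall z, @disc R z -> theta z * k z = 1) ->
  exists2 x : C, `|x| = 1 & forall z, @disc R z -> theta z = x.
Proof.
move=> it ik e; have d0 : @disc R 0 by apply/discE; rewrite nrm0.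
have [[c thc] _ _] := it.
have [lc nc] := inner_l2 it thc.
have t0 : theta 0 = c 0%N.
  rewrite (taylorE thc d0) (csumE (l := c 0%N)) //.
  have h n : (1 <= n)%N -> c n * 0 ^+ n = 0.
    by case: n => // n _; rewrite expr0n mulr0.
  have := series_eventually0 h.
  by rewrite big_ord_recl big_ord0 expr0 mulr1 addr0.
have n1 : nrm (theta 0) = 1.
  have := congr1 nrm (e 0 d0); rewrite nrmM nrm1 => e1.
  have a1 := inner_le1 it d0; have b1 := inner_le1 ik d0.
  apply/eqP; rewrite eq_le a1 /=; rewrite -e1.
  by rewrite ler_piMr ?nrm_ge0.
have cn n : c n.+1 = 0.
  have [_ _ /(_ n.+2)] := nsq_series lc; rewrite nc seriesSr /=.
  have : 1 <= series (sqn \o c) n.+1.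
    have <- : sqn (c 0%N) = 1 by rewrite -t0 /sqn n1 expr1n.
    rewrite /series /= big_nat_recl // lerDl; apply: sumr_ge0 => i _.
    exact: sqn_ge0.
  move=> h1 h2; have : sqn (c n.+1) <= 0.
    by rewrite -(lerD2l (series (sqn \o c) n.+1)) addr0 (le_trans h2).
  rewrite /sqn => h3; apply/eqP; rewrite -nrm_eq0 -sqrf_eq0 eq_le h3.
  exact: sqr_ge0.
exists (theta 0); first by rewrite nrmE n1.
move=> z z1; rewrite t0 (taylorE thc z1) (csumE (l := c 0%N)) //.
have h n : (1 <= n)%N -> c n * z ^+ n = 0.
  by case: n => // n _; rewrite cn mul0r.
have := series_eventually0 h.
by rewrite big_ord_recl big_ord0 expr0 mulr1 addr0.
Qed.

Lemma inner_quotP theta psi : inner_dvd psi theta ->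
  inner (inner_quot theta psi) /\
  forall z, @disc R z -> theta z = psi z * inner_quot theta psi z.
Proof.
move=> [h ih e]; rewrite /inner_quot; case: xgetP => [g _ //|/(_ h)[]].
by split.
Qed.

Section CommonFactor.
Variables phi psi1 psi2 phi1 phi2 : C -> C.
Hypotheses (i : inner phi) (i1 : inner psi1) (i2 : inner psi2).
Hypotheses (j1 : inner phi1) (j2 : inner phi2).
Hypothesis e1 : forall z, @disc R z -> phi1 z = phi z * psi1 z.
Hypothesis e2 : forall z, @disc R z -> phi2 z = phi z * psi2 z.

Lemma mul_disc theta psi rho f : (forall z, @disc R z ->
    theta z = psi z * rho z) ->
  hardy f -> theta * f = psi * (rho * f).
Proof.
move=> e hf; apply/funext => z; rewrite !fctE.
have [z1|z1] := pselect (@disc R z); first by rewrite e // mulrA.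
by have [_ _ f0] := proj1 (hardyP f) hf; rewrite f0 // !mulr0.
Qed.

Lemma inner_cancel_eq theta f g : inner theta -> hardy f -> hardy g ->
  theta * f = theta * g -> f = g.
Proof.
move=> it hf hg e; apply: (inner_cancel it hf hg) => z _.
by have := congr1 (fun h => h z) e; rewrite !fctE.
Qed.

Lemma inner_colon_sub : inner_colon phi1 phi2 `<=` inner_colon psi1 psi2.
Proof.
move=> f [hf [g hg e]]; split => //; exists g => //.
apply: (inner_cancel_eq i); [exact: hardy_mul|exact: hardy_mul|].
by rewrite -(mul_disc e2 hg) e (mul_disc e1 hf).
Qed.

(** After the Blaschke part of [psi2] is split off, the rest [psi] divides both quotients;
    maximality of [phi] makes it constant, and that constant is absorbed into the unimodular
    factor. *)
Lemma gcd_finite_blaschke :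
  (forall psi, inner psi -> inner_dvd psi phi1 -> inner_dvd psi phi2 ->
    inner_dvd psi phi) ->
  (exists n, forall m (e : 'I_m -> C -> C), (forall i, hardy (e i)) ->
    indep_mod (inner_colon phi1 phi2) e -> (m <= n)%N) ->
  finite_blaschke psi2.
Proof.
move=> gcdP [n bnd].
have bnd' m (e : 'I_m -> C -> C) : (forall i, hardy (e i)) ->
    indep_mod (inner_colon psi1 psi2) e -> (m <= n)%N.
  move=> he ie; apply: (bnd m e he) => c Nc; apply: ie.
  exact: inner_colon_sub Nc.
have [B [psi [[d bB] ip e3 [h ih e4]]]] := inner_colon_blaschke i1 i2 bnd'.
have iB := inner_blaschke bB.
have irho := innerM i ip.
(* [phi psi] is a common divisor, so it divides [phi]; cancelling [phi] will give [psi k = 1]. *)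
have [| |k ik ek] := gcdP _ irho.
- by exists h => // z z1; rewrite e1 // e4 // mulrA.
- by exists B => // z z1; rewrite e2 // e3 //; ring.
have pk z : @disc R z -> psi z * k z = 1.
  move=> z1.
  have hk : hardy (restr (fun z => psi z * k z)) by apply: hardy_inner;
    exact: innerM.
  have := inner_cancel i hk (@hardy_hardy1 R) _ => /(_ _)/(congr1 (fun f =>
    f z)).
  rewrite /hardy1 !restrE //; apply => w w1.
  by rewrite !restrE // mulr1 mulrA -ek.
have [x x1 px] := inner_unit ip ik pk.
have [y [a [y1 a1 BE]]] := bB.
exists d, (x * y), a; split => //; first by rewrite normrM x1 y1 mulr1.
by move=> z z1; rewrite e3 // px // BE // mulrC mulrA.
Qed.

Section Blaschke.
Variables n1 n2 : nat.
Hypotheses (b1 : blaschke_product n1 psi1) (b2 : blaschke_product n2 psi2).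

Notation P1 := (inner_proj phi1).
Notation P2 := (inner_proj phi2).
Notation M1 := [set P1 f | f in @hardy R].
Notation M2 := [set P2 f | f in @hardy R].
Notation T := (P2 \o P1).

(** [K] is the model space of [psi2], the orthogonal complement of [psi2 H^2]. *)
Let K : set (C -> C) := [set f | hardy f /\ adjoint psi2 f = 0].

Let sH := @hardy_subspace R.

Let subspace_K : is_subspace K.
Proof.
split; first by split; [exact: hardy0|exact: linear_on0 sH (adjoint_linear i2)].
move=> c f g [hf f0] [hg g0]; split; first exact: (proj2 sH).
by rewrite (adjoint_linear i2 c hf hg) f0 g0 scaler0 addr0.
Qed.

Let decompose f : hardy f -> K (f - psi2 * adjoint psi2 f).
Proof.
move=> hf; have ha := adjoint_hardy i2 hf; have hp := hardy_mul i2 ha.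
split; first exact: hardyB.
by rewrite (linear_onB (adjoint_linear i2) hf hp) adjoint_mul // subrr.
Qed.

(** The projection [D] onto [K] has kernel [psi2 H^2], so it carries a basis of the quotient by
    [psi2 H^2] to a basis of [K]. *)
Let K_basis : exists k : 'I_n2 -> C -> C, quotient_basis K [set 0] k.
Proof.
have [e [he gen ind]] := blaschke_codim b2.
pose D f := f - psi2 * adjoint psi2 f.
have DL : linear_on (@hardy R) D.
  move=> c f g hf hg; rewrite /D (adjoint_linear i2 c hf hg) mul_linear.
  by rewrite opprD addrACA -scalerBr.
have hD f : hardy f -> hardy (D f) by move=> hf; case: (decompose hf).
have DP f : hardy f -> D (psi2 * f) = 0.
  by move=> hf; rewrite /D adjoint_mul // subrr.
exists (fun i => D (e i)); split => [j|x [hx x0]|c Dc].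
- exact: decompose.
- have [c [g hg eg]] := gen _ hx; exists c => /=.
  rewrite -(linear_on_sum _ sH DL he).
  have hs := subspace_sum c sH he.
  have Dx : D x = x by rewrite /D x0; apply/funext => z;
    rewrite !fctE mulr0 subr0.
  by rewrite -{1}Dx -(linear_onB DL hx hs) -eg DP.
- apply: ind; have hs := subspace_sum c sH he.
  exists (adjoint psi2 (\sum_i c i *: e i)); first exact: adjoint_hardy.
  by apply/esym/subr0_eq; rewrite -[LHS]/(D _) (linear_on_sum _ sH DL he).
Qed.

(** Multiplication by [phi2] is multiplication by [psi2] followed by the isometry [phi], and the
    adjoint of an isometry undoes it. *)
Let adjoint_phi2 f : hardy f -> adjoint phi2 (phi * f) = adjoint psi2 f.
Proof.
move=> hf; have ha := adjoint_hardy i2 hf; have hpf := hardy_mul i hf.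
apply: (adjoint_uniq j2 hpf ha) => g hg.
rewrite (mul_disc e2 hg) (hardy_dot_mul i hf (hardy_mul i2 hg)).
exact: adjointE.
Qed.

Let T_phi1 f : hardy f -> T (phi1 * f) = phi2 * adjoint psi2 (psi1 * f).
Proof.
move=> hf; have h1 := hardy_mul j1 hf.
rewrite /= (inner_proj_id j1); last by exists f.
by rewrite (inner_projE j2 h1) (mul_disc e1 hf) (adjoint_phi2 (hardy_mul i1
  hf)).
Qed.

Let M1E : M1 = inner_space phi1 := image_inner_proj j1.
Let M2E : M2 = inner_space phi2 := image_inner_proj j2.

Let T_linear : forall (c : C) f g, M1 f -> M1 g ->
  T (c *: f + g) = c *: T f + T g.
Proof.
move=> c f g; rewrite M1E => /(inner_space_hardy j1) hf /(inner_space_hardy j1)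
  hg.
have hpf := hardy_inner_proj j1 hf; have hpg := hardy_inner_proj j1 hg.
by rewrite /= (inner_proj_linear j1 c hf hg) (inner_proj_linear j2 c hpf hpg).
Qed.

Let ker := [set f | M1 f /\ T f = 0].
Let ran := [set T f | f in M1].

Let sM1 : is_subspace M1. Proof. by rewrite M1E;
  exact: subspace_inner_space. Qed.
Let sM2 : is_subspace M2. Proof. by rewrite M2E;
  exact: subspace_inner_space. Qed.

Let subspace_ker : is_subspace ker.
Proof.
have [h0 hL] := sM1; split; first by split => //;
  exact: linear_on0 sM1 T_linear.
move=> c f g [Mf f0] [Mg g0]; split; first exact: hL.
by rewrite T_linear // f0 g0 scaler0 addr0.
Qed.

Let subspace_ran : is_subspace ran.
Proof.
have [h0 hL] := sM1; split; first by exists 0 => //;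
  exact: linear_on0 sM1 T_linear.
move=> c _ _ [f Mf <-] [g Mg <-]; exists (c *: f + g); first exact: hL.
exact: T_linear.
Qed.

(** An element of [phi1 H^2] is [phi] times one of [psi1 H^2], and [T] kills the former exactly when
    [adjoint psi2] kills the latter. *)
Let ker_basis d (f : 'I_d -> C -> C) :
  quotient_basis (inner_space psi1 `&` K) [set 0] f ->
  quotient_basis ker [set 0] (fun i => phi * f i).
Proof.
move=> [fV gen ind].
have hf j : hardy (f j) by case: (fV j) => _ [].
split => [j|x|c].
- have [[g hg fE] [_ f0]] := fV j.
  have e : phi * f j = phi1 * g by rewrite (mul_disc e1 hg) -fE.
  split; first by rewrite M1E e; exists g.
  rewrite e T_phi1 // fE f0.
  by apply/funext => z; rewrite !fctE mulr0.
- move=> [+ Tx]; rewrite M1E => -[g hg xE].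
  have hg1 := hardy_mul i1 hg; have ha := adjoint_hardy i2 hg1.
  move: Tx; rewrite -xE T_phi1 // => e3.
  have a0 : adjoint psi2 (psi1 * g) = 0.
    apply: (inner_cancel_eq j2 ha (@hardy0 R)); rewrite e3.
    by apply/funext => z; rewrite !fctE mulr0.
  have [|c /subr0_eq cE] := gen (psi1 * g); first by split; [exists g|split].
  by exists c => /=; rewrite -mul_sum -cE (mul_disc e1 hg) subrr.
- rewrite -mul_sum => e0; apply: ind => /=.
  have hs := subspace_sum c sH hf.
  apply: (inner_cancel_eq i hs (@hardy0 R)); rewrite e0.
  by apply/funext => z; rewrite !fctE mulr0.
Qed.

(** [adjoint psi2] maps [H^2] onto itself with kernel [K]. A combination therefore lands in the
    image of [psi1 H^2] exactly when it lies in [psi1 H^2 + K] before the map is applied. *)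
Let ran_basis d (g : 'I_d -> C -> C) :
  quotient_basis (@hardy R) [set x | exists2 y,
    K y & inner_space psi1 (x - y)] g ->
  quotient_basis M2 ran (fun i => phi2 * adjoint psi2 (g i)).
Proof.
move=> [hg gen ind].
have ha j : hardy (adjoint psi2 (g j)) by exact: adjoint_hardy.
have AL := adjoint_linear i2.
split => [j|x|c].
- by rewrite M2E; exists (adjoint psi2 (g j)).
- rewrite M2E => -[h hh <-]; have hp := hardy_mul i2 hh.
  have [c [y [hy y0] [m hm eq]]] := gen _ hp.
  exists c; have hs := subspace_sum c sH hg.
  have hm1 := hardy_mul i1 hm.
  exists (phi1 * m); first by rewrite M1E; exists m.
  rewrite T_phi1 // eq (linear_onB AL (hardyB hp hs) hy) y0 subr0.
  rewrite (linear_onB AL hp hs) adjoint_mul // (linear_on_sum _ sH AL hg).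
  by rewrite mulrBr mul_sum.
- move=> [x]; rewrite M1E => -[m hm <-]; rewrite T_phi1 // -mul_sum => e.
  apply: ind; have hs := subspace_sum c sH hg; have hm1 := hardy_mul i1 hm.
  have e3 : adjoint psi2 (psi1 * m) = adjoint psi2 (\sum_i c i *: g i).
    rewrite (linear_on_sum _ sH AL hg).
    apply: (inner_cancel_eq j2 (adjoint_hardy i2 hm1) _ e).
    exact: subspace_sum sH ha.
  exists (\sum_i c i *: g i - psi1 * m).
    split; first exact: hardyB.
    by rewrite (linear_onB AL hs hm1) e3 subrr.
  by rewrite opprB addrC subrK; exists m.
Qed.

Lemma blaschke_fredholm : fredholm_pair P1 P2 /\
  pair_index P1 P2 = (n2%:Z - n1%:Z)%R.
Proof.
have [e eb] := blaschke_codim b1; have [k kb] := K_basis.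
have s1 := subspace_inner_space psi1.
have W1 : inner_space psi1 `<=` @hardy R by move=> f /(inner_space_hardy i1).
have KH : K `<=` @hardy R by move=> f [].
(* The map [K -> H^2 / psi1 H^2] goes from dimension [n2] to dimension [n1]; its kernel and cokernel
   are those of the pair. *)
have [d [d' [[f fb] [g gb] dd]]] :=
  quotient_basis_index sH s1 subspace_K W1 KH eb kb.
have kerb := ker_basis fb; have ranb := ran_basis gb.
have s0 : is_subspace [set (0 : C -> C)].
  by split => // c x y -> ->; rewrite scaler0 addr0.
split; last first.
  rewrite /pair_index /fredholm_index -dd /Defs.dim.
  by rewrite (dim_modE subspace_ker s0 kerb) (dim_modE sM2 subspace_ran ranb).
split.
- move=> x; rewrite M1E => /(inner_space_hardy j1) hx.
  by exists (P1 x) => //; exact: hardy_inner_proj.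
- exact: T_linear.
- exists 1 => x; rewrite M1E mul1r => xM; have hx := inner_space_hardy j1 xM.
  by rewrite /= (inner_proj_id j1 xM); exact: inner_proj_le.
- by exists d; eexists; exact: kerb.
- by exists d'; eexists; exact: ranb.
Qed.

End Blaschke.
End CommonFactor.
End Index.

Theorem corollary4p6 (R : realType) (phi1 phi2 phi : cplx R -> cplx R)
    (inner1 : inner phi1) (inner2 : inner phi2)
    (comm_finite_rank :
       finite_rank (commutator (inner_proj phi1) (inner_proj phi2)))
    (gcd_phi : inner_gcd phi1 phi2 phi) :
  (fredholm_pair (inner_proj phi1) (inner_proj phi2) <->
     finite_blaschke (inner_quot phi1 phi) /\
     finite_blaschke (inner_quot phi2 phi)) /\
  (fredholm_pair (inner_proj phi1) (inner_proj phi2) ->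
     pair_index (inner_proj phi1) (inner_proj phi2) =
       (blaschke_degree (inner_quot phi2 phi))%:Z -
       (blaschke_degree (inner_quot phi1 phi))%:Z).
Proof.
have [i dv1 dv2 gcdP] := gcd_phi.
have [i1 e1] := inner_quotP dv1; have [i2 e2] := inner_quotP dv2.
have fwd : fredholm_pair (inner_proj phi1) (inner_proj phi2) ->
    finite_blaschke (inner_quot phi1 phi) /\ finite_blaschke (inner_quot phi2 phi).
  move=> fp; split.
    (* The roles are exchanged: [gcd_finite_blaschke] concludes about its second quotient, so the
       bound on [inner_colon phi2 phi1] is the one that handles [phi1]. *)
    apply: (gcd_finite_blaschke i i2 i1 e2 e1) => [psi ip d2 d1|]; first exact: gcdP.
    exact: fredholm_bound2.
  apply: (gcd_finite_blaschke i i1 i2 e1 e2) => [psi ip d1 d2|]; first exact: gcdP.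
  exact: fredholm_bound1.
split.
  split=> // -[[n1 b1] [n2 b2]].
  by have [] := blaschke_fredholm i i1 i2 inner1 inner2 e1 e2 b1 b2.
move=> /fwd[[n1 b1] [n2 b2]].
have [_ ->] := blaschke_fredholm i i1 i2 inner1 inner2 e1 e2 b1 b2.
by rewrite (blaschke_degreeE b1) (blaschke_degreeE b2).
Qed.
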